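(* Let $1<p<\infty$, $p\neq 2$, and let $\mathcal{U}$ be a selective nonprincipal ultrafilter on $\mathbb{N}$. Then there is a unique complemented closed subspace $M$ of $\widehat{L^{p}}$ with the following property: an operator $S\in B((L^{p})^{\mathcal{U}})$ belongs to the WOT closure of $\{T^{\mathcal{U}}:T\in B(L^{p})\}$ if and only if all three subspaces $L^{p}$, $\widehat{L^{p}}$ and $M$ of $(L^{p})^{\mathcal{U}}$ are invariant under $S$.
   Context: $L^{p}=L^{p}([0,1],\mu)$ with $\mu$ Lebesgue measure; scalars are real (the result also holds over $\mathbb{C}$). For a Banach space $X$ and a nonprincipal ultrafilter $\mathcal{U}$ on $\mathbb{N}$, $X^{\mathcal{U}}$ is the ultrapower: bounded sequences $(x_n)_{n\ge1}$ in $X$ modulo those with $\lim_{n,\mathcal{U}}\|x_n\|=0$, normed by $\|(x_n)_{n,\mathcal{U}}\|=\lim_{n,\mathcal{U}}\|x_n\|$; $(x_n)_{n,\mathcal{U}}$ denotes the class of $(x_n)$. For $T\in B(X)$, $T^{\mathcal{U}}\in B(X^{\mathcal{U}})$ is $(x_n)_{n,\mathcal{U}}\mapsto(Tx_n)_{n,\mathcal{U}}$. $X$ is identified with the subspace of constant classes $\{(x)_{n,\mathcal{U}}:x\in X\}$. For reflexive $X$, $\widehat{X}=\{(x_n)_{n,\mathcal{U}}: w\text{-}\lim_{n,\mathcal{U}}x_n=0\}$ (weak limit along $\mathcal{U}$), and $X^{\mathcal{U}}=X\oplus\widehat{X}$ via the projection $(x_n)_{n,\mathcal{U}}\mapsto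 w\text{-}\lim_{n,\mathcal{U}}x_n$. An ultrafilter $\mathcal{U}$ on $\mathbb{N}$ is selective if (1) for every sequence $A_1,A_2,\dots$ in $\mathcal{U}$ there is $A\in\mathcal{U}$ with $A\setminus A_k$ finite for each $k$; and (2) for every partition of $\mathbb{N}$ into finite sets $A_1,A_2,\dots$ there is $A\in\mathcal{U}$ with $A\cap A_k$ a singleton for each $k$. WOT denotes the weak operator topology. *)

(* Defs.v *)
(* Concrete model of L^p[0,1], its ultrapower,
   bounded operators, duals and the weak operator topology, with elements
   of quotient spaces represented by representatives. *)
From mathcomp Require Import all_boot all_order all_algebra.
From mathcomp Require Import all_classical all_reals all_analysis.
Set Implicit Arguments. Unset Strict Implicit. Unset Printing Implicit Defensive.
Import Order.TTheory GRing.Theory Num.Theory.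
Local Open Scope classical_set_scope.
Local Open Scope ring_scope.

Section Defs.
Variables (R : realType) (p : R).

Definition I01 : set R := `[(0:R), (1:R)].
Definition Lp (f : R -> R) : Prop :=
  measurable_fun I01 f /\
  (\int[(@lebesgue_measure R)]_(t in I01) ((`|f t| `^ p)%:E) < +oo)%E.

Definition lpn (f : R -> R) : R :=
  (fine (\int[(@lebesgue_measure R)]_(t in I01) ((`|f t| `^ p)%:E)))
    `^ p^-1.

Definition fadd (f g : R -> R) : R -> R := fun t => f t + g t.
Definition fsub (f g : R -> R) : R -> R := fun t => f t - g t.
Definition fscale (a : R) (f : R -> R) : R -> R := fun t => a * f t.

(* representatives T : (R -> R) -> (R -> R) of bounded operators on L^p *)
Definition LpOp (T : (R -> R) -> (R -> R)) : Prop :=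
  (forall f, Lp f -> Lp (T f)) /\
  (forall f g, Lp f -> Lp g -> lpn (fsub f g) = 0 -> lpn (fsub (T f) (T g)) = 0) /\
  (forall f g, Lp f -> Lp g -> lpn (fsub (T (fadd f g)) (fadd (T f) (T g))) = 0) /\
  (forall a f, Lp f -> lpn (fsub (T (fscale a f)) (fscale a (T f))) = 0) /\
  (exists C : R, forall f, Lp f -> lpn (T f) <= C * lpn f).

Definition LpDual (phi : (R -> R) -> R) : Prop :=
  (forall f g, Lp f -> Lp g -> phi (fadd f g) = phi f + phi g) /\
  (forall a f, Lp f -> phi (fscale a f) = a * phi f) /\
  (exists C : R, forall f, Lp f -> `|phi f| <= C * lpn f).

Definition ultrafilter_nat (U : set (set nat)) : Prop :=
  ~ U set0 /\ U setT /\
  (forall A B, U A -> A `<=` B -> U B) /\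
  (forall A B, U A -> U B -> U (A `&` B)) /\
  (forall A, U A \/ U (~` A)).

Definition nonprincipal (U : set (set nat)) : Prop := forall n, ~ U [set n].

Definition selective (U : set (set nat)) : Prop :=
  (forall A : nat -> set nat, (forall k, U (A k)) ->
     exists B, U B /\ forall k, finite_set (B `\` A k)) /\
  (forall A : nat -> set nat,
     (forall k, finite_set (A k)) -> (forall k, A k !=set0) ->
     (forall k l, k <> l -> A k `&` A l = set0) ->
     \bigcup_k A k = setT ->
     exists B, U B /\ forall k, exists n, B `&` A k = [set n]).

Definition ulim (U : set (set nat)) (a : nat -> R) (l : R) : Prop :=
  forall e : R, 0 < e -> U [set n | `|a n - l| < e].

Definition useq := nat -> R -> R.

Definition UP (x : useq) : Prop :=
  (forall n, Lp (x n)) /\ exists M : R, forall n, lpn (x n) <= M.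

Definition uadd (x y : useq) : useq := fun n => fadd (x n) (y n).
Definition usub (x y : useq) : useq := fun n => fsub (x n) (y n).
Definition uscale (a : R) (x : useq) : useq := fun n => fscale a (x n).
Definition uzero : useq := fun _ _ => 0.

Definition unorm (U : set (set nat)) (x : useq) (r : R) : Prop :=
  ulim U (fun n => lpn (x n)) r.

Definition ueq (U : set (set nat)) (x y : useq) : Prop := unorm U (usub x y) 0.

(* representatives S of bounded operators on (L^p)^U *)
Definition UOp (U : set (set nat)) (S : useq -> useq) : Prop :=
  (forall x, UP x -> UP (S x)) /\
  (forall x y, UP x -> UP y -> ueq U x y -> ueq U (S x) (S y)) /\
  (forall x y, UP x -> UP y -> ueq U (S (uadd x y)) (uadd (S x) (S y))) /\
  (forall a x, UP x -> ueq U (S (uscale a x)) (uscale a (S x))) /\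
  (exists C : R, forall x a b, UP x -> unorm U x a -> unorm U (S x) b -> b <= C * a).

Definition UDual (U : set (set nat)) (phi : useq -> R) : Prop :=
  (forall x y, UP x -> UP y -> ueq U x y -> phi x = phi y) /\
  (forall x y, UP x -> UP y -> phi (uadd x y) = phi x + phi y) /\
  (forall a x, UP x -> phi (uscale a x) = a * phi x) /\
  (exists C : R, forall x a, UP x -> unorm U x a -> `|phi x| <= C * a).

Definition ultraop (T : (R -> R) -> (R -> R)) : useq -> useq := fun x n => T (x n).

(* closed linear subspaces of (L^p)^U, as ueq-saturated sets of representatives *)
Definition usubspace (U : set (set nat)) (A : set useq) : Prop :=
  A `<=` UP /\
  (forall x y, A x -> UP y -> ueq U x y -> A y) /\
  A uzero /\
  (forall x y, A x -> A y -> A (uadd x y)) /\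
  (forall a x, A x -> A (uscale a x)).

Definition uclosed (U : set (set nat)) (A : set useq) : Prop :=
  forall x, UP x ->
    (forall e : R, 0 < e -> exists y r, A y /\ unorm U (usub x y) r /\ r < e) -> A x.

Definition Lconst (U : set (set nat)) : set useq :=
  [set x | UP x /\ exists f, Lp f /\ ueq U x (fun _ => f)].

Definition Lhat (U : set (set nat)) : set useq :=
  [set x | UP x /\ forall phi, LpDual phi -> ulim U (fun n => phi (x n)) 0].

Definition complemented_in (U : set (set nat)) (D M : set useq) : Prop :=
  exists P : useq -> useq,
    (forall x, D x -> M (P x)) /\
    (forall x y, D x -> D y -> ueq U x y -> ueq U (P x) (P y)) /\
    (forall x y, D x -> D y -> ueq U (P (uadd x y)) (uadd (P x) (P y))) /\
    (forall a x, D x -> ueq U (P (uscale a x)) (uscale a (P x))) /\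
    (exists C : R, forall x a b, D x -> unorm U x a -> unorm U (P x) b -> b <= C * a) /\
    (forall m, M m -> ueq U (P m) m).

Definition uinvariant (S : useq -> useq) (A : set useq) : Prop :=
  forall x, A x -> A (S x).

Definition WOT_closure_ultraops (U : set (set nat)) (S : useq -> useq) : Prop :=
  forall (k : nat) (xs : 'I_k -> useq) (phis : 'I_k -> useq -> R) (e : R),
    0 < e -> (forall i, UP (xs i)) -> (forall i, UDual U (phis i)) ->
    exists T, LpOp T /\
      forall i, `|phis i (S (xs i)) - phis i (ultraop T (xs i))| < e.

End Defs.

(* Main.v *)
(** Write [<f, g>] for the duality between L^p and L^q.  Every bounded sequence in L^p
    splits, modulo null sequences, into a part tending to zero in L^1 ([Dz]) and a part
    with uniformly integrable p-th powers ([Bz]).  The subspace [M] is [Dz] when [p > 2]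
    and the weakly null part of [Bz] when [p < 2].

    [M] is invariant under ultraoperators: for [p > 2], signed sums of [N] terms of a
    concentrating sequence have p-norm of order [N^(1/p)], while their images would have
    2-norm at least of order [N^(1/2)] if they did not tend to zero in L^1; the case
    [p < 2] follows by passing to adjoints.  The three invariance conditions are stable
    under weak operator limits because the subspaces are annihilators of functionals
    [x |-> lim <x_n, psi_n>].

    Conversely, selectivity provides a set in [U] along which a weakly null sequence [g]
    satisfies an upper s-estimate and [psi] an upper s'-estimate, with s, s' conjugate,
    while the coefficients [<h_i, psi_j>], [i <> j], are summably small.  Then
    [T x = sum_i <x, psi_i> g_i] is bounded and [T^U] acts on given weakly null classes
    as the rank one operator [lim <., psi_n> g].  The exponents of the upper estimates are
    conjugate as soon as [psi] annihilates [M] or [g] lies in (a dense part of) [M];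
    by linear algebra these operators approximate, on finite families, every operator that
    leaves L^p, its complement and [M] invariant.

    For uniqueness, rank one operators on the ultrapower show that any other candidate is
    [0] or the whole weakly null part, and concentrating and oscillating sequences show
    that [M] is neither. *)
Require Import Defs.
From mathcomp Require Import all_boot all_order all_algebra.
From mathcomp Require Import all_classical all_reals all_analysis.
From mathcomp Require Import measurable_realfun ring lra.
From HB Require Import structures.
Set Implicit Arguments. Unset Strict Implicit. Unset Printing Implicit Defensive.
Import Order.TTheory GRing.Theory Num.Theory.
Import numFieldNormedType.Exports.
Local Open Scope classical_set_scope.
Local Open Scope ring_scope.
(** * Powers of real numbers *)

Section powers.
Context {R : realType}.
Implicit Types (r s a b c t u v w : R).

(** The obstacle is one of exponents. The series [sum_i <x, psi_i> g_i] defines a bounded operator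
    if the coefficients are bounded in l^s, which is dual to an upper s'-estimate of [psi], and [g]
    has an upper s-estimate. A weakly null sequence in L^r has in general only an upper min(r,
    2)-estimate: the linear term in the expansion of [|a + c x|^r] disappears in the limit, the
    remainder does not. For conjugate p and q, the exponents min(p, 2) and min(q, 2) are conjugate
    only if p = 2. If p > 2 they are 2 and q, and one has to be improved: a concentrating [g] has
    the exponent p, and a [psi] bounded in L^2 has the exponent 2. If p < 2 the improvements are a
    concentrating [psi], with exponent q, and a [g] bounded in L^2. The two kinds of sequences
    annihilate each other, and [M] records exactly this dichotomy: tests that annihilate [M] allow
    every target, targets in [M] allow every test. *)

Definition conj_exp r s := [/\ 1 < r, 1 < s & r^-1 + s^-1 = 1].

Lemma conj_expC r s : conj_exp r s -> conj_exp s r.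
Proof. by move=> [r1 s1 rs]; split=> //; rewrite addrC. Qed.

Lemma conj_exp_ex r : 1 < r -> conj_exp r (r / (r - 1)).
Proof.
move=> r1; have r0 : r - 1 != 0 by rewrite subr_eq0 gt_eqF.
have rn : r != 0 by rewrite gt_eqF // (lt_trans _ r1).
split=> //; last by field; apply/andP.
by rewrite ltr_pdivlMr ?subr_gt0 // mul1r gtrBl.
Qed.

Lemma conj_exp22 : conj_exp (2:R) 2.
Proof. by split; [lra|lra|field]. Qed.

Lemma conj_exp_mul r s : conj_exp r s -> (r - 1) * s = r.
Proof.
move=> [r1 s1 rs].
have rn : r != 0 by rewrite gt_eqF // (lt_trans _ r1).
have sn : s != 0 by rewrite gt_eqF // (lt_trans _ s1).
have : (r^-1 + s^-1) * (r * s) = r * s by rewrite rs mul1r.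
have -> : (r^-1 + s^-1) * (r * s) = s + r by field; apply/andP.
move=> h; rewrite mulrBl mul1r -h; ring.
Qed.

Lemma conj_exp_lt2 r s : conj_exp r s -> r < 2 -> 2 < s.
Proof.
move=> c r2; have := conj_exp_mul c; case: c => r1 s1 _ h; nra.
Qed.

Lemma conj_exp_gt2 r s : conj_exp r s -> 2 < r -> s < 2.
Proof.
move=> c r2; have := conj_exp_mul c; case: c => r1 s1 _ h; nra.
Qed.

Lemma ler_powR2r r u v : 0 <= r -> 0 <= u -> u <= v -> u `^ r <= v `^ r.
Proof.
move=> r0 u0 uv; apply: ge0_ler_powR => //; rewrite nnegrE //.
exact: le_trans uv.
Qed.

Lemma powR_invK r u : 0 < r -> 0 <= u -> (u `^ r^-1) `^ r = u.
Proof. by move=> r0 u0; rewrite -powRrM mulVf ?gt_eqF // powRr1. Qed.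

Lemma powRK_inv r u : 0 < r -> 0 <= u -> (u `^ r) `^ r^-1 = u.
Proof. by move=> r0 u0; rewrite -powRrM mulfV ?gt_eqF // powRr1. Qed.

Lemma powRS r u : 0 <= u -> 1 < r -> u `^ (r - 1) * u = u `^ r.
Proof. by move=> u0 r1; rewrite mulrC mulr_powRB1 // (lt_trans _ r1). Qed.

(* The signed power that is the derivative of [|t|^r / r] and the duality map of L^r. *)
Definition dmap r t := Num.sg t * `|t| `^ (r - 1).

Lemma normr_dmap r t : 1 < r -> `|dmap r t| = `|t| `^ (r - 1).
Proof.
move=> r1; rewrite /dmap normrM normr_sg.
case: eqVneq => [->|_]; last by rewrite mul1r ger0_norm ?powR_ge0.
by rewrite mul0r normr0 powR0 // subr_eq0 gt_eqF.
Qed.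

Lemma dmap_mul r t : 1 < r -> dmap r t * t = `|t| `^ r.
Proof.
move=> r1; rewrite /dmap mulrAC -normrEsg mulrC.
by rewrite powRS.
Qed.

Lemma dmap_conj r s t : conj_exp r s -> `|dmap r t| `^ s = `|t| `^ r.
Proof.
by move=> c; rewrite normr_dmap; [rewrite -powRrM (conj_exp_mul c)|case: c].
Qed.

Lemma young r s a b : conj_exp r s ->
  `|a * b| <= `|a| `^ r / r + `|b| `^ s / s.
Proof.
move=> [r1 s1 rs]; rewrite normrM; apply: conjugate_powR => //.
- exact: lt_trans r1.
- exact: lt_trans s1.
Qed.

Lemma young1 r s a b : conj_exp r s -> `|a * b| <= `|a| `^ r + `|b| `^ s.
Proof.
move=> c; apply: (le_trans (young _ _ c)); case: c => r1 s1 _.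
by apply: lerD; rewrite ler_pdivrMr; [|lra| |lra]; rewrite ler_peMr ?powR_ge0 // ltW.
Qed.

(** Convexity of [v^r], obtained from Young's inequality for [u^(r-1)] and [v] rather than from a
    derivative. *)
Lemma powR_tangent r u v : 1 < r -> 0 <= u -> 0 <= v ->
  u `^ r + r * u `^ (r - 1) * (v - u) <= v `^ r.
Proof.
move=> r1 u0 v0.
have cs := conj_expC (conj_exp_ex r1); set s := r / (r - 1) in cs.
have := @young _ _ (u `^ (r - 1)) v cs.
rewrite normrM !ger0_norm ?powR_ge0 // -powRrM.
have -> : (r - 1) * s = r by exact: (conj_exp_mul (conj_expC cs)).
have -> : r * u `^ (r - 1) * (v - u) = r * (u `^ (r - 1) * v) - r * u `^ r.
  by rewrite -(powRS u0 r1); ring.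
have -> : s^-1 = 1 - r^-1 by case: cs => _ _ <-; rewrite addrK.
move=> h; have r0 : 0 < r by lra.
have := ler_pM2l r0 (u `^ (r - 1) * v) (u `^ r * (1 - r^-1) + v `^ r / r).
rewrite h; have -> : r * (u `^ r * (1 - r^-1) + v `^ r / r) = r * u `^ r - u `^ r + v `^ r.
  by field; rewrite gt_eqF.
by move=> ?; lra.
Qed.

(** The tangent is taken at [a + b] and evaluated at [|a|], so it yields an upper bound; both
    expansions of [|a + b|^r] used later start from it. *)
Lemma normr_powR_tangent r a b : 1 < r ->
  `|a + b| `^ r <= `|a| `^ r + r * (dmap r (a + b) * b).
Proof.
move=> r1.
have := @powR_tangent r `|a + b| `|a| r1 (normr_ge0 _) (normr_ge0 _).
suff : `|a + b| `^ (r - 1) * `|a + b| - `|a + b| `^ (r - 1) * `|a| <= dmap r (a + b) * b by nra.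
rewrite powRS // -(dmap_mul _ r1) [X in X - _]mulrDr.
have : dmap r (a + b) * a <= `|a + b| `^ (r - 1) * `|a|.
  by rewrite -(normr_dmap _ r1) -normrM ler_norm.
by lra.
Qed.

Lemma powR_addr_le r u v : 0 <= r -> 0 <= u -> 0 <= v ->
  (u + v) `^ r <= 2 `^ r * (u `^ r + v `^ r).
Proof.
move=> r0.
wlog uv : u v / u <= v => [H|] u0 v0.
  case: (leP u v) => [/H|/ltW/H]; first exact.
  by rewrite addrC [u `^ r + _]addrC; exact.
apply: (@le_trans _ _ ((2 * v) `^ r)); first by apply: ler_powR2r; lra.
by rewrite powRM // ler_wpM2l ?powR_ge0 // lerDr powR_ge0.
Qed.

Lemma normr_powR_add_le r a b : 0 <= r ->
  `|a + b| `^ r <= 2 `^ r * (`|a| `^ r + `|b| `^ r).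
Proof.
move=> r0; apply: le_trans (powR_addr_le r0 (normr_ge0 a) (normr_ge0 b)).
by apply: ler_powR2r => //; rewrite ler_normD.
Qed.

(** Adapted to [b] almost disjoint from [a]: the middle term pairs the fixed function [|a|^(r-1)]
    with [|b|], and its integral vanishes when [b] runs through a concentrating sequence. *)
Lemma normr_powR_add_cross r a b : 1 < r ->
  `|a + b| `^ r <=
    `|a| `^ r + r * 2 `^ r * (`|a| `^ (r - 1) * `|b|) + r * 2 `^ r * `|b| `^ r.
Proof.
move=> r1; apply: le_trans (normr_powR_tangent _ _ r1) _.
have h1 : dmap r (a + b) * b <= `|a + b| `^ (r - 1) * `|b|.
  by rewrite -(normr_dmap _ r1) -normrM ler_norm.
have r10 : 0 <= r - 1 by lra.
have h2 := normr_powR_add_le a b r10.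
have h3 : `|a + b| `^ (r - 1) * `|b| <= 2 `^ r * (`|a| `^ (r - 1) * `|b| + `|b| `^ r).
  apply: (@le_trans _ _ (2 `^ (r - 1) * (`|a| `^ (r - 1) + `|b| `^ (r - 1)) * `|b|)).
    by rewrite ler_wpM2r.
  rewrite -mulrA [(_ + _) * `|b|]mulrDl powRS //.
  rewrite ler_wpM2r ?addr_ge0 ?mulr_ge0 ?powR_ge0 //.
  by apply: ler_powR; lra.
have := le_trans h1 h3; rewrite -(ler_pM2l (_ : 0 < r)); last lra.
by rewrite -addrA -!mulrA -mulrDr -mulrDr; lra.
Qed.

Lemma powR_subadd r u v : 0 < r -> r <= 1 -> 0 <= u -> 0 <= v ->
  (u + v) `^ r <= u `^ r + v `^ r.
Proof.
move=> r0 r1 u0 v0; have [->|w0] := eqVneq (u + v) 0.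
  by rewrite powR0 ?gt_eqF // addr_ge0 ?powR_ge0.
have wp : 0 < u + v by rewrite lt_neqAle eq_sym w0 addr_ge0.
(* [x <= x^r] on [0, 1], applied to the proportion of [x] in [u + v]; the instances for [u] and [v]
   add up to the claim. *)
have key (x : R) : 0 <= x -> x <= u + v -> (u + v) `^ r * (x / (u + v)) <= x `^ r.
  move=> x0 xw; have [->|xn] := eqVneq x 0.
    by rewrite mul0r mulr0 powR_ge0.
  have xp : 0 < x by rewrite lt_neqAle eq_sym xn.
  have -> : x `^ r = (u + v) `^ r * (x / (u + v)) `^ r.
    by rewrite -powRM ?divr_ge0 ?(ltW wp) // mulrC mulfVK.
  rewrite ler_wpM2l ?powR_ge0 // ger1_powR //.
  by rewrite divr_gt0 //= ler_pdivrMr // mul1r.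
have := lerD (key u u0 _) (key v v0 _).
rewrite -mulrDr -mulrDl divff // mulr1; apply; lra.
Qed.

Lemma dmap0 r : dmap r 0 = 0. Proof. by rewrite /dmap sgr0 mul0r. Qed.

Lemma dmapN r t : dmap r (- t) = - dmap r t.
Proof. by rewrite /dmap sgrN normrN mulNr. Qed.

Lemma dmap_ge0E r t : 1 < r -> 0 <= t -> dmap r t = t `^ (r - 1).
Proof.
move=> r1; rewrite le_eqVlt => /predU1P[<-|t0].
  by rewrite dmap0 powR0 // subr_eq0 gt_eqF.
by rewrite /dmap gtr0_sg // mul1r gtr0_norm.
Qed.

(** For equal signs this is subadditivity of [u^(r-1)]; for opposite signs both [|a|] and [|b|] are
    at most [|a - b|], whence the factor 2. *)
Lemma dmap_hoelder_cont r a b : 1 < r -> r <= 2 ->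
  `|dmap r a - dmap r b| <= 2 * `|a - b| `^ (r - 1).
Proof.
move=> r1 r2.
have r10 : 0 < r - 1 by lra.
have r11 : r - 1 <= 1 by lra.
have same u v : 0 <= u -> 0 <= v -> u <= v ->
    `|dmap r u - dmap r v| <= `|u - v| `^ (r - 1).
  move=> u0 v0 uv; rewrite !dmap_ge0E // distrC ger0_norm; last first.
    by rewrite subr_ge0 ler_powR2r // ltW.
  rewrite lerBlDl distrC ger0_norm ?subr_ge0 //.
  have := powR_subadd r10 r11 u0 (_ : 0 <= v - u).
  by rewrite [u + (v - u)]addrC subrK; apply; rewrite subr_ge0.
have same' u v : 0 <= u -> 0 <= v ->
    `|dmap r u - dmap r v| <= 2 * `|u - v| `^ (r - 1).
  move=> u0 v0; apply: (@le_trans _ _ (`|u - v| `^ (r - 1))); last first.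
    by rewrite ler_peMl ?powR_ge0 //; lra.
  case: (leP u v) => [|/ltW] uv; first exact: same.
  by rewrite distrC [`|u - v|]distrC; exact: same.
have opp u v : 0 <= u -> v <= 0 ->
    `|dmap r u - dmap r v| <= 2 * `|u - v| `^ (r - 1).
  move=> u0 v0; apply: le_trans (ler_normB _ _) _; rewrite !normr_dmap //.
  rewrite mulr2n mulrDl mul1r; apply: lerD; apply: ler_powR2r => //.
  - by apply: ltW.
  - by rewrite !ger0_norm; lra.
  - by apply: ltW.
  - by rewrite ler0_norm // ger0_norm; lra.
case: (leP 0 a) => [a0|/ltW a0]; case: (leP 0 b) => [b0|/ltW b0].
- exact: same'.
- exact: opp.
- by rewrite distrC [`|a - b|]distrC; exact: opp.
- have := @same' (- a) (- b); rewrite !dmapN -!opprD !normrN; apply; lra.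
Qed.

Lemma dmap_lip r a b u : 2 <= r -> `|a| <= u -> `|b| <= u ->
  `|dmap r a - dmap r b| <= r * u `^ (r - 2) * `|a - b|.
Proof.
move=> r2.
have r1 : 1 < r by lra.
have same v w : 0 <= v -> v <= w -> w <= u ->
    `|dmap r w - dmap r v| <= r * u `^ (r - 2) * `|w - v|.
  move=> v0 vw wu; have w0 := le_trans v0 vw.
  rewrite !dmap_ge0E // ger0_norm; last by rewrite subr_ge0 ler_powR2r // ltW; lra.
  rewrite ger0_norm ?subr_ge0 //.
  (* [powR_tangent] will be applied with exponent [r - 1], which has to exceed 1. *)
  have [r2e|r2n] := eqVneq r 2.
    by rewrite r2e subrr powRr0 mulr1 (_ : 2 - 1 = 1 :> R) ?powRr1 //; lra.
  have r3 : 1 < r - 1 by have : r != 2 by []; move: r2; rewrite le_eqVlt eq_sym (negbTE r2n) /=; lra.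
  have := powR_tangent r3 w0 v0; rewrite (_ : r - 1 - 1 = r - 2); last by ring.
  have : w `^ (r - 2) <= u `^ (r - 2) by apply: ler_powR2r => //; lra.
  have := powR_ge0 w (r - 2).
  move: (w `^ (r - 2)) (u `^ (r - 2)) (w `^ (r - 1)) (v `^ (r - 1)) => A B C D A0 AB.
  move=> h; apply: (@le_trans _ _ ((r - 1) * A * (w - v))); first by lra.
  by rewrite ler_wpM2r ?subr_ge0 // ler_pM //; lra.
have opp v w : 0 <= v -> w <= 0 -> `|v| <= u -> `|w| <= u ->
    `|dmap r v - dmap r w| <= r * u `^ (r - 2) * `|v - w|.
  move=> v0 w0 vu wu; apply: le_trans (ler_normB _ _) _; rewrite !normr_dmap //.
  have u0 : 0 <= u by apply: le_trans vu.
  have k (x : R) : `|x| <= u -> `|x| `^ (r - 1) <= r * u `^ (r - 2) * `|x|.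
    move=> xu; have [->|xn] := eqVneq x 0.
      by rewrite normr0 powR0 ?mulr0 // subr_eq0 gt_eqF.
    have -> : r - 1 = (r - 2) + 1 by ring.
    rewrite powRD; last by apply/implyP; rewrite normr_eq0.
    rewrite powRr1 // ler_wpM2r // -[leLHS]mul1r ler_pM ?powR_ge0 ?(ltW r1) //.
    by rewrite ler_powR2r //; lra.
  rewrite (ger0_norm (_ : 0 <= v - w)); last lra.
  have := k v vu; have := k w wu; rewrite (ger0_norm v0) (ler0_norm w0); lra.
case: (leP 0 a) => [a0|/ltW a0]; case: (leP 0 b) => [b0|/ltW b0] au bu.
- case: (leP a b) => [|/ltW] ab; last by apply: same => //; rewrite -(ger0_norm a0).
  by rewrite distrC [`|a - b|]distrC; apply: same => //; rewrite -(ger0_norm b0).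
- exact: opp.
- by rewrite distrC [`|a - b|]distrC; exact: opp.
- have -> : dmap r a - dmap r b = dmap r (- b) - dmap r (- a) by rewrite !dmapN; ring.
  have -> : a - b = (- b) - (- a) by ring.
  rewrite -normrN in au; rewrite -normrN in bu.
  case: (leP a b) => ab; last first.
    by apply: same; [lra|lra|rewrite -(@ger0_norm _ (- b)) //; lra].
  rewrite distrC [`|- b - _|]distrC; apply: same; [lra|lra|].
  by rewrite -(@ger0_norm _ (- a)) //; lra.
Qed.

Lemma powR_max2 r u v : 0 <= r -> 0 <= u -> 0 <= v ->
  (Num.max u v) `^ r <= u `^ r + v `^ r.
Proof.
move=> r0 u0 v0; case: (leP u v) => _; first by rewrite lerDr powR_ge0.
by rewrite lerDl powR_ge0.
Qed.

(** The source of the exponent [min(r, 2)]. After the tangent inequality the remainder is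
    [dmap r (a + c b) - dmap r a] times [c b], of order [|c|^r] by Hoelder continuity if [r <= 2]
    and of order [c^2] by the Lipschitz bound if [r > 2]. *)
Lemma normr_powR_expand r : 1 < r -> exists2 C : R, 0 <= C & forall a b c, `|c| <= 1 ->
  `|a + c * b| `^ r <= `|a| `^ r + r * (c * (dmap r a * b))
     + C * `|c| `^ (Num.min r 2) * (`|a| `^ r + `|b| `^ r).
Proof.
move=> r1; have r0 : 0 <= r by lra.
suff [C C0 H] : exists2 C : R, 0 <= C & forall a b c, `|c| <= 1 ->
    `|dmap r (a + c * b) - dmap r a| * `|c * b|
      <= C * `|c| `^ (Num.min r 2) * (`|a| `^ r + `|b| `^ r).
  exists (r * C) => [|a b c c1]; first by rewrite mulr_ge0.
  apply: le_trans (normr_powR_tangent _ _ r1) _.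
  have -> : dmap r (a + c * b) * (c * b) = (dmap r (a + c * b) - dmap r a) * (c * b)
     + c * (dmap r a * b) by ring.
  have := H a b c c1; have := ler_norm ((dmap r (a + c * b) - dmap r a) * (c * b)).
  rewrite normrM => h1 h2; have := le_trans h1 h2.
  by rewrite -(ler_pM2l (_ : 0 < r)) => [h3|]; lra.
case: (leP r 2) => r2.
  exists 2 => // a b c c1.
  apply: (@le_trans _ _ (2 * `|c * b| `^ (r - 1) * `|c * b|)).
    rewrite ler_wpM2r //; apply: le_trans (dmap_hoelder_cont _ _ r1 r2) _.
    by rewrite addrC addKr.
  rewrite -mulrA powRS // normrM powRM // mulrA ler_wpM2l ?mulr_ge0 ?powR_ge0 //.
  by rewrite lerDr powR_ge0.
exists (r * 2 `^ (r - 2)) => [|a b c c1]; first by rewrite mulr_ge0 ?powR_ge0.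
pose m : R := Num.max `|a| `|b|.
have m0 : 0 <= m by rewrite le_max normr_ge0.
have am : `|a| <= m by rewrite le_max lexx.
have bm : `|b| <= m by rewrite le_max lexx orbT.
have cb : `|c * b| <= `|b| by rewrite normrM ler_piMl.
apply: (@le_trans _ _ (r * (2 * m) `^ (r - 2) * `|c * b| * `|c * b|)).
  rewrite ler_wpM2r //; have := @dmap_lip r (a + c * b) a (2 * m).
  rewrite addrAC subrr add0r; apply; [lra| |lra].
  by apply: le_trans (ler_normD _ _) _; lra.
have sq (x : R) : 0 <= x -> x `^ 2 = x ^+ 2 by exact: powR_mulrn 2.
rewrite powRM // sq // normrM.
have -> : r * (2 `^ (r - 2) * m `^ (r - 2)) * (`|c| * `|b|) * (`|c| * `|b|) =
  r * 2 `^ (r - 2) * `|c| ^+ 2 * (m `^ (r - 2) * `|b| ^+ 2) by ring.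
rewrite ler_wpM2l ?mulr_ge0 ?powR_ge0 ?sqr_ge0 //.
apply: le_trans _ (powR_max2 r0 (normr_ge0 a) (normr_ge0 b)).
rewrite -/m; have [m00|mn] := eqVneq m 0.
  by rewrite m00 powR0 ?mul0r ?powR_ge0 // subr_eq0 gt_eqF.
have -> : m `^ r = m `^ (r - 2) * m `^ 2.
  by rewrite -powRD ?subrK //; apply/implyP.
by rewrite ler_wpM2l ?powR_ge0 // sq // lerXn2r.
Qed.

End powers.

(** * Integration over the unit interval *)

Definition meas {R : realType} (f : R -> R) := measurable_fun (@I01 R) f.

HB.lock Definition L1 {R : realType} (f : R -> R) : Prop :=
  (@lebesgue_measure R).-integrable (@I01 R) (EFin \o f).

HB.lock Definition itg {R : realType} (f : R -> R) : R :=
  Rintegral (@lebesgue_measure R) (@I01 R) f.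

Section integration.
Context {R : realType}.
Implicit Types (f g h : R -> R) (r s a c K : R).
Local Notation mu := (@lebesgue_measure R).

Lemma I01_measurable : measurable (@I01 R).
Proof. exact: measurable_itv. Qed.
Hint Resolve I01_measurable : core.

Lemma I01_mu : mu (@I01 R) = 1%E.
Proof. by rewrite /I01 lebesgue_measure_itv /= lte_fin ltr01 oppr0 adde0. Qed.

Lemma measD f g : meas f -> meas g -> meas (fun t => f t + g t).
Proof. exact: measurable_funD. Qed.
Lemma measB f g : meas f -> meas g -> meas (fun t => f t - g t).
Proof. exact: measurable_funB. Qed.
Lemma measM f g : meas f -> meas g -> meas (fun t => f t * g t).
Proof. exact: measurable_funM. Qed.
Lemma meas_cst c : meas (fun=> c).
Proof. exact: measurable_cst. Qed.
Lemma measZ c f : meas f -> meas (fun t => c * f t).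
Proof. by move=> mf; apply: measM => //; exact: meas_cst. Qed.
Lemma meas_norm f : meas f -> meas (fun t => `|f t|).
Proof. by move=> mf; apply: (measurableT_comp (@normr_measurable R setT) mf). Qed.
Lemma meas_powR r f : meas f -> meas (fun t => f t `^ r).
Proof. by move=> mf; apply: (measurableT_comp (measurable_powR r) mf). Qed.
Lemma meas_Lpow r f : meas f -> meas (fun t => `|f t| `^ r).
Proof. by move=> mf; apply: meas_powR; exact: meas_norm. Qed.

Lemma meas_sg f : meas f -> meas (fun t => Num.sg (f t)).
Proof.
move=> mf; rewrite (_ : (fun t => _) = (fun t => f t * `|f t| `^ (-1))).
  by apply: measM => //; exact: meas_Lpow.
apply/funext => t; rewrite powR_inv1 //.
have [->|ft] := eqVneq (f t) 0; first by rewrite sgr0 mul0r.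
by rewrite {2}(numEsg (f t)) mulfK // normr_eq0.
Qed.

Lemma meas_dmap r f : meas f -> meas (fun t => dmap r (f t)).
Proof. by move=> mf; apply: measM; [exact: meas_sg|exact: meas_Lpow]. Qed.

Lemma meas_if f g h K : meas f -> meas g -> meas h ->
  meas (fun t => if `|h t| <= K then f t else g t).
Proof.
move=> mf mg mh; apply: measurable_fun_if => //.
- by apply: measurable_fun_ler; [exact: meas_norm|exact: meas_cst].
- by apply: measurable_funS mf => //; exact: subIsetl.
- by apply: measurable_funS mg => //; exact: subIsetl.
Qed.

Lemma L1_meas f : L1 f -> meas f.
Proof. by rewrite L1.unlock => /measurable_int/measurable_EFinP. Qed.

Lemma L1D f g : L1 f -> L1 g -> L1 (fun t => f t + g t).
Proof. by rewrite L1.unlock => Lf Lg; exact: (integrableD _ Lf Lg). Qed.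

Lemma L1Z c f : L1 f -> L1 (fun t => c * f t).
Proof. by rewrite L1.unlock => Lf; exact: (integrableZl _ c Lf). Qed.

Lemma L1B f g : L1 f -> L1 g -> L1 (fun t => f t - g t).
Proof. by rewrite L1.unlock => Lf Lg; exact: (integrableB _ Lf Lg). Qed.

Lemma L1_le f g : meas f -> (forall t, `|f t| <= g t) -> L1 g -> L1 f.
Proof.
rewrite L1.unlock => mf fg; apply: le_integrable => //; first exact/measurable_EFinP.
by move=> t _; rewrite /= lee_fin (le_trans (fg t)) // ler_norm.
Qed.

Lemma L1_cst c : L1 (fun=> c).
Proof.
rewrite L1.unlock; apply/integrableP; split; first by apply/measurable_EFinP; exact: measurable_cst.
by rewrite /= integral_cst //= I01_mu mule1 ltry.
Qed.

Lemma L1_norm f : L1 f -> L1 (fun t => `|f t|).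
Proof.
move=> Lf; apply: (@L1_le _ (fun t => `|f t|)); rewrite ?L1.unlock.
- by apply: meas_norm; apply: L1_meas.
- by move=> t; rewrite normr_id.
- by move: Lf; rewrite L1.unlock; exact: integrable_norm.
Qed.

Lemma itgD f g : L1 f -> L1 g -> itg (fun t => f t + g t) = itg f + itg g.
Proof. by rewrite L1.unlock itg.unlock => Lf Lg; rewrite RintegralD. Qed.

Lemma itgB f g : L1 f -> L1 g -> itg (fun t => f t - g t) = itg f - itg g.
Proof. by rewrite L1.unlock itg.unlock => Lf Lg; rewrite RintegralB. Qed.

Lemma itgZ c f : L1 f -> itg (fun t => c * f t) = c * itg f.
Proof. by rewrite L1.unlock itg.unlock => Lf; rewrite RintegralZl. Qed.

Lemma itg_cst c : itg (fun=> c) = c.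
Proof. by rewrite itg.unlock Rintegral_cst //= I01_mu mulr1. Qed.

Lemma itg_le f g : L1 f -> L1 g -> (forall t, f t <= g t) -> itg f <= itg g.
Proof. by rewrite L1.unlock itg.unlock => Lf Lg fg; exact: le_Rintegral. Qed.

Lemma itg_ge0 f : (forall t, 0 <= f t) -> 0 <= itg f.
Proof. by rewrite itg.unlock => f0; exact: Rintegral_ge0. Qed.

Lemma itg_norm f : L1 f -> `|itg f| <= itg (fun t => `|f t|).
Proof. by rewrite L1.unlock itg.unlock => Lf; exact: le_normr_Rintegral. Qed.

Lemma itg_cvg (F : nat -> R -> R) f g : (forall n, meas (F n)) -> meas f -> L1 g ->
  (forall n t, `|F n t| <= g t) -> (forall t, F ^~ t @ \oo --> f t) ->
  itg (F n) @[n --> \oo] --> itg f.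
Proof.
move=> mF mf; rewrite L1.unlock itg.unlock => Lg Fg Ff.
have [|||||If _ cv] := @dominated_convergence _ _ R mu (@I01 R) I01_measurable
  (fun n t => (F n t)%:E) (EFin \o f) (EFin \o g).
- by move=> n; apply/measurable_EFinP; exact: mF.
- exact/measurable_EFinP.
- by apply: aeW => t _; apply: cvg_EFin; [exact: nearW|exact: Ff].
- exact: Lg.
- by apply: aeW => t n _; rewrite lee_fin; exact: Fg.
have fi : (\int[mu]_(x in @I01 R) (f x)%:E)%E \is a fin_num.
  exact: integrable_fin_num.
by rewrite /Rintegral; apply: fine_cvg; rewrite fineK.
Qed.

End integration.

(** * The spaces L^r and their duality pairing *)

(* [LP], [nrm] are sealed copies of [Lp], [lpn]: unification must not unfold them. *)
HB.lock Definition LP {R : realType} (r : R) (f : R -> R) : Prop := Lp r f.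

HB.lock Definition nrm {R : realType} (r : R) (f : R -> R) : R := lpn r f.

HB.lock Definition Nm {R : realType} (r : R) (f : R -> R) : R :=
  itg (fun t => `|f t| `^ r).

HB.lock Definition pairing {R : realType} (f g : R -> R) : R := itg (fun t => f t * g t).

Definition trunc {R : realType} (K : R) (f : R -> R) : R -> R :=
  fun t => if `|f t| <= K then f t else 0.

Section Lp_spaces.
Context {R : realType}.
Implicit Types (f g h : R -> R) (r s a c K : R).
Local Notation mu := (@lebesgue_measure R).

Lemma powR_inv a r : 0 <= a -> a^-1 `^ r = a `^ (- r).
Proof. by move=> a0; rewrite -powR_inv1 // -powRrM mulN1r. Qed.

Lemma powR_mulN a r : 0 < a -> a `^ r * a `^ (- r) = 1.
Proof. by move=> a0; rewrite powRN mulfV // gt_eqF // powR_gt0. Qed.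

Lemma NmE r f : Nm r f = itg (fun t => `|f t| `^ r). Proof. by rewrite Nm.unlock. Qed.

Lemma pairingE f g : pairing f g = itg (fun t => f t * g t). Proof. by rewrite pairing.unlock. Qed.

Lemma LpP r f : LP r f <-> meas f /\ L1 (fun t => `|f t| `^ r).
Proof.
rewrite LP.unlock L1.unlock /Lp; split=> -[mf h]; split=> //.
  apply/integrableP; split.
    by apply/measurable_EFinP; apply: meas_Lpow.
  by under eq_integral do rewrite /= ger0_norm ?powR_ge0 //.
move/integrableP : h => [_].
by under eq_integral do rewrite /= ger0_norm ?powR_ge0 //.
Qed.

Lemma lpnE r f : nrm r f = Nm r f `^ r^-1.
Proof. by rewrite nrm.unlock NmE /lpn itg.unlock. Qed.

Lemma Lp_meas r f : LP r f -> meas f. Proof. by move=> /LpP[]. Qed.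

Lemma Nm_ge0 r f : 0 <= Nm r f.
Proof. by rewrite NmE; apply: itg_ge0 => t; exact: powR_ge0. Qed.

Lemma lpn_ge0 r f : 0 <= nrm r f.
Proof. by rewrite lpnE powR_ge0. Qed.

Lemma lpn_pow r f : 0 < r -> nrm r f `^ r = Nm r f.
Proof. by move=> r0; rewrite lpnE powR_invK // Nm_ge0. Qed.

Lemma lpn_le r f a : 0 < r -> 0 <= a -> (nrm r f <= a) = (Nm r f <= a `^ r).
Proof.
move=> r0 a0; apply/idP/idP => h.
  by rewrite -lpn_pow // ler_powR2r ?lpn_ge0 // ltW.
by rewrite lpnE -[leRHS](powRK_inv r0 a0) ler_powR2r ?Nm_ge0 // invr_ge0 ltW.
Qed.

Lemma Lp_le r f g : 0 <= r -> meas f -> (forall t, `|f t| <= `|g t|) -> LP r g -> LP r f.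
Proof.
move=> r0 mf fg /LpP[_ Lg]; apply/LpP; split=> //.
apply: L1_le Lg; first exact: meas_Lpow.
by move=> t; rewrite ger0_norm ?powR_ge0 // ler_powR2r.
Qed.

Lemma Lp_cst r c : LP r (fun=> c).
Proof. by apply/LpP; split; [exact: meas_cst|exact: L1_cst]. Qed.

Lemma Lp_bounded r f K : 0 <= r -> meas f -> (forall t, `|f t| <= K) -> LP r f.
Proof.
move=> r0 mf fK; apply: (Lp_le r0 mf _ (Lp_cst r K)) => t.
by rewrite (le_trans (fK t)) // ler_norm.
Qed.

Lemma LpD r f g : 0 <= r -> LP r f -> LP r g -> LP r (fadd f g).
Proof.
move=> r0 /LpP[mf Lf] /LpP[mg Lg]; apply/LpP.
have mfg : meas (fadd f g) by exact: measD.
split=> //; have := L1Z (2 `^ r) (L1D Lf Lg); apply: L1_le; first exact: meas_Lpow.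
by move=> t; rewrite ger0_norm ?powR_ge0 // normr_powR_add_le.
Qed.

Lemma LpZ r c f : LP r f -> LP r (fscale c f).
Proof.
move=> /LpP[mf Lf]; apply/LpP; split; first exact: measZ.
rewrite (_ : (fun t => _) = fun t => `|c| `^ r * `|f t| `^ r); first exact: L1Z.
by apply/funext => t; rewrite /fscale normrM powRM.
Qed.

Lemma LpB r f g : 0 <= r -> LP r f -> LP r g -> LP r (fsub f g).
Proof.
move=> r0 Lf Lg; rewrite (_ : fsub f g = fadd f (fscale (-1) g)).
  by apply: LpD => //; exact: LpZ.
by apply/funext => t; rewrite /fsub /fadd /fscale mulN1r.
Qed.

(* The measure is a probability: [u^r <= (r/s) u^s + 1 - r/s] pointwise. *)
Lemma Nm_exp_le r s f a : 0 < r -> r <= s -> LP s f -> 0 < a -> Nm s f <= a `^ s ->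
  LP r f /\ Nm r f <= a `^ r.
Proof.
move=> r0 rs /LpP[mf Lf] a0 h; have s0 : 0 < s by lra.
have key (u : R) : 0 <= u -> u `^ r <= r / s * u `^ s + (1 - r / s).
  move=> u0; have [<-|rsn] := eqVneq r s.
    by rewrite divff ?gt_eqF // mul1r subrr addr0.
  have sr1 : 1 < s / r.
    by rewrite ltr_pdivlMr // mul1r lt_neqAle rsn.
  have := powR_tangent sr1 ler01 (powR_ge0 u r).
  rewrite powR1 -powRrM mulrCA divff ?gt_eqF // !mulr1.
  have -> : r / s = (s / r)^-1 by rewrite invf_div.
  move=> h1; rewrite -(ler_pM2l (_ : 0 < s / r)); last by rewrite divr_gt0.
  rewrite mulrDr mulrBr mulr1 mulrA mulfV ?gt_eqF ?divr_gt0 // mul1r; lra.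
have Ls := L1Z (a `^ (- s)) Lf.
have key2 t : `|f t| `^ r <= a `^ r * (r / s * (a `^ (- s) * `|f t| `^ s) + (1 - r / s)).
  have := key (`|f t| / a) (divr_ge0 (normr_ge0 _) (ltW a0)).
  rewrite !powRM ?invr_ge0 ?(ltW a0) // !powR_inv ?(ltW a0) //.
  move=> h1; rewrite -(ler_pM2l (_ : 0 < a `^ (- r))) ?powR_gt0 //.
  rewrite [X in _ <= X]mulrA [a `^ (- r) * a `^ r]mulrC powR_mulN // mul1r mulrC.
  by rewrite [a `^ (-s) * _]mulrC.
have Lb := L1Z (a `^ r) (L1D (L1Z (r / s) Ls) (L1_cst (1 - r / s))).
have Lr : L1 (fun t => `|f t| `^ r).
  by apply: L1_le Lb; [exact: meas_Lpow|move=> t; rewrite ger0_norm ?powR_ge0 ?key2].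
split; first by apply/LpP.
rewrite NmE; apply: (le_trans (itg_le Lr Lb key2)).
rewrite itgZ; last by apply: L1D; [exact: L1Z|exact: L1_cst].
rewrite itgD; [|exact: L1Z|exact: L1_cst].
rewrite itgZ // itgZ // itg_cst ler_piMr ?powR_ge0 //.
have rs0 : 0 < r / s by rewrite divr_gt0.
have : a `^ (- s) * itg (fun t : R => `|f t| `^ s) <= 1.
  rewrite -NmE.
  rewrite -(ler_pM2l (_ : 0 < a `^ s)) ?powR_gt0 // mulrA powR_mulN //.
  by rewrite mul1r mulr1.
move: (a `^ _ * itg _) => X; move: (r / s) rs0 => k k0 X1.
have h9 : k * X <= k by apply: ler_piMr => //; exact: ltW.
lra.
Qed.

Lemma Lp_exp_le r s f : 0 < r -> r <= s -> LP s f -> LP r f.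
Proof.
move=> r0 rs Lf; have s0 : 0 < s by lra.
case: (@Nm_exp_le r s f (nrm s f + 1)) => //; first by have := lpn_ge0 s f; lra.
by rewrite -lpn_le //; have := lpn_ge0 s f; lra.
Qed.

Lemma lpn_exp_le r s f : 0 < r -> r <= s -> LP s f -> nrm r f <= nrm s f.
Proof.
move=> r0 rs Lf; have s0 : 0 < s by lra.
apply/ler_addgt0Pr => e e0; have l0 := lpn_ge0 s f.
rewrite lpn_le; [|lra|lra].
by case: (@Nm_exp_le r s f (nrm s f + e)) => //; [lra|rewrite -lpn_le; lra].
Qed.

Lemma lpn1E f : nrm 1 f = itg (fun t => `|f t|).
Proof.
rewrite lpnE invr1 powRr1 ?Nm_ge0 // NmE.
by congr itg; apply/funext => t; rewrite powRr1.
Qed.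

Lemma Lp_L1 r f : 1 <= r -> LP r f -> L1 f.
Proof.
move=> r1 Lf; have /LpP[mf] := Lp_exp_le ltr01 r1 Lf.
by apply: L1_le => // t; rewrite powRr1.
Qed.

Lemma itg_norm_le r f : 1 <= r -> LP r f -> itg (fun t => `|f t|) <= nrm r f.
Proof. by move=> r1 Lf; rewrite -lpn1E lpn_exp_le. Qed.

Lemma Nm_le r f g : 0 <= r -> LP r f -> LP r g -> (forall t, `|f t| <= `|g t|) ->
  Nm r f <= Nm r g.
Proof.
move=> r0 /LpP[mf Lf] /LpP[_ Lg] fg; rewrite !NmE; apply: itg_le => // t.
by rewrite ler_powR2r.
Qed.

Lemma lpn_mono r f g : 0 < r -> LP r f -> LP r g -> (forall t, `|f t| <= `|g t|) ->
  nrm r f <= nrm r g.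
Proof.
move=> r0 Lf Lg fg; rewrite !lpnE ler_powR2r ?Nm_ge0 ?invr_ge0 ?(ltW r0) //.
by apply: Nm_le => //; rewrite ltW.
Qed.

Lemma lpn_cst r c : 0 < r -> nrm r (fun=> c) = `|c|.
Proof. by move=> r0; rewrite lpnE NmE itg_cst powRK_inv. Qed.

Lemma lpn0 r : 0 < r -> nrm r (fun=> 0) = 0.
Proof. by move=> r0; rewrite lpn_cst // normr0. Qed.

Lemma lpnZ r c f : 0 < r -> LP r f -> nrm r (fscale c f) = `|c| * nrm r f.
Proof.
move=> r0 /LpP[mf Lf]; rewrite !lpnE -(@powRK_inv _ r `|c|) // -powRM ?powR_ge0 ?Nm_ge0 //.
congr (_ `^ _); rewrite !NmE -itgZ //; congr itg.
by apply/funext => t; rewrite /fscale normrM powRM.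
Qed.

Lemma lpnN r f : nrm r (fscale (-1) f) = nrm r f.
Proof.
rewrite !lpnE !NmE; congr (itg _ `^ _).
by apply/funext => t; rewrite /fscale mulN1r normrN.
Qed.

Lemma lpn_subC r f g : nrm r (fsub f g) = nrm r (fsub g f).
Proof.
by rewrite -lpnN; congr nrm; apply/funext => t; rewrite /fscale /fsub mulN1r opprB.
Qed.

Lemma Lp_dmap r s f : conj_exp r s -> LP r f -> LP s (fun t => dmap r (f t)).
Proof.
move=> c /LpP[mf Lf]; apply/LpP; split; first exact: meas_dmap.
by under eq_fun do rewrite (dmap_conj _ c).
Qed.

Lemma Nm_dmap r s f : conj_exp r s -> Nm s (fun t => dmap r (f t)) = Nm r f.
Proof. by move=> c; rewrite !NmE; under eq_fun do rewrite (dmap_conj _ c). Qed.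

Lemma pairingC f g : pairing f g = pairing g f.
Proof. by rewrite !pairingE; under eq_fun do rewrite mulrC. Qed.

Lemma pairing_dmap r f : 1 < r -> pairing f (fun t => dmap r (f t)) = Nm r f.
Proof. by move=> r1; rewrite pairingC pairingE NmE; under eq_fun do rewrite dmap_mul //. Qed.

Section conj.
Variables (r s : R).
Hypothesis rs : conj_exp r s.

Let r1 : 1 < r. Proof. by case: rs. Qed.
Let r0 : 0 < r. Proof. exact: lt_trans r1. Qed.
Let s1 : 1 < s. Proof. by case: rs. Qed.
Let s0 : 0 < s. Proof. exact: lt_trans s1. Qed.

Lemma L1_pair f g : LP r f -> LP s g -> L1 (fun t => f t * g t).
Proof.
move=> /LpP[mf Lf] /LpP[mg Lg]; have := L1D Lf Lg; apply: L1_le; first exact: measM.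
by move=> t; exact: young1.
Qed.

Lemma pairingDl f g h : LP r f -> LP r g -> LP s h ->
  pairing (fadd f g) h = pairing f h + pairing g h.
Proof.
move=> Lf Lg Lh; rewrite !pairingE /fadd -itgD; [|exact: L1_pair|exact: L1_pair].
by congr itg; apply/funext => t; rewrite mulrDl.
Qed.

Lemma pairingBl f g h : LP r f -> LP r g -> LP s h ->
  pairing (fsub f g) h = pairing f h - pairing g h.
Proof.
move=> Lf Lg Lh; rewrite !pairingE /fsub -itgB; [|exact: L1_pair|exact: L1_pair].
by congr itg; apply/funext => t; rewrite mulrBl.
Qed.

Lemma pairingZl c f h : LP r f -> LP s h -> pairing (fscale c f) h = c * pairing f h.
Proof.
move=> Lf Lh; rewrite !pairingE /fscale -itgZ; last exact: L1_pair.
by congr itg; apply/funext => t; rewrite mulrA.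
Qed.

Lemma pairing_le f g : LP r f -> LP s g -> `|pairing f g| <= nrm r f * nrm s g.
Proof.
move=> Lf Lg; have LfE := Lf; have LgE := Lg; move/LpP : LfE => [mf L1f]; move/LpP : LgE => [mg L1g].
(* The bounds [a], [b] are positive and may exceed the norms, so that one can normalize even when a
   norm is zero; at the end they decrease to the norms. *)
have key (a b : R) : 0 < a -> 0 < b -> nrm r f <= a -> nrm s g <= b -> `|pairing f g| <= a * b.
  move=> a0 b0; rewrite !lpn_le ?(ltW a0) ?(ltW b0) // => fa gb.
  have Lab := L1D (L1Z (a `^ (- r) / r) L1f) (L1Z (b `^ (- s) / s) L1g).
  have pt t : `|f t * g t| <= a * b * (a `^ (- r) / r * `|f t| `^ r + b `^ (- s) / s * `|g t| `^ s).
    have := young (f t / a) (g t / b) rs.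
    rewrite !normrM !normfV (gtr0_norm a0) (gtr0_norm b0) !powRM ?invr_ge0 ?(ltW a0) ?(ltW b0) //.
    rewrite !powR_inv ?(ltW a0) ?(ltW b0) // => h1.
    rewrite -(ler_pM2l (_ : 0 < a^-1 * b^-1)) ?mulr_gt0 ?invr_gt0 //.
    apply: le_trans (_ : _ <= `|f t| `^ r * a `^ (- r) / r + `|g t| `^ s * b `^ (- s) / s) _.
      by apply: le_trans h1; rewrite le_eqVlt; apply/orP; left; apply/eqP; ring.
    rewrite le_eqVlt; apply/orP; left; apply/eqP.
    by field; rewrite !gt_eqF.
  rewrite pairingE; apply: (le_trans (itg_norm (L1_pair Lf Lg))).
  apply: (le_trans (itg_le (L1_norm (L1_pair Lf Lg)) (L1Z (a * b) Lab) pt)).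
  rewrite itgZ // itgD; [|exact: L1Z|exact: L1Z].
  rewrite !itgZ // -!NmE ler_piMr ?mulr_ge0 ?(ltW a0) ?(ltW b0) //.
  case: (rs) => _ _ <-.
  have q (c d N : R) : 0 < c -> 0 < d -> N <= c `^ d -> c `^ (- d) / d * N <= d^-1.
    move=> c0 d0 hN; rewrite mulrAC ler_piMl ?invr_ge0 ?(ltW d0) //.
    rewrite -(ler_pM2l (_ : 0 < c `^ d)) ?powR_gt0 // mulrA powR_mulN //.
    by rewrite mul1r mulr1.
  by apply: lerD; apply: q.
apply/ler_addgt0Pr => e e0.
set A := nrm r f; set B := nrm s g.
have A0 : 0 <= A := lpn_ge0 _ _; have B0 : 0 <= B := lpn_ge0 _ _.
(* Chosen so that [d * (A + B + 1) <= e] and [d <= 1], which gives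
   [(A + d) * (B + d) <= A * B + e]. *)
pose d := Num.min 1 (e / (A + B + 1)).
have d0 : 0 < d by rewrite lt_min ltr01 /= divr_gt0 //; lra.
have d1 : d <= 1 by rewrite ge_min lexx.
have d2 : d * (A + B + 1) <= e.
  by rewrite -ler_pdivlMr; [rewrite ge_min lexx orbT|lra].
apply: (le_trans (key (A + d) (B + d) _ _ _ _)); rewrite -?/A -?/B; [lra..|].
have : d * d <= d by rewrite ler_piMr // ltW.
have -> : (A + d) * (B + d) = A * B + (d * (A + B + 1) - d + d * d) by ring.
by lra.
Qed.

Lemma pairing_null_l f g : LP r f -> LP s g -> nrm r f = 0 -> pairing f g = 0.
Proof.
move=> Lf Lg f0; apply/eqP; rewrite -normr_le0 (le_trans (pairing_le Lf Lg)) //.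
by rewrite f0 mul0r.
Qed.

(** Both summands are tested against [D = dmap r (f + g)], which norms [f + g]: the pairing is
    [|| f + g ||^r], while [D] has s-norm [|| f + g ||^(r-1)]. *)
Lemma minkowski f g : LP r f -> LP r g -> nrm r (fadd f g) <= nrm r f + nrm r g.
Proof.
move=> Lf Lg; have Lfg : LP r (fadd f g) by apply: LpD => //; rewrite ltW.
set h := fadd f g in Lfg *; set D := fun t => dmap r (h t).
have LD : LP s D by exact: Lp_dmap.
have [->|hn] := eqVneq (nrm r h) 0; first by rewrite addr_ge0 ?lpn_ge0.
have hp : 0 < nrm r h by rewrite lt_neqAle eq_sym hn lpn_ge0.
have e1 : nrm r h `^ r = pairing f D + pairing g D.
  by rewrite lpn_pow // -(pairing_dmap _ r1) -pairingDl.
have e2 : nrm s D = nrm r h `^ (r - 1).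
  rewrite lpnE (Nm_dmap _ rs) -lpn_pow // -powRrM; congr (_ `^ _).
  by rewrite -{1}(conj_exp_mul rs) mulfK // gt_eqF.
have := lerD (le_trans (ler_norm _) (pairing_le Lf LD)) (le_trans (ler_norm _) (pairing_le Lg LD)).
by rewrite -e1 -mulrDl e2 -powRS ?lpn_ge0 // mulrC ler_pM2r // powR_gt0.
Qed.

(** The converse of Hoelder's inequality, with the duality image of [f] as test function. Adjoints,
    weak limits and operator series are known only through their pairings, and this is how their
    norms are bounded. *)
Lemma lpn_dual_le f a : LP r f -> 0 <= a ->
  (forall g, LP s g -> pairing f g <= a * nrm s g) -> nrm r f <= a.
Proof.
move=> Lf a0 H; have [->//|fn] := eqVneq (nrm r f) 0.
have fp : 0 < nrm r f by rewrite lt_neqAle eq_sym fn lpn_ge0.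
have := H _ (Lp_dmap rs Lf).
rewrite (pairing_dmap _ r1) lpnE (Nm_dmap _ rs) -lpn_pow // -powRrM.
rewrite (_ : r * s^-1 = r - 1); last by rewrite -{1}(conj_exp_mul rs) mulfK // gt_eqF.
by rewrite -powRS ?lpn_ge0 // mulrC ler_pM2r // powR_gt0.
Qed.

End conj.

Lemma lpn_triangle r f g : 1 < r -> LP r f -> LP r g -> nrm r (fadd f g) <= nrm r f + nrm r g.
Proof. by move=> r1; exact: (minkowski (conj_exp_ex r1)). Qed.

Lemma lpn_triangleB r f g : 1 < r -> LP r f -> LP r g -> nrm r (fsub f g) <= nrm r f + nrm r g.
Proof.
move=> r1 Lf Lg; rewrite (_ : fsub f g = fadd f (fscale (-1) g)).
  rewrite -(lpnN r g); apply: lpn_triangle => //; exact: LpZ.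
by apply/funext => t; rewrite /fsub /fadd /fscale mulN1r.
Qed.

Lemma lpn_triangle3 r f g h : 1 < r -> LP r f -> LP r g -> LP r h ->
  nrm r (fsub f h) <= nrm r (fsub f g) + nrm r (fsub g h).
Proof.
move=> r1 Lf Lg Lh; have r0 : 0 <= r by lra.
rewrite (_ : fsub f h = fadd (fsub f g) (fsub g h)).
  by apply: lpn_triangle => //; exact: LpB.
by apply/funext => t; rewrite /fsub /fadd addrA subrK.
Qed.

Lemma lpn_le_sub r f g : 1 < r -> LP r f -> LP r g -> nrm r f <= nrm r g + nrm r (fsub f g).
Proof.
move=> r1 Lf Lg; have r0 : 0 <= r by lra.
rewrite {1}(_ : f = fadd g (fsub f g)).
  by apply: lpn_triangle => //; exact: LpB.
by apply/funext => t; rewrite /fsub /fadd addrCA subrr addr0.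
Qed.

Lemma trunc_le K f t : `|trunc K f t| <= `|f t|.
Proof. by rewrite /trunc; case: ifP => // _; rewrite normr0. Qed.

Lemma trunc_bound K f t : 0 <= K -> `|trunc K f t| <= K.
Proof. by rewrite /trunc; case: ifP => // _; rewrite normr0. Qed.

Lemma trunc_sub_le K f t : `|fsub f (trunc K f) t| <= `|f t|.
Proof. by rewrite /fsub /trunc; case: ifP => _; rewrite ?subrr ?subr0 ?normr0. Qed.

Lemma meas_trunc K f : meas f -> meas (trunc K f).
Proof. by move=> mf; apply: meas_if => //; exact: meas_cst. Qed.

Lemma Lp_trunc r K f : 0 <= r -> LP r f -> LP r (trunc K f).
Proof.
move=> r0 Lf; apply: (Lp_le r0 _ _ Lf); first by apply: meas_trunc; apply: Lp_meas Lf.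
exact: trunc_le.
Qed.

Lemma Lp_trunc_bounded r K f : 0 <= r -> 0 <= K -> meas f -> LP r (trunc K f).
Proof.
move=> r0 K0 mf; apply: (Lp_bounded r0 (meas_trunc _ mf)) => t; exact: trunc_bound.
Qed.

Lemma cvg_lpn_trunc r f : 0 < r -> LP r f ->
  nrm r (fsub f (trunc n%:R f)) @[n --> \oo] --> 0.
Proof.
move=> r0 Lf; have /LpP[mf Lr] := Lf.
have N0 : Nm r (fsub f (trunc n%:R f)) @[n --> \oo] --> 0.
  under eq_fun do rewrite NmE; rewrite -[0](itg_cst 0); apply: (itg_cvg _ (meas_cst 0) Lr).
  - by move=> n; apply: meas_Lpow; apply: measB => //; exact: meas_trunc.
  - move=> n t; rewrite ger0_norm ?powR_ge0 //.
    by rewrite ler_powR2r ?(ltW r0) // trunc_sub_le.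
  - move=> t; apply: cvg_near_cst; near=> n.
    rewrite /fsub /trunc ifT ?subrr ?normr0 ?powR0 ?gt_eqF //.
    by near: n; exact: nbhs_infty_ger.
apply/cvgrPdist_le => e e0; have /cvgrPdist_le := N0 => /(_ (e `^ r)).
rewrite powR_gt0 // => /(_ isT); apply: filterS => n.
rewrite !sub0r !normrN !ger0_norm ?Nm_ge0 ?lpn_ge0 // -lpn_le //.
exact: ltW.
Unshelve. all: by end_near. Qed.

Definition lincomb (c : nat -> R) (x : nat -> R -> R) (N : nat) : R -> R :=
  fun t => \sum_(i < N) c i * x i t.

Lemma lincomb0 (c : nat -> R) x : lincomb c x 0 = fun=> 0.
Proof. by apply/funext => t; rewrite /lincomb big_ord0. Qed.

Lemma lincombS (c : nat -> R) x N : lincomb c x N.+1 = fadd (lincomb c x N) (fscale (c N) (x N)).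
Proof. by apply/funext => t; rewrite /lincomb big_ord_recr. Qed.

Lemma Lp_lincomb r (c : nat -> R) x N : 0 <= r -> (forall i, LP r (x i)) -> LP r (lincomb c x N).
Proof.
move=> r0 Lx; elim: N => [|N IH]; first by rewrite lincomb0; exact: Lp_cst.
by rewrite lincombS; apply: LpD => //; exact: LpZ.
Qed.

Lemma lpn_lincomb r (c : nat -> R) x N : 1 < r -> (forall i, LP r (x i)) ->
  nrm r (lincomb c x N) <= \sum_(i < N) `|c i| * nrm r (x i).
Proof.
move=> r1 Lx; have r0 : 0 < r by lra.
elim: N => [|N IH]; first by rewrite lincomb0 lpn0 // big_ord0.
rewrite lincombS big_ord_recr /=; apply: (le_trans (lpn_triangle r1 _ _)).
- by apply: Lp_lincomb => //; rewrite ltW.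
- exact: LpZ.
- by rewrite lpnZ // lerD2r.
Qed.

Lemma pairing_lincomb r s (c : nat -> R) x N g : conj_exp r s -> (forall i, LP r (x i)) -> LP s g ->
  pairing (lincomb c x N) g = \sum_(i < N) c i * pairing (x i) g.
Proof.
move=> rs Lx Lg; have r0 : 0 <= r by case: rs; lra.
elim: N => [|N IH].
  by rewrite lincomb0 big_ord0 pairingE; under eq_fun do rewrite mul0r; rewrite itg_cst.
rewrite lincombS big_ord_recr /= (pairingDl rs) ?IH //; [|exact: Lp_lincomb|exact: LpZ].
by rewrite (pairingZl rs).
Qed.

End Lp_spaces.

(** * Riesz representation *)

Definition dualfun {R : realType} (r : R) (phi : (R -> R) -> R) : Prop :=
  [/\ forall f g, LP r f -> LP r g -> phi (fadd f g) = phi f + phi g,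
      forall a f, LP r f -> phi (fscale a f) = a * phi f &
      exists C : R, forall f, LP r f -> `|phi f| <= C * nrm r f].

Lemma LpDualP {R : realType} (r : R) phi : LpDual r phi <-> dualfun r phi.
Proof.
rewrite /LpDual /dualfun LP.unlock nrm.unlock.
by split=> [[? [? ?]]|[? ? ?]].
Qed.

Section riesz.
Context {R : realType}.
Variables (r : R) (phi : (R -> R) -> R) (C : R).
Hypothesis r1 : 1 < r.
Hypothesis phiD : forall f g, LP r f -> LP r g -> phi (fadd f g) = phi f + phi g.
Hypothesis phiZ : forall a f, LP r f -> phi (fscale a f) = a * phi f.
Hypothesis phiC : forall f, LP r f -> `|phi f| <= C * nrm r f.
Local Notation mu := (@lebesgue_measure R).

Let r0 : 0 < r. Proof. exact: lt_trans r1. Qed.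
Let r0w : 0 <= r. Proof. exact: ltW. Qed.

Let C0 : 0 <= C.
Proof.
have := phiC (Lp_cst r 1); rewrite lpn_cst // normr1 mulr1; exact: le_trans.
Qed.

Lemma phiB f g : LP r f -> LP r g -> phi (fsub f g) = phi f - phi g.
Proof.
move=> Lf Lg; rewrite (_ : fsub f g = fadd f (fscale (-1) g)).
  rewrite phiD // ?phiZ ?mulN1r //; exact: LpZ.
by apply/funext => t; rewrite /fsub /fadd /fscale mulN1r.
Qed.

Lemma phi_lincomb (c : nat -> R) x N : (forall i, LP r (x i)) ->
  phi (lincomb c x N) = \sum_(i < N) c i * phi (x i).
Proof.
move=> Lx; elim: N => [|N IH].
  rewrite lincomb0 big_ord0; apply/eqP; rewrite -normr_le0.
  by rewrite (le_trans (phiC (Lp_cst _ _))) // lpn0 // mulr0.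
rewrite lincombS big_ord_recr /= phiD ?IH ?phiZ //.
- exact: Lp_lincomb.
- exact: LpZ.
Qed.

Lemma itg_ext (f g : R -> R) : (forall t, I01 t -> f t = g t) -> itg f = itg g.
Proof.
move=> fg; rewrite itg.unlock; apply: eq_Rintegral => t.
by rewrite inE => /fg.
Qed.

Lemma phi_ext (f g : R -> R) : LP r f -> LP r g -> (forall t, I01 t -> f t = g t) ->
  phi f = phi g.
Proof.
move=> Lf Lg fg; apply/eqP; rewrite -subr_eq0 -phiB // -normr_le0.
apply: (le_trans (phiC (LpB r0w Lf Lg))).
rewrite lpnE NmE (@itg_ext _ (fun=> 0)) ?itg_cst ?powR0 ?mulr0 ?invr_eq0 ?gt_eqF //.
by move=> t It; rewrite /fsub fg // subrr normr0 powR0 // gt_eqF.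
Qed.

Lemma meas_indic (A : set R) : measurable A -> meas (\1_A : R -> R).
Proof. by move=> mA; exact: measurable_indic. Qed.

Lemma indic_le1 (A : set R) (t : R) : `|\1_A t : R| <= 1.
Proof. by rewrite indicE; case: (_ \in _); rewrite ?normr0 ?normr1. Qed.

Lemma Lp_indic (A : set R) : measurable A -> LP r (\1_A : R -> R).
Proof.
by move=> mA; apply: (@Lp_bounded _ _ _ 1 r0w (meas_indic mA)) => t; exact: indic_le1.
Qed.

(** A signed measure, whose Radon-Nikodym density with respect to Lebesgue measure will represent
    [phi]. *)
Definition indic_charge (A : set (measurableTypeR R)) : \bar R := (phi (\1_A))%:E.

Let nu0 : indic_charge set0 = 0%E.
Proof.
rewrite /indic_charge; congr EFin; apply/eqP; rewrite -normr_le0 indic0.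
by rewrite (le_trans (phiC (Lp_cst r 0))) // lpn0 // mulr0.
Qed.

Let nu_fin A : measurable A -> indic_charge A \is a fin_num. Proof. by []. Qed.

Let nu_sigma : semi_sigma_additive indic_charge.
Proof.
move=> F mF tF mUF.
pose x i : R -> R := \1_(F i); have Lx i : LP r (x i) := Lp_indic (mF i).
have LU : LP r (\1_(\bigcup_n F n) : R -> R) := Lp_indic mUF.
pose S n := lincomb (fun=> 1) x n.
have LS n : LP r (S n) by exact: Lp_lincomb.
have -> : (fun n => (\sum_(0 <= i < n) indic_charge (F i))%E) = EFin \o (fun n => phi (S n)).
  apply/funext => n /=; rewrite big_mkord sumEFin phi_lincomb //; congr EFin.
  by apply: eq_bigr => i _; rewrite mul1r.
apply: cvg_EFin; first exact: nearW.
have Sin n t k : F k t -> (k < n)%N -> S n t = 1.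
  move=> Fkt kn; rewrite /S /lincomb.
  rewrite (eq_bigr (fun i : 'I_n => (i == Ordinal kn)%:R)); last first.
    move=> i _; rewrite mul1r /x indicE; congr (nat_of_bool _)%:R.
    have [->|ik] := eqVneq i (Ordinal kn); first by rewrite mem_set.
    apply/negbTE; rewrite notin_setE => Fit; move/negP: ik; apply.
    apply/eqP/val_inj => /=; apply: (tF i k) => //; by exists t.
  rewrite (bigD1 (Ordinal kn)) //= eqxx big1 ?addr0 // => i /negbTE -> //.
have Sout n t : ~ (\bigcup_n F n) t -> S n t = 0.
  move=> nF; rewrite /S /lincomb big1 // => i _; rewrite /x indicE memNset ?mulr0 //.
  by move=> Fi; apply: nF; exists i.
have S01 n t : `|S n t| <= 1.
  have [[k _ Fkt]|nF] := pselect ((\bigcup_n F n) t); last by rewrite Sout // normr0.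
  have [kn|nk] := ltnP k n; first by rewrite (Sin _ _ k) // normr1.
  rewrite /S /lincomb big1 ?normr0 // => i _; rewrite /x indicE memNset ?mulr0 //.
  move=> Fi; have : (i < k)%N by exact: leq_trans nk.
  rewrite (tF i k) ?ltnn //; by exists t.
(* The indicators of the finite unions converge in L^r by dominated convergence, and [phi] is
   continuous for that norm. *)
have N0 : Nm r (fsub (\1_(\bigcup_n F n)) (S n)) @[n --> \oo] --> 0.
  under eq_fun do rewrite NmE; rewrite -[0](itg_cst 0).
  apply: (itg_cvg _ (meas_cst 0) (L1_cst (2 `^ r))).
  - by move=> n; apply: meas_Lpow; apply: measB; [exact: meas_indic|exact: Lp_meas (LS n)].
  - move=> n t; rewrite ger0_norm ?powR_ge0 // ler_powR2r //.
    rewrite (le_trans (ler_normB _ _)) //; have := S01 n t.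
    by have := indic_le1 (\bigcup_n F n) t; lra.
  - move=> t; apply: cvg_near_cst.
    have [[k _ Fkt]|nF] := pselect ((\bigcup_n F n) t).
      exists k.+1 => // n /= kn; rewrite /fsub (Sin _ _ k) // indicE mem_set; last by exists k.
      by rewrite subrr normr0 powR0 // gt_eqF.
    apply: nearW => n; rewrite /fsub Sout // indicE memNset // subrr normr0 powR0 //.
    by rewrite gt_eqF.
apply/cvgrPdist_le => e e0.
have C1 : 0 < C + 1 by have := C0; lra.
have /cvgrPdist_le := N0 => /(_ ((e / (C + 1)) `^ r)).
rewrite powR_gt0 ?divr_gt0 // => /(_ isT); apply: filterS => n.
rewrite sub0r normrN ger0_norm ?Nm_ge0 // -lpn_le ?divr_ge0 ?(ltW e0) ?(ltW C1) // => h.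
rewrite -phiB //; apply: (le_trans (phiC (LpB r0w LU (LS n)))).
apply: (le_trans (_ : _ <= (C + 1) * (e / (C + 1)))).
  by apply: ler_pM => //; [exact: lpn_ge0|lra].
by rewrite mulrC divfK // gt_eqF.
Qed.

HB.instance Definition _ := isCharge.Build _ _ _ indic_charge nu0 nu_fin nu_sigma.

Let nu_dom : indic_charge `<< mu.
Proof.
apply/null_content_dominatesP => A mA A0; rewrite /indic_charge; congr EFin.
apply/eqP; rewrite -normr_le0 (le_trans (phiC (Lp_indic mA))) //.
rewrite lpnE NmE (_ : (fun t => _) = \1_A); last first.
  apply/funext => t; rewrite indicE; case: (_ \in _); rewrite ?normr0 ?normr1 ?powR1 //.
  by rewrite powR0 // gt_eqF.
rewrite itg.unlock /Rintegral integral_indic //; last exact: I01_measurable.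
rewrite [X in fine X](_ : _ = 0%E) /= ?powR0 ?mulr0 ?invr_eq0 ?gt_eqF //.
by apply: (subset_measure0 _ _ _ A0) => //; apply: measurableI => //; exact: I01_measurable.
Qed.

Lemma riesz_indic : exists2 g : R -> R, L1 g &
  forall A, measurable A -> phi (\1_A) = itg (fun t => \1_A t * g t).
Proof.
pose nu : {charge set (measurableTypeR R) -> \bar R} := indic_charge.
have nuD : nu `<< mu := nu_dom.
have Ig := Radon_Nikodym_integrable nuD.
have Fg x := Radon_Nikodym_fin_num x nuD.
set h := Radon_Nikodym _ _ in Ig Fg.
pose g x := fine (h x); have gh : EFin \o g = h.
  by apply/funext => x; rewrite /g /= fineK.
exists g => [|A mA].
  by rewrite L1.unlock gh; apply: integrableS Ig => //; exact: I01_measurable.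
have mA1 : measurable (A `&` @I01 R) by apply: measurableI => //; exact: I01_measurable.
rewrite (@phi_ext _ (\1_(A `&` @I01 R))); [|exact: Lp_indic|exact: Lp_indic|]; last first.
  by move=> t It; rewrite !indicE in_setI (mem_set It) andbT.
have := Radon_Nikodym_integral nuD mA1; rewrite -/h /nu /= /indic_charge => /(congr1 fine) /= ->.
rewrite itg.unlock /Rintegral setIC integral_mkcondr; congr fine.
apply: eq_integral => t _; rewrite patchE indicE -gh /=.
by case: (t \in A); rewrite ?mul1r ?mul0r.
Qed.

End riesz.

Section riesz_representation.
Context {R : realType}.
Variables (r s : R) (phi : (R -> R) -> R).
Hypothesis rs : conj_exp r s.
Local Notation mu := (@lebesgue_measure R).

Let r1 : 1 < r. Proof. by case: rs. Qed.
Let r0 : 0 < r. Proof. exact: lt_trans r1. Qed.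
Let r0w : 0 <= r. Proof. exact: ltW. Qed.
Let s1 : 1 < s. Proof. by case: rs. Qed.
Let s0 : 0 < s. Proof. exact: lt_trans s1. Qed.

(** Monotone convergence. Finiteness of the integral is the conclusion, so the limit is taken in the
    extended reals. *)
Lemma Lp_of_trunc (g : R -> R) B : meas g -> (forall n, Nm s (trunc n%:R g) <= B) -> LP s g.
Proof.
move=> mg H; rewrite LP.unlock; split => //.
have cv : (\int[mu]_(t in @I01 R) (`|trunc n%:R g t| `^ s)%:E)%E @[n --> \oo] -->
          (\int[mu]_(t in @I01 R) (`|g t| `^ s)%:E)%E.
  have := @cvg_monotone_convergence _ _ _ mu _ (@I01_measurable R)
     (fun n t => (`|trunc n%:R g t| `^ s)%:E).
  have -> : (fun x => limn (fun n => (`|trunc n%:R g x| `^ s)%:E)) =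
            (fun x => (`|g x| `^ s)%:E).
    apply/funext => t; apply/cvg_lim => //; apply: cvg_near_cst.
    near=> n; rewrite /trunc ifT //; near: n; exact: nbhs_infty_ger.
  apply.
  - by move=> n; apply/measurable_EFinP; apply: meas_Lpow; exact: meas_trunc.
  - by move=> n t _; rewrite lee_fin powR_ge0.
  - move=> t _ m n mn; rewrite lee_fin ler_powR2r ?(ltW s0) // /trunc.
    case: ifP => // h; last by rewrite normr0.
    by rewrite ifT // (le_trans h) // ler_nat.
apply: (@le_lt_trans _ _ B%:E); last exact: ltry.
apply: (cvge_le _ cv); apply: nearW => n.
have := H n; rewrite -lee_fin NmE itg.unlock /Rintegral fineK //.
have : L1 (fun t => `|trunc n%:R g t| `^ s).
  by have /LpP[] := Lp_trunc_bounded (ltW s0) (ler0n _ n) mg.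
by rewrite L1.unlock => /integrable_fin_num; apply; exact: I01_measurable.
Unshelve. all: by end_near. Qed.

Lemma riesz : dualfun r phi -> exists2 g, LP s g & forall f, LP r f -> phi f = pairing f g.
Proof.
move=> [phiD phiZ [C phiC]].
have [g Lg Hg] := riesz_indic r1 phiD phiZ phiC.
have mg := L1_meas Lg.
have C0 : 0 <= C.
  have := phiC _ (Lp_cst r 1); rewrite lpn_cst // normr1 mulr1; exact: le_trans.
have Lbg (f : R -> R) (K : R) : meas f -> (forall t, `|f t| <= K) -> L1 (fun t => f t * g t).
  move=> mf fK; apply: (L1_le (measM mf mg) _ (L1Z K (L1_norm Lg))) => t.
  by rewrite normrM ler_wpM2r.
pose B := C + itg (fun t => `|g t|).
have B0 : 0 <= B by rewrite addr_ge0 // itg_ge0.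
have unit_bd (f : R -> R) : meas f -> (forall t, 0 <= f t <= 1) ->
    `|phi f - itg (fun t => f t * g t)| <= B.
  move=> mf f01; have fn t : `|f t| <= 1.
    by have /andP[? ?] := f01 t; rewrite ger0_norm.
  have Lf : LP r f by exact: Lp_bounded fn.
  apply: (le_trans (ler_normB _ _)); apply: lerD.
    apply: (le_trans (phiC _ Lf)); rewrite ler_piMr // -[leRHS](normr1 R) -(lpn_cst 1 r0).
    by apply: lpn_mono => //; [exact: Lp_cst|move=> t; rewrite normr1].
  have Lfg := Lbg f 1 mf fn.
  apply: (le_trans (itg_norm Lfg)); apply: itg_le; [exact: L1_norm|exact: L1_norm|].
  by move=> t; rewrite normrM ler_piMl.
(* Passage from indicators to functions with values in [0, 1] by binary digits: [f = (f1 + 1_A) / 2]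
   with [A = {f >= 1/2}] and [f1] again between 0 and 1. The two functionals agree on [1_A], so each
   digit halves the bound on their difference. *)
have unit_half n (f : R -> R) : meas f -> (forall t, 0 <= f t <= 1) ->
    `|phi f - itg (fun t => f t * g t)| <= B / 2 ^+ n.
  elim: n f => [|n IH] f mf f01; first by rewrite expr0 divr1; exact: unit_bd.
  have mI := @I01_measurable R.
  pose A : set R := @I01 R `&` f @^-1` `[2^-1, +oo[.
  have mA : measurable A by apply: mf => //; exact: measurable_itv.
  (* The last factor keeps [f1] in [0, 1] also off the unit interval, which [A] does not meet. *)
  pose f1 t := (2 * f t - \1_A t) * \1_(@I01 R) t.
  have mf1 : meas f1.
    apply: measM; last exact: meas_indic.
    by apply: measB; [exact: measZ|exact: meas_indic].
  have fA t : @I01 R t -> f t = 2^-1 * (f1 t + \1_A t).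
    move=> It; have i1 : \1_(@I01 R) t = 1 :> R by rewrite indicE mem_set.
    by rewrite /f1 i1 mulr1 subrK mulrA mulVf ?mul1r.
  have f101 t : 0 <= f1 t <= 1.
    have [It|nI] := pselect (@I01 R t); last first.
      have i0 : \1_(@I01 R) t = 0 :> R by rewrite indicE memNset.
      by rewrite /f1 i0 mulr0 lexx ler01.
    have i1 : \1_(@I01 R) t = 1 :> R by rewrite indicE mem_set.
    rewrite /f1 i1 mulr1; have /andP[h0 h1] := f01 t.
    have [h2|h2] := leP 2^-1 (f t).
      have -> : \1_A t = 1 :> R; last by apply/andP; split; lra.
      by rewrite indicE mem_set //; split=> //=; rewrite in_itv /= h2.
    have -> : \1_A t = 0 :> R; last by apply/andP; split; lra.
    by rewrite indicE memNset // => -[_] /=; rewrite in_itv /= andbT leNgt h2.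
  have fn1 t : `|f1 t| <= 1 by have /andP[? ?] := f101 t; rewrite ger0_norm.
  have fn t : `|f t| <= 1 by have /andP[? ?] := f01 t; rewrite ger0_norm.
  have Lf : LP r f by exact: Lp_bounded fn.
  have Lf1 : LP r f1 by exact: Lp_bounded fn1.
  have LA : LP r (\1_A : R -> R) by exact: Lp_indic.
  have -> : phi f = 2^-1 * (phi f1 + phi (\1_A)).
    rewrite -phiD // -phiZ; last exact: LpD.
    by apply: (phi_ext r1 phiD phiZ phiC) => //; apply: LpZ; exact: LpD.
  have -> : itg (fun t => f t * g t) = 2^-1 * (itg (fun t => f1 t * g t) + phi (\1_A)).
    rewrite Hg // -itgD; [|exact: Lbg fn1|exact: (Lbg _ 1 (meas_indic mA) (indic_le1 A))].
    rewrite -itgZ; last first.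
      apply: L1D; [exact: Lbg fn1|exact: (Lbg _ 1 (meas_indic mA) (indic_le1 A))].
    by apply: itg_ext => t It; rewrite (fA t It); ring.
  rewrite -mulrBr opprD addrACA subrr addr0 normrM ger0_norm ?invr_ge0 //.
  by rewrite exprS invfM mulrCA ler_pM2l ?invr_gt0 // IH.
have unit0 (f : R -> R) : meas f -> (forall t, 0 <= f t <= 1) ->
    phi f = itg (fun t => f t * g t).
  move=> mf f01; apply/eqP; rewrite -subr_eq0; apply/negPn/negP => x0.
  rewrite -normr_gt0 in x0; set x := `|_| in x0.
  pose n := (Num.truncn (B / x)).+1.
  have : B / x < n%:R by exact: truncnS_gt.
  rewrite ltr_pdivrMr // => h1; have := unit_half n f mf f01; rewrite -/x.
  rewrite ler_pdivlMr ?exprn_gt0 // => h2.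
  have h3 : (n%:R : R) <= 2 ^+ n by rewrite -natrX ler_nat ltnW // ltn_expl.
  have : x * n%:R <= x * 2 ^+ n by rewrite ler_pM2l.
  by rewrite mulrC; lra.
have bdd0 (f : R -> R) (K : R) : 0 < K -> meas f -> (forall t, `|f t| <= K) ->
    phi f = itg (fun t => f t * g t).
  move=> K0 mf fK; pose f' t := 2^-1 * (K^-1 * f t + 1).
  have mf' : meas f' by apply: measZ; apply: measD; [exact: measZ|exact: meas_cst].
  have f'01 t : 0 <= f' t <= 1.
    have : `|K^-1 * f t| <= 1.
      by rewrite normrM gtr0_norm ?invr_gt0 // ler_pdivrMl // mulr1.
    by rewrite ler_norml /f' => /andP[h1 h2]; apply/andP; split; lra.
  have f'n t : `|f' t| <= 1 by have /andP[? ?] := f'01 t; rewrite ger0_norm.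
  have c1n (t : R) : `|1 : R| <= 1 by rewrite normr1.
  have fE : f = fadd (fscale (2 * K) f') (fscale (- K) (fun=> 1)).
    apply/funext => t; rewrite /fadd /fscale /f'; field; rewrite gt_eqF //.
  have Lf' : LP r f' by exact: Lp_bounded f'n.
  rewrite {1}fE phiD; [|exact: LpZ|apply: LpZ; exact: Lp_cst].
  rewrite (phiZ (2 * K) f') // (phiZ (- K) (fun=> 1)); last exact: Lp_cst.
  rewrite (unit0 f' mf' f'01) (unit0 (fun=> 1)); [|exact: meas_cst|by move=> t; rewrite lexx ler01].
  have L1' := Lbg _ 1 mf' f'n; have L11 := Lbg _ 1 (meas_cst 1) c1n.
  rewrite -itgZ // -itgZ // -itgD; [|exact: L1Z|exact: L1Z].
  congr itg; apply/funext => t.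
  have -> : f t = 2 * K * f' t + - K * 1 by rewrite {1}fE.
  ring.
(* The truncation [h] of [g] is tested against its duality image: [Nm s h <= C * (Nm s h)^(1/r)]
   bounds the s-norm of [h] by [C], uniformly in the level. *)
have Lsg : LP s g.
  apply: (@Lp_of_trunc _ (C `^ s)) => // n.
  set h := trunc n%:R g; pose f t := dmap s (h t).
  have mh : meas h by exact: meas_trunc.
  have mf : meas f by exact: meas_dmap.
  have n0 : 0 <= n%:R :> R by exact: ler0n.
  have K0 : 0 < n%:R `^ (s - 1) + 1 :> R by have := powR_ge0 (n%:R : R) (s - 1); lra.
  have fK t : `|f t| <= n%:R `^ (s - 1) + 1.
    rewrite /f normr_dmap //; apply: (@le_trans _ _ (n%:R `^ (s - 1))); last lra.
    by rewrite ler_powR2r //; [have := s1; lra|exact: trunc_bound].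
  have LPf : LP r f by exact: Lp_bounded fK.
  have e1 : phi f = Nm s h.
    rewrite (bdd0 _ _ K0 mf fK) NmE; congr itg; apply/funext => t.
    rewrite -(dmap_mul _ s1) /f /h /trunc; case: ifP => // _.
    by rewrite dmap0 !mul0r.
  have e2 : nrm r f = Nm s h `^ r^-1 by rewrite lpnE (Nm_dmap _ (conj_expC rs)).
  have := phiC _ LPf; rewrite e1 e2 ger0_norm ?Nm_ge0 //.
  set N := Nm s h; have N0 : 0 <= N := Nm_ge0 _ _.
  have [->|Nn] := eqVneq N 0; first by rewrite powR_ge0.
  have Np : 0 < N by rewrite lt_neqAle eq_sym Nn.
  have e3 : N = N `^ r^-1 * N `^ s^-1.
    by rewrite -powRD; [case: rs => _ _ ->; rewrite powRr1|rewrite Nn implybT].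
  rewrite {1}e3 [_ * N `^ s^-1]mulrC ler_pM2r ?powR_gt0 // => h1.
  rewrite -(powR_invK s0 N0) ler_powR2r ?powR_ge0 ?(ltW s0) //.
exists g => // f Lf; apply/eqP; rewrite -subr_eq0 -normr_le0.
have key n : `|phi f - pairing f g| <= (C + nrm s g) * nrm r (fsub f (trunc n%:R f)).
  have Lt : LP r (trunc n%:R f) by exact: Lp_trunc.
  have Ld := LpB r0w Lf Lt.
  have e1 : phi (trunc n%:R f) = pairing (trunc n%:R f) g.
    rewrite pairingE; apply: (bdd0 _ (n%:R + 1)); [by rewrite ltr_wpDl|exact: Lp_meas Lt|].
    by move=> t; rewrite (le_trans (trunc_bound f t (ler0n R n))) // lerDl.
  have -> : phi f - pairing f g = phi (fsub f (trunc n%:R f)) - pairing (fsub f (trunc n%:R f)) g.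
    rewrite (phiB phiD phiZ) // (pairingBl rs) // e1; ring.
  apply: (le_trans (ler_normB _ _)); rewrite mulrDl lerD ?phiC //.
  by rewrite mulrC; exact: (pairing_le rs).
have c1 : (C + nrm s g) * nrm r (fsub f (trunc n%:R f)) @[n --> \oo] --> 0.
  by rewrite -(mulr0 (C + nrm s g)); apply: cvgM; [exact: cvg_cst|exact: cvg_lpn_trunc].
by apply: (ler_cvg_to (cvg_cst `|phi f - pairing f g|) c1); exact: nearW.
Qed.

End riesz_representation.

(** * Limits along an ultrafilter *)

Existing Class ultrafilter_nat.

#[global] Instance ultra_filter (U : set_system nat) (Uu : ultrafilter_nat U) :
  ProperFilter U.
Proof.
case: Uu => U0 [UT [US [UI UC]]]; split=> //; split=> //.
by move=> P Q PQ UP; exact: US UP PQ.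
Qed.

Section ulimits.
Context {R : realType} (U : set_system nat) {Uu : ultrafilter_nat U}.
Implicit Types (a b : nat -> R) (l M : R).

Lemma ulim_cvg a l : ulim U a l <-> a n @[n --> U] --> l.
Proof.
split=> [h|/cvgrPdist_lt h e e0]; last first.
  by apply: filterS (h e e0) => n /=; rewrite distrC.
by apply/cvgrPdist_lt => e e0; apply: filterS (h e e0) => n /=; rewrite distrC.
Qed.

Lemma ultra_notin (P : set nat) : ~ U P -> U (~` P).
Proof. by case: Uu => _ [_ [_ [_ UC]]] nP; case: (UC P). Qed.

(** The limit is the supremum of the levels [t] with [t <= a n] along [U]. A level above the
    supremum fails, and then [U] contains the complement. *)
Lemma ubounded_cvg a M : (forall n, `|a n| <= M) -> exists l, a n @[n --> U] --> l.
Proof.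
move=> aM; pose S := [set t : R | U [set n | t <= a n]].
have hb : has_sup S.
  split.
    exists (- M); rewrite /S /=; apply: filterS filterT => n _ /=.
    by have := aM n; rewrite ler_norml => /andP[].
  exists M => t; rewrite /S /= => /filter_ex[n /= h].
  by have := aM n; rewrite ler_norml => /andP[_]; exact: le_trans h.
exists (sup S); apply/cvgrPdist_le => e e0.
have [t St tS] := sup_adherent e0 hb.
have nS : ~ S (sup S + e).
  by move=> /(sup_ubound (proj2 hb)); rewrite gerDl leNgt e0.
apply: filterS2 St (ultra_notin nS) => n /= h1 /negP; rewrite -ltNge => h2.
by rewrite ler_norml; apply/andP; split; lra.
Qed.

Lemma ucvg_unique a l l' : a n @[n --> U] --> l -> a n @[n --> U] --> l' -> l = l'.
Proof. by move=> h h'; exact: (cvg_unique (@Rhausdorff R) h h'). Qed.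

Lemma ucvg0_le a b : (\forall n \near U, `|a n| <= b n) ->
  b n @[n --> U] --> 0 -> a n @[n --> U] --> 0.
Proof.
move=> ab /cvgrPdist_le b0; apply/cvgrPdist_le => e e0.
apply: filterS2 ab (b0 e e0) => n h1; rewrite !sub0r !normrN => h2.
by rewrite (le_trans h1) // (le_trans _ h2) // ler_norm.
Qed.

Lemma ucvg0P a : (forall e : R, 0 < e -> \forall n \near U, `|a n| <= e) ->
  a n @[n --> U] --> 0.
Proof.
move=> h; apply/cvgrPdist_le => e e0; apply: filterS (h e e0) => n.
by rewrite sub0r normrN.
Qed.

Lemma ucvg0_near a e : a n @[n --> U] --> 0 -> 0 < e -> \forall n \near U, `|a n| <= e.
Proof.
move=> /cvgrPdist_le h e0; apply: filterS (h e e0) => n.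
by rewrite sub0r normrN.
Qed.

Lemma ucvg_le a l M : a n @[n --> U] --> l -> (\forall n \near U, a n <= M) -> l <= M.
Proof. by move=> al aM; apply: (ler_cvg_to al (cvg_cst M)). Qed.

Lemma ucvg_norm_le a l M : a n @[n --> U] --> l -> (\forall n \near U, `|a n| <= M) ->
  `|l| <= M.
Proof. by move=> al aM; apply: (ucvg_le (a := fun n => `|a n|)) => //; exact: cvg_norm. Qed.

Lemma ucvg_ge a l M : a n @[n --> U] --> l -> (\forall n \near U, M <= a n) -> M <= l.
Proof. by move=> al aM; apply: (ler_cvg_to (cvg_cst M) al). Qed.

Lemma unear_ge : nonprincipal U -> forall N, \forall n \near U, (N <= n)%N.
Proof.
move=> Unp; elim=> [|N IH]; first exact: nearW.
apply: filterS2 IH (ultra_notin (Unp N)) => n Nn /= nN.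
by rewrite ltn_neqAle Nn andbT; apply/eqP => h; apply: nN.
Qed.

Lemma unear_ex2 (P Q : set nat) : U P -> U Q -> exists2 n, P n & Q n.
Proof. by move=> UP UQ; have [n [? ?]] := filter_ex (filterI UP UQ); exists n. Qed.

Lemma near_seq (T : eqType) (s : seq T) (P : T -> set nat) :
  (forall x, x \in s -> U (P x)) -> U [set n | forall x, x \in s -> P x n].
Proof.
elim: s => [_|x s IH H]; first by apply: filterS filterT.
have h1 : U (P x) by apply: H; rewrite mem_head.
have h2 : U [set n | forall y, y \in s -> P y n].
  by apply: IH => y ys; apply: H; rewrite in_cons ys orbT.
apply: filterS2 h1 h2 => n h1 h2 y; rewrite in_cons => /predU1P[->//|]; exact: h2.
Qed.

End ulimits.

(** * Bounded sequences, weakly null sequences *)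

Definition ubdd {R : realType} (r : R) (x : useq R) : Prop :=
  (forall n, LP r (x n)) /\ exists M : R, forall n, nrm r (x n) <= M.

Definition unull {R : realType} (U : set_system nat) (r : R) (x : useq R) : Prop :=
  nrm r (x n) @[n --> U] --> 0.

Definition upair {R : realType} (U : set_system nat) (x y : useq R) : R :=
  lim (pairing (x n) (y n) @[n --> U]).

Definition wnull {R : realType} (U : set_system nat) (r s : R) (x : useq R) : Prop :=
  ubdd r x /\ forall y, LP s y -> pairing (x n) y @[n --> U] --> 0.

(* Up to a null sequence, these are the bounded sequences that live on sets of
   measure tending to zero. *)
Definition Dz {R : realType} (U : set_system nat) (r : R) (x : useq R) : Prop :=
  ubdd r x /\ itg (fun t => `|x n t|) @[n --> U] --> 0.

(* Equivalently, the r-th powers are uniformly integrable along [U]. *)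
Definition Bz {R : realType} (U : set_system nat) (r s : R) (x : useq R) : Prop :=
  ubdd r x /\ forall y, Dz U s y -> pairing (x n) (y n) @[n --> U] --> 0.

Section sequences.
Context {R : realType} (U : set_system nat) {Uu : ultrafilter_nat U}.
Variables (r s : R).
Hypothesis rs : conj_exp r s.
Implicit Types (x y z : useq R) (f g : R -> R) (c K M : R).

Let r1 : 1 < r. Proof. by case: rs. Qed.
Let r0 : 0 < r. Proof. exact: lt_trans r1. Qed.
Let r0w : 0 <= r. Proof. exact: ltW. Qed.
Let s1 : 1 < s. Proof. by case: rs. Qed.
Let s0 : 0 < s. Proof. exact: lt_trans s1. Qed.

Lemma ubdd_pos x : ubdd r x -> exists2 M : R, 0 < M & forall n, nrm r (x n) <= M.
Proof.
move=> [_ [M xM]]; exists (`|M| + 1) => [|n]; first by rewrite ltr_wpDl.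
by rewrite (le_trans (xM n)) // (le_trans (ler_norm M)) // lerDl.
Qed.

Lemma ubddD x y : ubdd r x -> ubdd r y -> ubdd r (uadd x y).
Proof.
move=> [Lx [M xM]] [Ly [N yN]]; split=> [n|]; first exact: LpD.
by exists (M + N) => n; apply: (le_trans (lpn_triangle _ _ _)); rewrite // lerD.
Qed.

Lemma ubddB x y : ubdd r x -> ubdd r y -> ubdd r (usub x y).
Proof.
move=> [Lx [M xM]] [Ly [N yN]]; split=> [n|]; first exact: LpB.
by exists (M + N) => n; apply: (le_trans (lpn_triangleB _ _ _)); rewrite // lerD.
Qed.

Lemma ubddZ c x : ubdd r x -> ubdd r (uscale c x).
Proof.
move=> [Lx [M xM]]; split=> [n|]; first exact: LpZ.
by exists (`|c| * M) => n; rewrite lpnZ // ler_wpM2l.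
Qed.

Lemma ubdd_cst f : LP r f -> ubdd r (fun=> f).
Proof. by move=> Lf; split=> //; exists (nrm r f). Qed.

Lemma ubdd_dmap x : ubdd r x -> ubdd s (fun n t => dmap r (x n t)).
Proof.
move=> bx; have [Lx _] := bx; have [M M0 xM] := ubdd_pos bx.
split=> [n|]; first exact: (Lp_dmap rs).
exists ((M `^ r) `^ s^-1) => n; rewrite lpnE (Nm_dmap _ rs).
by rewrite ler_powR2r ?Nm_ge0 ?invr_ge0 ?(ltW s0) // -lpn_le // ltW.
Qed.

Lemma ubdd_le x y : ubdd r y -> (forall n, meas (x n)) ->
  (forall n t, `|x n t| <= `|y n t|) -> ubdd r x.
Proof.
move=> [Ly [M yM]] mx xy.
have Lx n : LP r (x n) by exact: (Lp_le _ (mx n) (xy n) (Ly n)).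
split=> //; exists M => n; apply: le_trans (yM n).
exact: lpn_mono.
Qed.

Lemma ubdd_nrm_cvg x : ubdd r x -> exists2 l : R, 0 <= l & nrm r (x n) @[n --> U] --> l.
Proof.
move=> [Lx [M xM]]; have [l h] : exists l : R, nrm r (x n) @[n --> U] --> l.
  by apply: (@ubounded_cvg _ _ _ _ M) => n; rewrite ger0_norm ?lpn_ge0.
by exists l => //; apply: (ucvg_ge h); apply: nearW => n; exact: lpn_ge0.
Qed.

Lemma upairP x y : ubdd r x -> ubdd s y ->
  pairing (x n) (y n) @[n --> U] --> upair U x y.
Proof.
move=> [Lx [M xM]] [Ly [N yN]]; apply/cvg_ex.
apply: (@ubounded_cvg _ _ _ _ (M * N)) => n.
by rewrite (le_trans (pairing_le rs (Lx n) (Ly n))) // ler_pM ?lpn_ge0.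
Qed.

Lemma upairE x y l : pairing (x n) (y n) @[n --> U] --> l -> upair U x y = l.
Proof. by move=> h; apply/cvg_lim. Qed.

Lemma upairDl x y z : ubdd r x -> ubdd r y -> ubdd s z ->
  upair U (uadd x y) z = upair U x z + upair U y z.
Proof.
move=> bx by_ bz; apply: upairE.
under eq_fun do rewrite (pairingDl rs (bx.1 _) (by_.1 _) (bz.1 _)).
by apply: cvgD; exact: upairP.
Qed.

Lemma upairBl x y z : ubdd r x -> ubdd r y -> ubdd s z ->
  upair U (usub x y) z = upair U x z - upair U y z.
Proof.
move=> bx by_ bz; apply: upairE.
under eq_fun do rewrite (pairingBl rs (bx.1 _) (by_.1 _) (bz.1 _)).
by apply: cvgB; exact: upairP.
Qed.

Lemma upairZl c x z : ubdd r x -> ubdd s z -> upair U (uscale c x) z = c * upair U x z.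
Proof.
move=> bx bz; apply: upairE.
under eq_fun do rewrite (pairingZl rs c (bx.1 _) (bz.1 _)).
by apply: cvgM; [exact: cvg_cst|exact: upairP].
Qed.

Lemma upair_le x y (l : R) M : ubdd r x -> ubdd s y -> nrm r (x n) @[n --> U] --> l ->
  (forall n, nrm s (y n) <= M) -> `|upair U x y| <= l * M.
Proof.
move=> bx by_ xl yM; have h : `|pairing (x n) (y n)| @[n --> U] --> `|upair U x y|.
  by apply: cvg_norm; exact: upairP.
have h2 : nrm r (x n) * M @[n --> U] --> l * M by apply: cvgM => //; exact: cvg_cst.
apply: (ler_cvg_to h h2).
apply: nearW => n; rewrite (le_trans (pairing_le rs (bx.1 n) (by_.1 n))) //.
by rewrite ler_wpM2l ?lpn_ge0.
Qed.

Lemma upair_null x y : ubdd r x -> ubdd s y -> unull U r x -> upair U x y = 0.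
Proof.
move=> bx by_ nx; have [_ [M yM]] := by_.
by apply/eqP; rewrite -normr_le0 -(mul0r M); apply: upair_le.
Qed.

(* Reflexivity: the functional [y |-> lim <x_n, y>] on L^s is represented in L^r. *)
Lemma weak_limit x : ubdd r x -> exists2 f, LP r f & wnull U r s (usub x (fun=> f)).
Proof.
move=> bx; pose phi (y : R -> R) := upair U x (fun=> y).
have [M M0 xM] := ubdd_pos bx.
have sr := conj_expC rs.
have cvphi (y : R -> R) : LP s y -> pairing (x n) y @[n --> U] --> phi y.
  by move=> Ly; apply: upairP => //; split=> //; exists (nrm s y).
have dphi : dualfun s phi.
  split=> [f g Lf Lg|c f Lf|].
  - apply: upairE; under eq_fun do rewrite pairingC (pairingDl sr Lf Lg (bx.1 _)).
    by apply: cvgD; under eq_fun do rewrite pairingC; exact: cvphi.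
  - apply: upairE; under eq_fun do rewrite pairingC (pairingZl sr c Lf (bx.1 _)).
    by apply: cvgM; [exact: cvg_cst|under eq_fun do rewrite pairingC; exact: cvphi].
  exists M => f Lf; apply: (ucvg_norm_le (cvphi _ Lf)); apply: nearW => n.
  by rewrite (le_trans (pairing_le rs (bx.1 n) Lf)) // ler_wpM2r ?lpn_ge0.
have [f Lf Hf] := riesz sr dphi; exists f => //; split.
  by apply: ubddB => //; exact: ubdd_cst.
move=> y Ly; under eq_fun do rewrite (pairingBl rs (bx.1 _) Lf Ly).
rewrite -(subrr (pairing f y)); apply: cvgB; last exact: cvg_cst.
by rewrite pairingC -Hf //; exact: cvphi.
Qed.

Lemma unullD x y : ubdd r x -> ubdd r y -> unull U r x -> unull U r y -> unull U r (uadd x y).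
Proof.
move=> bx by_ nx ny; apply: (@ucvg0_le _ _ _ _ (fun n => nrm r (x n) + nrm r (y n))).
  apply: nearW => n; rewrite ger0_norm ?lpn_ge0 //.
  exact: (lpn_triangle r1 (bx.1 n) (by_.1 n)).
by rewrite -(addr0 (0 : R)); exact: cvgD.
Qed.

Lemma unullZ c x : ubdd r x -> unull U r x -> unull U r (uscale c x).
Proof.
move=> bx nx; rewrite /unull; under eq_fun do rewrite (lpnZ c r0 (bx.1 _)).
by rewrite -(mulr0 `|c|); apply: cvgM => //; exact: cvg_cst.
Qed.

Lemma unull_subC x y : unull U r (usub x y) -> unull U r (usub y x).
Proof. by rewrite /unull; under eq_fun do rewrite lpn_subC. Qed.

Lemma wnull_unull x : ubdd r x -> unull U r x -> wnull U r s x.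
Proof.
move=> bx nx; split=> // y Ly; apply: (@ucvg0_le _ _ _ _ (fun n => nrm r (x n) * nrm s y)).
  by apply: nearW => n; exact: (pairing_le rs (bx.1 n) Ly).
by rewrite -(mul0r (nrm s y)); apply: cvgM => //; exact: cvg_cst.
Qed.

Lemma wnullD x y : wnull U r s x -> wnull U r s y -> wnull U r s (uadd x y).
Proof.
move=> [bx wx] [by_ wy]; split=> [|z Lz]; first exact: ubddD.
under eq_fun do rewrite (pairingDl rs (bx.1 _) (by_.1 _) Lz).
by rewrite -(addr0 (0 : R)); apply: cvgD; [exact: wx|exact: wy].
Qed.

Lemma wnullZ c x : wnull U r s x -> wnull U r s (uscale c x).
Proof.
move=> [bx wx]; split=> [|z Lz]; first exact: ubddZ.
under eq_fun do rewrite (pairingZl rs c (bx.1 _) Lz).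
by rewrite -(mulr0 c); apply: cvgM; [exact: cvg_cst|exact: wx].
Qed.

Lemma usubE x y : usub x y = uadd x (uscale (-1) y).
Proof. by apply/funext => n; apply/funext => t; rewrite /usub /uadd /fsub /fadd /uscale /fscale mulN1r. Qed.

Lemma wnullB x y : wnull U r s x -> wnull U r s y -> wnull U r s (usub x y).
Proof. by move=> wx wy; rewrite usubE; apply: wnullD => //; exact: wnullZ. Qed.

Lemma upair_cst x f : wnull U r s x -> LP s f -> upair U x (fun=> f) = 0.
Proof. by move=> [_ wx] Lf; apply: upairE; exact: wx. Qed.

End sequences.

Section sequences2.
Context {R : realType} (U : set_system nat) {Uu : ultrafilter_nat U}.
Variables (r s : R).
Hypothesis rs : conj_exp r s.
Implicit Types (x y z : useq R) (f g : R -> R) (c K M : R).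

Let r1 : 1 < r. Proof. by case: rs. Qed.
Let r0 : 0 < r. Proof. exact: lt_trans r1. Qed.
Let s1 : 1 < s. Proof. by case: rs. Qed.
Let s0 : 0 < s. Proof. exact: lt_trans s1. Qed.
Let sr := conj_expC rs.

Lemma upairC x y : upair U x y = upair U y x.
Proof. by rewrite /upair; under eq_fun do rewrite pairingC. Qed.

Lemma upair_dmap_null x : ubdd r x -> upair U x (fun n t => dmap r (x n t)) = 0 -> unull U r x.
Proof.
move=> bx h; have := upairP (Uu := Uu) rs bx (ubdd_dmap rs bx); rewrite h => {}h.
apply: ucvg0P => e e0; have := ucvg0_near (Uu := Uu) h (powR_gt0 r e0).
apply: filterS => n; rewrite (pairing_dmap _ r1) !ger0_norm ?Nm_ge0 ?lpn_ge0 //.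
by rewrite lpn_le // ltW.
Qed.

(** The duality image of [x] detects whether [x] is null. Subtracting its weak limit turns it into a
    weakly null test sequence, and the subtracted constant pairs to zero with [x]. *)
Lemma wnull_separated x : wnull U r s x ->
  (forall psi, wnull U s r psi -> upair U x psi = 0) -> unull U r x.
Proof.
move=> wx H; have bx := wx.1; apply: upair_dmap_null => //.
have bd := ubdd_dmap rs bx; have [g Lg wg] := weak_limit (Uu := Uu) sr bd.
have := H _ wg; rewrite upairC (upairBl sr bd (ubdd_cst Lg) bx) (upairC (fun=> g)).
by rewrite (upair_cst wx Lg) subr0 upairC.
Qed.

Lemma pairing_trunc_le x (y : R -> R) K : ubdd r x -> LP s y -> 0 <= K -> forall n,
  `|pairing (x n) y| <= K * itg (fun t => `|x n t|) + nrm r (x n) * nrm s (fsub y (trunc K y)).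
Proof.
move=> bx Ly K0 n; have Lt : LP s (trunc K y) by apply: Lp_trunc => //; exact: ltW.
have Lx := bx.1 n; have Ld := LpB (ltW s0) Ly Lt.
have -> : pairing (x n) y = pairing (x n) (trunc K y) + pairing (x n) (fsub y (trunc K y)).
  by rewrite [in RHS]pairingC [X in _ + X]pairingC (pairingBl sr) // addrC subrK pairingC.
apply: (le_trans (ler_normD _ _)); apply: lerD; last exact: (pairing_le rs).
have L1x : L1 (x n) by apply: Lp_L1 Lx; exact: ltW.
have Lp_ := L1_pair rs Lx Lt.
rewrite pairingE; apply: (le_trans (itg_norm Lp_)).
rewrite -itgZ; last exact: L1_norm.
apply: itg_le; [exact: L1_norm|exact/L1Z/L1_norm|] => t.
by rewrite normrM mulrC ler_wpM2r // trunc_bound.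
Qed.

(** Bounded test functions see only the L^1 norm, and truncations approximate every [y] in L^s. *)
Lemma Dz_wnull x : Dz U r x -> wnull U r s x.
Proof.
move=> [bx x0]; split=> // y Ly; have [M M0 xM] := ubdd_pos bx.
apply: ucvg0P => e e0.
have /cvgrPdist_le := cvg_lpn_trunc s0 Ly => /(_ (e / 2 / M)).
have eM : 0 < e / 2 / M by rewrite !divr_gt0.
move=> /(_ eM) /filter_ex[K]; rewrite sub0r normrN ger0_norm ?lpn_ge0 // => hK.
have K1 : 0 < K%:R + 1 :> R by rewrite ltr_wpDl.
have eK : 0 < e / 2 / (K%:R + 1) by rewrite !divr_gt0.
apply: filterS (ucvg0_near x0 eK) => n; rewrite ger0_norm ?itg_ge0 // => hn.
apply: (le_trans (pairing_trunc_le bx Ly (ler0n R K) n)).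
rewrite (splitr e); apply: lerD.
  apply: (@le_trans _ _ ((K%:R + 1) * (e / 2 / (K%:R + 1)))).
    by apply: ler_pM => //; [exact: itg_ge0|rewrite lerDl].
  by rewrite mulrC divfK // gt_eqF.
apply: (@le_trans _ _ (M * (e / 2 / M))); last by rewrite mulrC divfK // gt_eqF.
by apply: ler_pM; rewrite ?lpn_ge0.
Qed.

End sequences2.

(** * Splitting off the concentrating part *)

Section splitting.
Context {R : realType} (U : set_system nat) {Uu : ultrafilter_nat U}.
Hypothesis Unp : nonprincipal U.
Variables (r s : R).
Hypothesis rs : conj_exp r s.
Implicit Types (x y z : useq R) (f g : R -> R) (c K M : R).

Let r1 : 1 < r. Proof. by case: rs. Qed.
Let r0 : 0 < r. Proof. exact: lt_trans r1. Qed.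
Let r0w : 0 <= r. Proof. exact: ltW. Qed.
Let s1 : 1 < s. Proof. by case: rs. Qed.
Let s0 : 0 < s. Proof. exact: lt_trans s1. Qed.
Let sr := conj_expC rs.

Lemma Dz_dmap x : Dz U r x -> Dz U s (fun n t => dmap r (x n t)).
Proof.
move=> [bx x0]; split; first exact: ubdd_dmap.
have [M M0 xM] := ubdd_pos bx.
have r10 : 0 < r - 1 by rewrite subr_gt0.
apply: ucvg0P => e e0.
have e3 : 0 < e / 3 by rewrite divr_gt0.
pose d := (e / 3) `^ (r - 1)^-1; have d0 : 0 < d by rewrite powR_gt0.
have dE : d `^ (r - 1) = e / 3 by rewrite powR_invK // ltW.
have Mr0 : 0 < M `^ r by rewrite powR_gt0.
pose K := 3 * M `^ r / e; have K0 : 0 < K by rewrite divr_gt0 // mulr_gt0.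
(* Three ranges of [u]: the power is small up to [d], at most a multiple of [u] between [d] and [K],
   and at most [u^r / K] beyond. The second part integrates to something tending to zero; [K] is
   chosen to make the third small. *)
have key (u : R) : 0 <= u -> u `^ (r - 1) <= e / 3 + K `^ (r - 1) / d * u + K^-1 * u `^ r.
  move=> u0.
  have h1 : 0 <= K `^ (r - 1) / d * u by rewrite !mulr_ge0 ?powR_ge0 // invr_ge0 ltW.
  have h2 : 0 <= K^-1 * u `^ r by rewrite mulr_ge0 ?powR_ge0 // invr_ge0 ltW.
  have [ud|du] := leP u d.
    have : u `^ (r - 1) <= d `^ (r - 1) by rewrite ler_powR2r // ltW.
    by rewrite dE; lra.
  have [uK|Ku] := leP u K.
    have : u `^ (r - 1) <= K `^ (r - 1) / d * u.
      rewrite mulrAC -mulrA -[leLHS]mulr1 ler_pM ?powR_ge0 //.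
        by rewrite ler_powR2r // ltW.
      by rewrite ler_pdivlMr // mul1r ltW.
    lra.
  have : u `^ (r - 1) <= K^-1 * u `^ r.
    rewrite -(powRS u0 r1) mulrC -mulrA -[leLHS]mulr1 ler_wpM2l ?powR_ge0 //.
    by rewrite ler_pdivlMr // mul1r ltW.
  lra.
have cK : 0 <= K `^ (r - 1) / d by rewrite divr_ge0 ?powR_ge0 // ltW.
have eK : 0 < e / 3 / (K `^ (r - 1) / d + 1) by rewrite divr_gt0 // ltr_wpDl.
apply: filterS (ucvg0_near x0 eK) => n; rewrite (ger0_norm (itg_ge0 _)) // => hn.
rewrite ger0_norm ?itg_ge0 //.
have Lx := bx.1 n; have /LpP[mx Lxr] := Lx; have L1x : L1 (x n) := Lp_L1 (ltW r1) Lx.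
have La := L1D (L1D (L1_cst (e / 3)) (L1Z (K `^ (r - 1) / d) (L1_norm L1x))) (L1Z K^-1 Lxr).
have Ld : L1 (fun t => `|dmap r (x n t)|).
  by apply: L1_norm; apply: (Lp_L1 (ltW s1)); exact: (Lp_dmap rs).
apply: (le_trans (itg_le Ld La _)).
  by move=> t; rewrite normr_dmap //; exact: key.
rewrite itgD; [|by apply: L1D; [exact: L1_cst|exact/L1Z/L1_norm]|exact: L1Z].
rewrite itgD; [|exact: L1_cst|exact/L1Z/L1_norm].
rewrite itg_cst itgZ; last exact: L1_norm.
rewrite itgZ // -NmE.
have hN : Nm r (x n) <= M `^ r by rewrite -lpn_le // ltW.
have b3 : K^-1 * Nm r (x n) <= e / 3.
  apply: (@le_trans _ _ (K^-1 * M `^ r)).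
    by rewrite ler_wpM2l // invr_ge0 ltW.
  have -> // : K^-1 * M `^ r = e / 3.
  by rewrite /K; field; rewrite !gt_eqF.
have b2 : K `^ (r - 1) / d * itg (fun t => `|x n t|) <= e / 3.
  apply: (@le_trans _ _ ((K `^ (r - 1) / d + 1) * (e / 3 / (K `^ (r - 1) / d + 1)))).
    by apply: ler_pM => //; [exact: itg_ge0|rewrite lerDl].
  by rewrite mulrC divfK // gt_eqF // ltr_wpDl.
by lra.
Qed.

(** By [Dz_dmap] the duality image of [x] also concentrates, so [x] pairs to zero with a sequence
    that norms it. *)
Lemma Dz_Bz_null x : Dz U r x -> Bz U r s x -> unull U r x.
Proof.
move=> Dx [bx Bx]; apply: (upair_dmap_null rs) => //.
by apply: upairE; apply: Bx; exact: Dz_dmap.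
Qed.

Lemma bounded_pairing_le f g K : LP r f -> meas g -> (forall t, `|g t| <= K) ->
  `|pairing f g| <= K * itg (fun t => `|f t|).
Proof.
move=> Lf mg gK; have Lg : LP s g by apply: Lp_bounded gK => //; exact: ltW.
have L1f : L1 f := Lp_L1 (ltW r1) Lf; have Lp_ := L1_pair rs Lf Lg.
rewrite pairingE; apply: (le_trans (itg_norm Lp_)).
rewrite -itgZ; last exact: L1_norm.
apply: itg_le; [exact: L1_norm|exact/L1Z/L1_norm|] => t.
by rewrite normrM mulrC ler_wpM2r.
Qed.

Lemma Nm_trunc_sub f k l : LP r f -> k <= l ->
  Nm r (fsub (trunc l f) (trunc k f)) = Nm r (trunc l f) - Nm r (trunc k f).
Proof.
move=> Lf kl; have /LpP[_ Ll] : LP r (trunc l f) by exact: Lp_trunc.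
have /LpP[_ Lk] : LP r (trunc k f) by exact: Lp_trunc.
rewrite !NmE -itgB //; congr itg; apply/funext => t; rewrite /fsub /trunc.
have [h|h] := leP `|f t| k; first by rewrite (le_trans h kl) subrr normr0 powR0 ?gt_eqF // subrr.
by case: ifP => _; rewrite ?subr0 ?normr0 // powR0 ?subr0 ?gt_eqF.
Qed.

(** The subsequence splitting of Kadec and Pelczynski, with an ultrafilter in place of the
    subsequence: the levels [K n] tend to infinity along [U], but so slowly that the truncated
    sequence has uniformly integrable powers. *)
Lemma split_seq x : ubdd r x -> exists K : nat -> nat,
  let b n := trunc (K n)%:R (x n) in
  [/\ forall e : R, 0 < e -> exists k : nat,
        \forall n \near U, nrm r (fsub (b n) (trunc k%:R (x n))) <= e,
      Bz U r s b & Dz U r (usub x b)].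
Proof.
move=> bx; have [M M0 xM] := ubdd_pos bx; have Lx := bx.1.
have xMr n : Nm r (x n) <= M `^ r by rewrite -lpn_le // ltW.
have tMr k n : Nm r (trunc k (x n)) <= M `^ r.
  by apply: le_trans (xMr n); apply: Nm_le => //; [exact: Lp_trunc|exact: trunc_le].
have Hlim (k : nat) : exists l : R, Nm r (trunc k%:R (x n)) @[n --> U] --> l.
  by apply: (@ubounded_cvg _ _ _ _ (M `^ r)) => n; rewrite ger0_norm ?Nm_ge0.
have [phi Hphi] := choice Hlim.
have phiM k : phi k <= M `^ r.
  by apply: (ucvg_le (Hphi k)); apply: nearW => n; exact: tMr.
pose L := sup (range phi).
have hs : has_sup (range phi).
  by split; [exists (phi 0%N), 0%N|exists (M `^ r) => _ [k _ <-]].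
have phiL k : phi k <= L by apply: (sup_ubound hs.2); exists k.
pose S (k n : nat) := Nm r (trunc k%:R (x n)) <= phi k + k.+1%:R^-1.
have US k : \forall n \near U, S k n.
  have /cvgrPdist_le := Hphi k => /(_ k.+1%:R^-1); rewrite invr_gt0 ltr0Sn => /(_ isT).
  by apply: filterS => n; rewrite /S distrC -lerBlDl; exact: le_trans (ler_norm _).
(* Each fixed level qualifies along [U], so [K] tends to infinity; yet the mass of the truncation at
   level [K n] exceeds the supremum [L] of the limit masses by at most [1 / (K n + 1)]. *)
pose K n := \max_(k < n.+1 | S k n) (k : nat).
have Kge k : \forall n \near U, (k <= K n)%N.
  apply: filterS2 (US k) (unear_ge Unp k) => n Sk kn.
  by have := @leq_bigmax_cond _ (fun i : 'I_n.+1 => S i n) (@nat_of_ord n.+1) (Ordinal (kn : k < n.+1)%N) Sk.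
have KS : \forall n \near U, S (K n) n.
  apply: filterS (US 0%N) => n S0.
  have [|i Si Ki] := @eq_bigmax_cond _ [pred i : 'I_n.+1 | S i n] (@nat_of_ord n.+1).
    by apply/card_gt0P; exists ord0.
  rewrite /K; rewrite (_ : \max_(k < n.+1 | S k n) k = i) //; exact: Ki.
exists K => b.
have Lt k n : LP r (trunc k (x n)) by exact: Lp_trunc.
have mb n : meas (b n) by exact: Lp_meas (Lt _ n).
have bb : ubdd r b.
  by apply: (ubdd_le rs bx mb) => n t; exact: trunc_le.
have appr e : 0 < e -> exists k : nat,
    \forall n \near U, nrm r (fsub (b n) (trunc k%:R (x n))) <= e.
  (* Three errors of size [h]: the gap between [phi k] and [L], the distance of the mass at level
     [k] from [phi k], and the excess [1 / (K n + 1)]. *)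
  move=> e0; pose h := e `^ r / 3.
  have er : 0 < e `^ r by rewrite powR_gt0.
  have h0 : 0 < h by rewrite divr_gt0.
  have [_ [k _ <-] Lk] := sup_adherent h0 hs.
  exists k; pose m := Num.truncn h^-1.
  have hm : m.+1%:R^-1 <= h.
    by rewrite -[leRHS]invrK lef_pV2 ?posrE ?invr_gt0 ?ltr0Sn // ltW // truncnS_gt.
  have /cvgrPdist_le := Hphi k => /(_ h h0) Hk.
  have Km := Kge (maxn k m).
  apply: filterS3 KS Km Hk => n SK /[!geq_max]/andP[kK mK] hn.
  rewrite lpn_le ?(ltW e0) // Nm_trunc_sub ?ler_nat //.
  have h1 : (K n).+1%:R^-1 <= h.
    apply: le_trans hm; rewrite lef_pV2 ?posrE ?ltr0Sn // ler_nat ltnS //.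
  have := phiL (K n); rewrite /S in SK; move: hn; rewrite ler_norml => /andP[h2 h3].
  have -> : e `^ r = h + h + h by rewrite /h; field.
  move: (_%:R^-1) h1 SK => w h1 SK hL; rewrite -/L in Lk; lra.
have Db : Dz U r (usub x b).
  split; first exact: (ubddB rs).
  apply: ucvg0P => e e0.
  have r10 : 0 < r - 1 by rewrite subr_gt0.
  have Mr : 0 < M `^ r by rewrite powR_gt0.
  (* The remainder lives where [|x n|] exceeds [K n >= k0]; there [|x n| <= k0^(1-r) |x n|^r], and
     [k0^(1-r) M^r = e]. *)
  pose k0 := (M `^ r / e) `^ (r - 1)^-1.
  have k00 : 0 < k0 by rewrite powR_gt0 // divr_gt0.
  apply: filterS (Kge (Num.truncn k0).+1) => n Kn.
  have kK : k0 <= (K n)%:R.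
    by rewrite ltW // (lt_le_trans (truncnS_gt k0)) // ler_nat.
  have Kp : 0 < (K n)%:R :> R by exact: lt_le_trans kK.
  have /LpP[mx Lxr] := Lx n.
  have L1d : L1 (usub x b n).
    by apply: (Lp_L1 (ltW r1)); exact: (LpB r0w (Lx n) (Lt _ n)).
  rewrite ger0_norm ?itg_ge0 //.
  apply: (@le_trans _ _ (k0 `^ (- (r - 1)) * Nm r (x n))).
    rewrite NmE -itgZ //; apply: itg_le; [exact: L1_norm|exact: L1Z|move=> t].
    rewrite /usub /fsub /b /trunc; case: ifP => h.
      by rewrite subrr normr0 mulr_ge0 ?powR_ge0.
    rewrite subr0; move/negbT : h; rewrite -ltNge => h.
    rewrite -(powRS _ r1) // mulrA -[leLHS]mul1r ler_wpM2r //.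
    rewrite -[leLHS](powR_mulN (r - 1) k00) mulrC ler_wpM2l ?powR_ge0 //.
    by rewrite ler_powR2r ?(ltW k00) ?(ltW r10) // (le_trans kK) // ltW.
  apply: (@le_trans _ _ (k0 `^ (- (r - 1)) * M `^ r)); first by rewrite ler_wpM2l ?powR_ge0.
  rewrite powRN powR_invK ?divr_ge0 ?powR_ge0 ?(ltW e0) // invf_div.
  by rewrite divfK // gt_eqF.
split=> //; split=> // y [by_ y0].
have [N N0 yN] := ubdd_pos by_.
apply: ucvg0P => e e0; have eN : 0 < e / 2 / N by rewrite !divr_gt0.
have [k Hk] := appr _ eN.
have k1 : 0 < k%:R + 1 :> R by rewrite ltr_wpDl.
have ek : 0 < e / 2 / (k%:R + 1) by rewrite !divr_gt0.
apply: filterS2 Hk (ucvg0_near y0 ek) => n hb; rewrite (ger0_norm (itg_ge0 _)) // => hy.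
have Ly := by_.1 n.
have -> : pairing (b n) (y n) = pairing (fsub (b n) (trunc k%:R (x n))) (y n)
    + pairing (trunc k%:R (x n)) (y n).
  by rewrite (pairingBl rs) ?subrK //; exact: Lt.
apply: (le_trans (ler_normD _ _)); rewrite (splitr e); apply: lerD.
  apply: (le_trans (pairing_le rs _ Ly)); first exact: (LpB r0w (Lt _ n) (Lt _ n)).
  apply: (@le_trans _ _ (e / 2 / N * N)); last by rewrite divfK // gt_eqF.
  by apply: ler_pM; rewrite ?lpn_ge0.
have L1y : L1 (y n) := Lp_L1 (ltW s1) Ly.
apply: (@le_trans _ _ (k%:R * itg (fun t => `|y n t|))).
  rewrite pairingC pairingE; have Lp_ := L1_pair sr Ly (Lt k%:R n).
  apply: (le_trans (itg_norm Lp_)).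
  rewrite -itgZ; last exact: L1_norm.
  apply: itg_le; [exact: L1_norm|exact/L1Z/L1_norm|] => t.
  by rewrite normrM mulrC ler_wpM2r // trunc_bound.
apply: (@le_trans _ _ ((k%:R + 1) * (e / 2 / (k%:R + 1)))).
  by apply: ler_pM => //; [exact: itg_ge0|rewrite lerDl].
by rewrite mulrC divfK // gt_eqF.
Qed.

End splitting.

(** * Bounded operators *)

Definition bop {R : realType} (r : R) (T : (R -> R) -> (R -> R)) : Prop :=
  [/\ forall f, LP r f -> LP r (T f),
      forall f g, LP r f -> LP r g -> nrm r (fsub f g) = 0 -> nrm r (fsub (T f) (T g)) = 0,
      forall f g, LP r f -> LP r g -> nrm r (fsub (T (fadd f g)) (fadd (T f) (T g))) = 0,
      forall a f, LP r f -> nrm r (fsub (T (fscale a f)) (fscale a (T f))) = 0 &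
      exists C : R, forall f, LP r f -> nrm r (T f) <= C * nrm r f].

Lemma LpOpP {R : realType} (r : R) T : LpOp r T <-> bop r T.
Proof.
rewrite /LpOp /bop LP.unlock nrm.unlock.
by split=> [[? [? [? [? ?]]]]|[? ? ? ? ?]].
Qed.

Section operators.
Context {R : realType}.
Variables (r s : R).
Hypothesis rs : conj_exp r s.
Implicit Types (f g y : R -> R) (c a : R) (T : (R -> R) -> (R -> R)).

Let r1 : 1 < r. Proof. by case: rs. Qed.
Let r0 : 0 < r. Proof. exact: lt_trans r1. Qed.
Let r0w : 0 <= r. Proof. exact: ltW. Qed.

Lemma pairing_eq_null f g y : LP r f -> LP r g -> LP s y ->
  nrm r (fsub f g) = 0 -> pairing f y = pairing g y.
Proof.
move=> Lf Lg Ly h; apply/eqP; rewrite -subr_eq0 -(pairingBl rs) //.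
by rewrite (pairing_null_l rs) //; exact: LpB.
Qed.

Lemma null_eq_pairing f g : LP r f -> LP r g ->
  (forall y, LP s y -> pairing f y = pairing g y) -> nrm r (fsub f g) = 0.
Proof.
move=> Lf Lg h; apply/le_anti; rewrite lpn_ge0 andbT.
apply: (lpn_dual_le rs) => [|//|y Ly]; first exact: LpB.
by rewrite (pairingBl rs) // h // subrr mul0r.
Qed.

Section bop.
Variable T : (R -> R) -> (R -> R).
Hypothesis bT : bop r T.

Lemma bop_LP f : LP r f -> LP r (T f).
Proof. by case: bT => h _ _ _ _; exact: h. Qed.

Lemma bop_pairingD f g y : LP r f -> LP r g -> LP s y ->
  pairing (T (fadd f g)) y = pairing (T f) y + pairing (T g) y.
Proof.
move=> Lf Lg Ly; rewrite -(pairingDl rs) //; [|exact: bop_LP|exact: bop_LP].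
apply: pairing_eq_null => //; [exact/bop_LP/LpD|by apply: LpD => //; exact: bop_LP|].
by case: bT => _ _ h _ _; exact: h.
Qed.

Lemma bop_pairingZ c f y : LP r f -> LP s y ->
  pairing (T (fscale c f)) y = c * pairing (T f) y.
Proof.
move=> Lf Ly; rewrite -(pairingZl rs) //; last exact: bop_LP.
apply: pairing_eq_null => //; [exact/bop_LP/LpZ|by apply: LpZ; exact: bop_LP|].
by case: bT => _ _ _ h _; exact: h.
Qed.

Lemma bop_bound : exists2 C : R, 0 < C & forall f, LP r f -> nrm r (T f) <= C * nrm r f.
Proof.
case: bT => _ _ _ _ [C h]; exists (`|C| + 1) => [|f Lf]; first by rewrite ltr_wpDl.
rewrite (le_trans (h f Lf)) // ler_wpM2r ?lpn_ge0 // (le_trans (ler_norm C)) //.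
by rewrite lerDl.
Qed.

Lemma bop_ubdd (x : useq R) : ubdd r x -> ubdd r (fun n => T (x n)).
Proof.
move=> bx; have [M M0 xM] := ubdd_pos bx; have [C C0 h] := bop_bound.
split=> [n|]; first exact/bop_LP/bx.1.
by exists (C * M) => n; rewrite (le_trans (h _ (bx.1 n))) // ler_wpM2l // ltW.
Qed.

End bop.

(** Linearity is required only modulo null functions, so it can be checked by pairings; additivity
    and the norm bound then make [T] respect null differences. *)
Lemma bop_intro T : (forall f, LP r f -> LP r (T f)) ->
  (forall f g y, LP r f -> LP r g -> LP s y ->
     pairing (T (fadd f g)) y = pairing (T f) y + pairing (T g) y) ->
  (forall c f y, LP r f -> LP s y -> pairing (T (fscale c f)) y = c * pairing (T f) y) ->
  (exists C : R, forall f, LP r f -> nrm r (T f) <= C * nrm r f) -> bop r T.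
Proof.
move=> LT TD TZ [C TC].
have DT f g : LP r f -> LP r g -> nrm r (fsub (T (fadd f g)) (fadd (T f) (T g))) = 0.
  move=> Lf Lg; have LTf := LT _ Lf; have LTg := LT _ Lg.
  apply: null_eq_pairing; [exact/LT/LpD|exact: LpD|move=> y Ly].
  by rewrite TD // (pairingDl rs).
have ZT a f : LP r f -> nrm r (fsub (T (fscale a f)) (fscale a (T f))) = 0.
  move=> Lf; have LTf := LT _ Lf.
  apply: null_eq_pairing; [exact/LT/LpZ|exact: LpZ|move=> y Ly].
  by rewrite TZ // (pairingZl rs).
split=> //; last by exists C.
move=> f g Lf Lg h; have Ld := LpB r0w Lf Lg.
have Td : nrm r (T (fsub f g)) = 0.
  by apply/le_anti; rewrite lpn_ge0 andbT (le_trans (TC _ Ld)) // h mulr0.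
apply: null_eq_pairing; [exact: LT|exact: LT|move=> y Ly].
have -> : f = fadd (fsub f g) g by apply/funext => t; rewrite /fadd /fsub subrK.
rewrite TD // (pairing_null_l rs) ?add0r //; exact: LT.
Qed.

End operators.

(** * Adjoints, by Riesz representation *)

Section adjoints.
Context {R : realType}.
Variables (r s : R).
Hypothesis rs : conj_exp r s.
Implicit Types (f g y : R -> R) (c a : R) (T : (R -> R) -> (R -> R)).

Let s1 : 1 < s. Proof. by case: rs. Qed.
Let s0 : 0 < s. Proof. exact: lt_trans s1. Qed.
Let sr := conj_expC rs.

Lemma adjoint T : bop r T -> exists2 T', bop s T' &
  forall f y, LP r f -> LP s y -> pairing (T f) y = pairing f (T' y).
Proof.
move=> bT; have [C C0 TC] := bop_bound bT.
have H (y : R -> R) : exists g : R -> R, LP s y -> LP s g /\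
    forall f, LP r f -> pairing (T f) y = pairing f g.
  have [Ly|nLy] := pselect (LP s y); last by exists y.
  have D : dualfun r (fun f => pairing (T f) y).
    split=> [f g Lf Lg|c f Lf|]; first exact: (bop_pairingD rs).
      exact: (bop_pairingZ rs).
    exists (C * nrm s y) => f Lf; have LT := bop_LP bT Lf.
    rewrite (le_trans (pairing_le rs LT Ly)) // mulrAC ler_wpM2r ?lpn_ge0 //; exact: TC.
  by have [g Lg Hg] := riesz rs D; exists g.
have [T' HT'] := choice H.
have LT' y : LP s y -> LP s (T' y) by move=> /HT'[].
have pT' f y : LP r f -> LP s y -> pairing (T' y) f = pairing (T f) y.
  by move=> Lf /HT'[_ h]; rewrite h // pairingC.
exists T'; last by move=> f y Lf Ly; rewrite [RHS]pairingC pT'.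
apply: (bop_intro sr) => //.
- move=> f g y Lf Lg Ly; have LTy := bop_LP bT Ly.
  rewrite !pT' //; last exact: (LpD (ltW s0)).
  by rewrite pairingC (pairingDl sr) // pairingC [X in _ + X]pairingC.
- move=> c f y Lf Ly; have LTy := bop_LP bT Ly.
  by rewrite !pT' //; [rewrite pairingC (pairingZl sr) // pairingC|exact: LpZ].
exists C => y Ly; apply: (lpn_dual_le sr) => [||f Lf]; first exact: LT'.
  by rewrite mulr_ge0 ?lpn_ge0 // ltW.
have LTf := bop_LP bT Lf.
rewrite pT' // (le_trans (ler_norm _)) // (le_trans (pairing_le rs LTf Ly)) //.
by rewrite mulrAC ler_wpM2r ?lpn_ge0 //; exact: TC.
Qed.

End adjoints.

(** * Concentrating sequences under bounded operators, for exponents above 2 *)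

Section concentration.
Context {R : realType} (U : set_system nat) {Uu : ultrafilter_nat U}.
Hypothesis Unp : nonprincipal U.
Variables (r s : R).
Hypothesis rs : conj_exp r s.
Implicit Types (x y z : useq R) (f g : R -> R) (c K M : R) (T : (R -> R) -> (R -> R)).

Let r1 : 1 < r. Proof. by case: rs. Qed.
Let r0 : 0 < r. Proof. exact: lt_trans r1. Qed.
Let r0w : 0 <= r. Proof. exact: ltW. Qed.
Let s1 : 1 < s. Proof. by case: rs. Qed.
Let s0 : 0 < s. Proof. exact: lt_trans s1. Qed.
Let sr := conj_expC rs.

Lemma Dz_abs x : Dz U r x -> Dz U r (fun n t => `|x n t|).
Proof.
move=> [bx x0]; split; last by under eq_fun do (under eq_fun do rewrite normr_id).
apply: (ubdd_le rs bx) => [n|n t]; last by rewrite normr_id.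
by apply: meas_norm; exact: Lp_meas (bx.1 n).
Qed.

(** [|f|^(r-1)] lies in L^s, and [|x n|] concentrates together with [x n], hence is weakly null. *)
Lemma cross_term_null x f : Dz U r x -> LP r f ->
  itg (fun t => `|f t| `^ (r - 1) * `|x n t|) @[n --> U] --> 0.
Proof.
move=> Dx Lf; have [_ wx] := Dz_wnull rs (Dz_abs Dx).
have Ld : LP s (fun t => `|dmap r (f t)|).
  have Lfd := Lp_dmap rs Lf; apply: (Lp_le (ltW s0) _ _ Lfd).
    by apply: meas_norm; exact: Lp_meas Lfd.
  by move=> t; rewrite normr_id.
have := wx _ Ld; under eq_fun do rewrite pairingC pairingE.
by under eq_fun do (under eq_fun do rewrite normr_dmap //).
Qed.

Lemma Nm_cross f g : LP r f -> LP r g ->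
  Nm r (fadd f g) <= Nm r f + r * 2 `^ r * itg (fun t => `|f t| `^ (r - 1) * `|g t|)
    + r * 2 `^ r * Nm r g.
Proof.
move=> Lf Lg; have /LpP[mf Lfr] := Lf; have /LpP[mg Lgr] := Lg.
have /LpP[_ Lfg] := LpD r0w Lf Lg.
have Lc : L1 (fun t => `|f t| `^ (r - 1) * `|g t|).
  have := L1_norm (L1_pair sr (Lp_dmap rs Lf) Lg).
  by under eq_fun do rewrite normrM normr_dmap //.
rewrite !NmE -!itgZ // -itgD //; last exact: L1Z.
rewrite -itgD; [|by apply: L1D => //; exact: L1Z|exact: L1Z].
apply: itg_le => // [|t]; last exact: normr_powR_add_cross.
by apply: L1D; [apply: L1D => //; exact: L1Z|exact: L1Z].
Qed.

Lemma pairing_self f : pairing f f = Nm 2 f.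
Proof.
rewrite pairingE NmE; congr itg; apply/funext => t.
by rewrite (powR_mulrn 2) // -normrX ger0_norm ?sqr_ge0 // expr2.
Qed.

(* Sums of [N] almost disjoint signed terms have r-norm of order [N^(1/r)], whereas
   their images, if not null in L^1, have 2-norm at least of order [N^(1/2)]. *)
Lemma bop_Dz T x : 2 < r -> bop r T -> Dz U r x -> Dz U r (fun n => T (x n)).
Proof.
move=> r2 bT Dx; have [bx x0] := Dx; split; first exact: bop_ubdd.
have [M M0 xM] := ubdd_pos bx; have [C C0 TC] := bop_bound bT.
apply: ucvg0P => d d0; apply: contrapT => /ultra_notin Ud.
have L2 f : LP r f -> LP 2 f by move=> Lf; apply: (Lp_exp_le _ (ltW r2) Lf).
pose A := r * 2 `^ r; have A0 : 0 < A by rewrite mulr_gt0 ?powR_gt0.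
(* The cost in [Nm r] of one more term: at most 1 for the cross term and [A * M^r] for the term
   itself. *)
pose B := 1 + A * M `^ r; have B0 : 0 < B by rewrite ltr_wpDr // mulr_ge0 ?powR_ge0 // ltW.
(* Terms are added one by one. The sign of the new term makes the L^2 pairing of the images
   nonnegative, so their squared 2-norms at least add up; its index is taken where the claim fails
   and the cross term is small. *)
have step N : exists2 u, LP r u & Nm r u <= B * N%:R /\ d ^+ 2 * N%:R <= Nm 2 (T u).
  elim: N => [|N [u Lu [uB uT]]].
    exists (fun=> 0); first exact: Lp_cst.
    by rewrite !mulr0 -lpn_pow // lpn0 // powR0 ?gt_eqF // Nm_ge0.
  have /ucvg0_near/(_ (divr_gt0 ltr01 A0)) hc := cross_term_null Dx Lu.
  have [n] := unear_ex2 (Uu := Uu) Ud hc.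
  move=> /= /negP; rewrite -ltNge => dn cn.
  have Lx := bx.1 n; have LTx := bop_LP bT Lx; have LTu := bop_LP bT Lu.
  pose e : R := if 0 <= pairing (T u) (T (x n)) then 1 else - 1.
  have e1 : `|e| = 1 by rewrite /e; case: ifP; rewrite ?normrN normr1.
  have ee : e * e = 1 by rewrite /e; case: ifP; rewrite ?mulrNN mulr1.
  have ep : 0 <= e * pairing (T u) (T (x n)).
    rewrite /e; case: ifPn; first by rewrite mul1r.
    by rewrite -ltNge mulN1r oppr_ge0 => /ltW.
  have Lex := LpZ e Lx.
  exists (fadd u (fscale e (x n))); first exact: LpD.
  split.
    apply: (le_trans (Nm_cross Lu Lex)); rewrite -/A.
    have -> : (fun t => `|u t| `^ (r - 1) * `|fscale e (x n) t|) =
              (fun t => `|u t| `^ (r - 1) * `|x n t|).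
      by apply/funext => t; rewrite /fscale normrM e1 mul1r.
    have h1 : A * itg (fun t => `|u t| `^ (r - 1) * `|x n t|) <= 1.
      rewrite -ler_pdivlMl // mulr1 -[A^-1]mul1r; apply: le_trans cn; exact: ler_norm.
    have h2 : A * Nm r (fscale e (x n)) <= A * M `^ r.
      rewrite ler_pM2l // -lpn_le ?(ltW M0) // lpnZ // e1 mul1r; exact: xM.
    by rewrite -natr1 mulrDr mulr1 {2}/B; lra.
  have Ly := bop_LP bT (LpD r0w Lu Lex).
  have rs2 := @conj_exp22 R.
  have Lw : LP r (fadd (T u) (fscale e (T (x n)))) by apply: LpD => //; exact: LpZ.
  (* [T] is additive only modulo null functions, so the image of the sum has to be replaced in both
     slots of the L^2 pairing. *)
  have null : nrm r (fsub (T (fadd u (fscale e (x n)))) (fadd (T u) (fscale e (T (x n))))) = 0.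
    apply: (null_eq_pairing rs) => // y Ly'.
    rewrite (bop_pairingD rs bT) // (bop_pairingZ rs bT) // (pairingDl rs) //; last exact: LpZ.
    by rewrite (pairingZl rs).
  have n2 : nrm 2 (fsub (T (fadd u (fscale e (x n)))) (fadd (T u) (fscale e (T (x n))))) = 0.
    apply/le_anti; rewrite lpn_ge0 andbT -null.
    by apply: lpn_exp_le => //; [exact: ltW|exact: LpB].
  rewrite -pairing_self (pairing_eq_null rs2 _ _ _ n2); [|exact: L2..].
  rewrite pairingC (pairing_eq_null rs2 _ _ _ n2); [|exact: L2..].
  have LTe := LpZ e LTx.
  rewrite (pairingDl rs2); [|exact: L2..].
  rewrite pairingC [X in _ + X]pairingC !(pairingDl rs2); try exact: L2.
  rewrite (pairingZl rs2); [|exact: L2..].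
  rewrite (pairingC (T u) (fscale _ _)) (pairingZl rs2); [|exact: L2..].
  rewrite (pairingZl rs2); [|exact: L2..].
  rewrite (pairingC (T (x n)) (fscale _ _)) (pairingZl rs2); [|exact: L2..].
  rewrite mulrA ee mul1r (pairingC (T (x n)) (T u)) !pairing_self.
  have h3 : d ^+ 2 <= Nm 2 (T (x n)).
    rewrite -(powR_mulrn 2) ?(ltW d0) // -(@lpn_pow _ 2) //.
    apply: ler_powR2r => //; first exact: ltW.
    rewrite ger0_norm ?itg_ge0 // in dn; apply: (le_trans (ltW dn)).
    by apply: itg_norm_le => //; [lra|exact: L2].
  by rewrite -natr1 mulrDr mulr1; lra.
have bound N : d ^+ 2 * N%:R <= C ^+ 2 * (B * N%:R) `^ (2 / r).
  have [u Lu [uB uT]] := step N; apply: (le_trans uT).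
  have LTu := bop_LP bT Lu.
  have h1 : nrm 2 (T u) <= C * (B * N%:R) `^ r^-1.
    apply: (le_trans (lpn_exp_le _ (ltW r2) LTu)) => //.
    apply: (le_trans (TC _ Lu)); rewrite ler_pM2l // lpnE.
    by rewrite ler_powR2r ?Nm_ge0 // invr_ge0 ltW.
  rewrite -(@lpn_pow _ 2) //; apply: (le_trans (ler_powR2r _ (lpn_ge0 _ _) h1)) => //.
  rewrite powRM ?(ltW C0) ?powR_ge0 // -powRrM (powR_mulrn 2) ?(ltW C0) //.
  by rewrite [r^-1 * 2]mulrC.
(* Here [r > 2] enters: [N <= D N^(2/r)] fails as soon as [N^th > D]. *)
pose th := 1 - 2 / r; have th0 : 0 < th by rewrite subr_gt0 ltr_pdivrMr // mul1r.
pose D := C ^+ 2 * B `^ (2 / r) / d ^+ 2.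
have D0 : 0 <= D.
  apply: divr_ge0; [|exact: sqr_ge0].
  by apply: mulr_ge0; [exact: sqr_ge0|exact: powR_ge0].
pose N := (Num.truncn (D `^ th^-1)).+1.
have hN : D `^ th^-1 < N%:R by exact: truncnS_gt.
have N0 : 0 < N%:R :> R by rewrite ltr0Sn.
have : D < N%:R `^ th.
  rewrite -{1}(@powR_invK _ th D) //; apply: gt0_ltr_powR => //; rewrite nnegrE ?powR_ge0 //.
apply/negP; rewrite -leNgt /D ler_pdivlMr ?exprn_gt0 // mulrC.
have := bound N; rewrite powRM ?(ltW B0) ?(ltW N0) // mulrA.
have NE : (N%:R : R) = N%:R `^ th * N%:R `^ (2 / r).
  have N1 : (N%:R : R) != 0 by rewrite gt_eqF.
  by rewrite -powRD ?N1 ?implybT // /th subrK powRr1.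
by rewrite {1}NE mulrA ler_pM2r // powR_gt0.
Qed.

End concentration.

(** * Selective ultrafilters *)

(** A diagonal intersection: each element meets the requirements imposed by all earlier elements.
    The shift by one leaves [A 0] as the requirement when nothing precedes. *)
Definition adapted (A : nat -> set nat) (D : set nat) : Prop :=
  forall n, D n -> A 0%N n /\ forall m, D m -> (m < n)%N -> A m.+1 n.

Section selection.
Local Open Scope nat_scope.

Lemma finite_nat_bound (S : set nat) : finite_set S -> exists N, forall n, S n -> n < N.
Proof.
move=> /finite_seqP[s ->]; exists (\max_(i <- s) i).+1 => n /= ns.
by rewrite ltnS; exact: leq_bigmax_seq.
Qed.

(** The first clause of selectivity yields a set almost contained in every requirement; the second
    thins it to one point in each of a sequence of intervals that outgrow the thresholds. The
    ultrafilter also decides the parity of the interval, so two selected points are separated by a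
    full interval. *)
Lemma selective_adapted (U : set_system nat) (A : nat -> set nat) :
  ultrafilter_nat U -> selective U -> (forall m, U (A m)) ->
  exists2 D, U D & adapted A D.
Proof.
move=> Uu [Usel1 Usel2] UA.
pose A' k := [set n | forall i, i <= k -> A i n].
have UA' k : U (A' k).
  have := @near_seq U Uu _ (iota 0 k.+1) A (fun i _ => UA i).
  by apply: filterS => n h i ik; apply: h; rewrite mem_iota.
have [B [UB Bfin]] := Usel1 A' UA'.
have Hf k : exists N, forall n, B n -> N <= n -> A' k n.
  have [N HN] := finite_nat_bound (Bfin k); exists N => n Bn Nn.
  by apply: contrapT => nA; have := HN n (conj Bn nA); rewrite ltnNge Nn.
have [f Hf'] := choice Hf.
pose F k := maxn (f k.+1) k.+1.
have HF k n : B n -> F k <= n -> A' k.+1 n.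
  by move=> Bn; rewrite geq_max => /andP[fn _]; exact: Hf'.
(* Beyond [e (i+1) = F (e i)] the points of [B] satisfy every requirement with index up to
   [e i + 1]. *)
pose e := fix e i := if i is i'.+1 then F (e i') else 0.
have elt i : e i < e i.+1 by rewrite /= leq_maxr.
have emono i j : i <= j -> e i <= e j.
  by move=> /subnK <-; elim: (j - i) => // k; move/leq_trans; apply; exact: ltnW (elt _).
have ege i : i <= e i by elim: i => // i IH; exact: leq_ltn_trans IH (elt i).
pose I k := [set n | e k <= n < e k.+1].
have Iidx n : exists k, I k n.
  have [k kn kmin] : exists2 k, n < e k.+1 & forall j, n < e j.+1 -> k <= j.
    have ex : exists k, n < e k.+1 by exists n; exact: ege.
    by exists (ex_minn ex); case: ex_minnP.
  exists k; rewrite /I /= kn andbT; case: k kn kmin => // k kn kmin.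
  by rewrite leqNgt; apply/negP => /kmin; rewrite ltnn.
have Iuniq k l n : I k n -> I l n -> k = l.
  move=> /= /andP[k1 k2] /andP[l1 l2]; apply/eqP; rewrite eqn_leq.
  apply/andP; split; rewrite leqNgt; apply/negP => h; have := emono _ _ h.
    by rewrite leqNgt (leq_ltn_trans k1 l2).
  by rewrite leqNgt (leq_ltn_trans l1 k2).
have [|||| C [UC HC]] := Usel2 I.
- by move=> k; apply: (@sub_finite_set _ _ `I_(e k.+1)) => // n /andP[].
- by move=> k; exists (e k); rewrite /I /= leqnn elt.
- move=> k l kl; apply/seteqP; split=> // n [h1 h2]; exact: kl (Iuniq _ _ _ h1 h2).
- by apply/seteqP; split=> // n _; have [k Ik] := Iidx n; exists k.
have [par Upar] : exists b : bool, U [set n | forall k, I k n -> odd k = b].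
  case: (Uu) => _ [_ [US [_ UCo]]].
  have [UE|UE] := UCo [set n | forall k, I k n -> odd k]; first by exists true.
  exists false; apply: US UE _ => n /= h k Ik; apply/negbTE/negP => ok.
  by apply: h => l Il; rewrite (Iuniq _ _ _ Il Ik).
exists (B `&` C `&` [set n | forall k, I k n -> odd k = par] `&` A 0%N).
  by apply: filterI => //; apply: filterI => //; apply: filterI.
move=> n [[[Bn Cn] Pn] An]; split=> // m [[[Bm Cm] Pm] _] mn.
have [i Im] := Iidx m; have [j In] := Iidx n.
have /andP[m1 m2] := Im; have /andP[n1 n2] := In.
have ij : i != j.
  apply/eqP => eij; rewrite eij in Im; have [l Hl] := HC j.
  have : [set l] m by rewrite -Hl.
  have : [set l] n by rewrite -Hl.
  by move=> /= nl ml; rewrite nl ml ltnn in mn.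
have i2j : i.+2 <= j.
  have lij : i < j.
    rewrite ltn_neqAle ij /= leqNgt; apply/negP => /emono h.
    by have := leq_ltn_trans m1 (leq_trans mn (leq_trans (ltnW n2) h)); rewrite ltnn.
  rewrite ltn_neqAle lij andbT; apply/eqP => h.
  by have := Pn j In; rewrite -(Pm i Im) -h /=; case: (odd i).
(* The point [m] of interval [i] lies below [e (i+1)], and [n] is not below [e (i+2)], the threshold
   attached to [e (i+1)]. *)
have : A' (e i.+1).+1 n by apply: HF => //; apply: leq_trans n1; exact: (emono i.+2).
by apply; rewrite ltnS ltnW.
Qed.

Variable D : set nat.

(* One plus the largest element of [D] below [n], or [0]. *)
Fixpoint prv (n : nat) : nat :=
  if n is m.+1 then (if `[< D m >] then n else prv m) else 0.

Lemma prv_le n : prv n <= n.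
Proof. by elim: n => //= n IH; case: asboolP => // _; exact: leqW. Qed.

Lemma prv_in n : D n -> prv n.+1 = n.+1.
Proof. by move=> Dn /=; case: asboolP. Qed.

Lemma prv_out n : ~ D n -> prv n.+1 = prv n.
Proof. by move=> Dn /=; case: asboolP. Qed.

Lemma prv_gap n i : D i -> i < n -> i < prv n.
Proof.
move=> Di; elim: n => // n IH; rewrite ltnS leq_eqVlt => /predU1P[<-|/IH h].
  by rewrite prv_in.
by rewrite /=; case: asboolP => // _; rewrite ltnS (leq_trans (ltnW h)) // prv_le.
Qed.

Lemma prv_spec n : prv n = 0 \/ exists m, [/\ D m, m < n & prv n = m.+1].
Proof.
elim: n => [|n IH]; first by left.
have [Dn|nD] := pselect (D n); first by right; exists n; rewrite prv_in.
rewrite prv_out //; case: IH => [|[m [Dm mn e]]]; first by left.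
by right; exists m; split=> //; exact: leqW.
Qed.

Lemma adapted_prv A n : adapted A D -> D n -> A (prv n) n.
Proof.
move=> /(_ n) h /h[h0 hm]; have [->//|[m [Dm mn ->]]] := prv_spec n.
exact: hm.
Qed.

End selection.

Section prv_sums.
Context {R : realType}.
Variable D : set nat.

Lemma half_exp_le (m n : nat) : (m <= n)%N -> 2^-1 ^+ n <= 2^-1 ^+ m :> R.
Proof. by move=> mn; apply: ler_wiXn2l => //; lra. Qed.

Lemma half_expS (n : nat) : 2^-1 ^+ n = 2 * 2^-1 ^+ n.+1 :> R.
Proof. by rewrite exprS mulrA mulfV ?mul1r. Qed.

(** Telescoping: at an element [i] of [D], [prv D] jumps from [prv D i <= i] to [i + 1], so twice
    [2^-prv] drops by at least [2^-(prv D i)]; elsewhere it does not change. *)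
Lemma prv_sum (v : nat -> R) (n N : nat) : (n <= N)%N ->
  (forall i, (n <= i < N)%N -> ~ D i -> v i <= 0) ->
  (forall i, (n <= i < N)%N -> D i -> v i <= 2^-1 ^+ prv D i) ->
  \sum_(n <= i < N) v i <= 2 * 2^-1 ^+ prv D n - 2 * 2^-1 ^+ prv D N.
Proof.
move=> nN v0 vD; elim: N nN v0 vD => [|N IH].
  by rewrite leqn0 => /eqP -> _ _; rewrite big_geq // subrr.
rewrite leq_eqVlt => /predU1P[-> _ _|]; first by rewrite big_geq // subrr.
rewrite ltnS => nN v0 vD; rewrite big_nat_recr //=.
have lift i : (n <= i < N)%N -> (n <= i < N.+1)%N by move=> /andP[-> /ltnW].
have {}IH := IH nN (fun i h => v0 i (lift i h)) (fun i h => vD i (lift i h)).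
have NN : (n <= N < N.+1)%N by rewrite nN leqnn.
case: asboolP => [DN|nD]; last by have := v0 N NN nD; lra.
have := vD N NN DN; have := half_exp_le (prv_le D N); rewrite (half_expS N); lra.
Qed.

End prv_sums.

(** * Upper estimates *)

(** The requirements [A] are recorded rather than one good set: those of several sequences can then
    be intersected before a single adapted set is selected. *)
Definition upper {R : realType} (U : set_system nat) (r s : R) (x : useq R) : Prop :=
  exists2 A : nat -> set nat, (forall m, U (A m)) & forall D, adapted A D ->
    exists2 K : R, 0 <= K & forall (c : nat -> R) (N : nat), (forall i, ~ D i -> c i = 0) ->
      \sum_(i < N) `|c i| `^ s <= 1 -> nrm r (lincomb c x N) <= K.

(* [|| a + c x_n ||^r] is controlled by [(1 + C |c|^s) || a ||^r + C |c|^s], up to a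
   term vanishing along [U]; iterating this yields an upper s-estimate. *)
Definition increment {R : realType} (U : set_system nat) (r s : R) (x : useq R) : Prop :=
  exists2 C : R, 0 <= C & forall a, LP r a -> forall e : R, 0 < e ->
    \forall n \near U, forall c : R, `|c| <= 1 ->
      Nm r (fadd a (fscale c (x n))) <= (1 + C * `|c| `^ s) * Nm r a + C * `|c| `^ s + e.

Section upper_estimates.
Context {R : realType}.
Implicit Types (c : R) (x : useq R).

(** A finite net of [-1, 1] of mesh [2^-i], so that at each stage only finitely many combinations of
    earlier terms have to be controlled. The mesh shrinks with the index to make the rounding errors
    summable. *)
Definition grid (i : nat) : seq R :=
  [seq k%:R / 2 ^+ i | k <- iota 0 (2 ^ i).+1] ++
  [seq - (k%:R / 2 ^+ i) | k <- iota 0 (2 ^ i).+1].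

(** Rounding is towards zero, which keeps the l^s sum of the coefficients below 1. *)
Definition round (i : nat) c : R := Num.sg c * ((Num.truncn (`|c| * 2 ^+ i))%:R / 2 ^+ i).

Lemma two_exp_gt0 i : 0 < 2 ^+ i :> R. Proof. exact: exprn_gt0. Qed.

Lemma round_frac i (u : R) : 0 <= u ->
  (0 : R) <= (Num.truncn (u * 2 ^+ i))%:R / 2 ^+ i <= u /\
  u - (Num.truncn (u * 2 ^+ i))%:R / 2 ^+ i <= 2^-1 ^+ i :> R.
Proof.
move=> u0; have p0 := two_exp_gt0 i.
have v0 : 0 <= u * 2 ^+ i by rewrite mulr_ge0 // ltW.
have h1 : (Num.truncn (u * 2 ^+ i))%:R <= u * 2 ^+ i :> R by rewrite truncn_le.
have h2 : u * 2 ^+ i < (Num.truncn (u * 2 ^+ i)).+1%:R := truncnS_gt _.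
split; first by rewrite divr_ge0 ?ler0n ?(ltW p0) //= ler_pdivrMr.
rewrite -ltr_pdivlMr // -natr1 mulrDl mul1r in h2.
by rewrite exprVn lerBlDl ltW.
Qed.

Lemma round_le i c : `|round i c| <= `|c|.
Proof.
have [/andP[h1 h2] _] := round_frac i (normr_ge0 c).
rewrite /round normrM normr_sg (ger0_norm h1).
by case: eqP => _; rewrite ?mul0r ?mul1r.
Qed.

Lemma round_dist i c : `|c - round i c| <= 2^-1 ^+ i.
Proof.
have [/andP[h1 h2] h3] := round_frac i (normr_ge0 c).
have [->|c0] := eqVneq c 0; first by rewrite /round sgr0 mul0r subrr normr0 exprn_ge0.
rewrite /round {1}(numEsg c) -mulrBr normrM normr_sg c0 mul1r ger0_norm //.
by rewrite subr_ge0.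
Qed.

Lemma round0 i : round i 0 = 0. Proof. by rewrite /round sgr0 mul0r. Qed.

Lemma round_grid i c : `|c| <= 1 -> round i c \in grid i.
Proof.
move=> c1; have p0 := two_exp_gt0 i.
set k := Num.truncn (`|c| * 2 ^+ i).
have kb : k \in iota 0 (2 ^ i).+1.
  rewrite mem_iota /= add0n ltnS -(ler_nat R).
  apply: le_trans (_ : `|c| * 2 ^+ i <= _); first by rewrite truncn_le mulr_ge0 // ltW.
  by rewrite natrX ler_piMl // ltW.
rewrite /round -/k /grid mem_cat; apply/orP.
case: (ltgtP c 0) => [c0|c0|->].
- by right; rewrite ltr0_sg // mulN1r; apply/mapP; exists k.
- by left; rewrite gtr0_sg // mul1r; apply/mapP; exists k.
- by left; apply/mapP; exists 0%N; rewrite ?mem_iota // sgr0 !mul0r.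
Qed.

Section increment_upper.
Variables (U : set_system nat).
Context {Uu : ultrafilter_nat U}.
Variables (r s : R).
Hypotheses (r1 : 1 < r) (s0 : 0 < s).

Let r0 : 0 < r. Proof. exact: lt_trans r1. Qed.
Let r0w : 0 <= r. Proof. exact: ltW. Qed.

Lemma lincomb_stop (c : nat -> R) x m n : (m <= n)%N ->
  (forall i, (m <= i < n)%N -> c i = 0) -> lincomb c x n = lincomb c x m.
Proof.
move=> mn; elim: n mn => [|n IH]; first by rewrite leqn0 => /eqP ->.
rewrite leq_eqVlt => /predU1P[->//|]; rewrite ltnS => mn H.
rewrite lincombS H ?mn ?leqnn // -IH //; last by move=> i /andP[h1 h2]; rewrite H // h1 ltnW.
by apply/funext => t; rewrite /fadd /fscale mul0r addr0.
Qed.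

Lemma increment_upper x : ubdd r x -> increment U r s x -> upper U r s x.
Proof.
move=> bx [C C0 HC]; have Lx := bx.1; have [M M0 xM] := ubdd_pos bx.
pose P e a n := forall c, `|c| <= 1 ->
   Nm r (fadd a (fscale c (x n))) <= (1 + C * `|c| `^ s) * Nm r a + C * `|c| `^ s + e.
pose A m := [set n | forall c : nat -> R, (forall i, (i < m)%N -> c i \in grid i) ->
   P (2^-1 ^+ m) (lincomb c x m) n].
(* Induction on the number of free coefficients; [a] carries the terms whose coefficients are
   already fixed. *)
have UA0 m a (e : R) : LP r a -> 0 < e -> U [set n | forall c : nat -> R,
    (forall i, (i < m)%N -> c i \in grid i) -> P e (fadd a (lincomb c x m)) n].
  elim: m a => [|m IH] a La e0.
    apply: filterS (HC a La e e0) => n h c _.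
    by rewrite lincomb0 (_ : fadd a _ = a) //; apply/funext => t; rewrite /fadd addr0.
  have h : U [set n | forall g, g \in grid m -> forall c : nat -> R,
      (forall i, (i < m)%N -> c i \in grid i) ->
      P e (fadd (fadd a (fscale g (x m))) (lincomb c x m)) n].
    apply: near_seq => g _; apply: IH => //; apply: LpD => //; exact: LpZ.
  apply: filterS h => n h c Hc.
  have := h (c m) (Hc m (leqnn _)) c (fun i im => Hc i (ltnW im)).
  rewrite (_ : fadd (fadd a _) _ = fadd a (lincomb c x m.+1)) //.
  by rewrite lincombS; apply/funext => t; rewrite /fadd -addrA [_ + lincomb _ _ _ _]addrC.
have UA m : U (A m).
  have := UA0 m (fun=> 0) (2^-1 ^+ m) (Lp_cst r 0).
  rewrite exprn_gt0 ?invr_gt0 // => /(_ isT); apply: filterS => n h c Hc.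
  have := h c Hc; rewrite (_ : fadd _ _ = lincomb c x m) //.
  by apply/funext => t; rewrite /fadd add0r.
exists A => // D aD.
(* The factors [1 + C |c_i|^s] multiply to at most [exp C]; the additive terms sum to at most [C],
   and the errors [2^-(prv D i)] to at most 2. *)
pose B := (expR C * (C + 2)) `^ r^-1; have B0 : 0 <= B by exact: powR_ge0.
exists (B + 2 * M) => [|c N cD cs]; first by rewrite addr_ge0 // mulr_ge0 // ltW.
pose c' i := round i (c i).
have c'D i : ~ D i -> c' i = 0 by move=> nD; rewrite /c' cD // round0.
have c1 i : (i < N)%N -> `|c i| <= 1.
  move=> iN; have : `|c i| `^ s <= 1.
    apply: le_trans cs; rewrite (bigD1 (Ordinal iN)) //= lerDl.
    by apply: sumr_ge0 => j _; exact: powR_ge0.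
  move=> h; rewrite leNgt; apply/negP => h2.
  have : 1 `^ s < `|c i| `^ s by apply: gt0_ltr_powR => //; rewrite nnegrE.
  by rewrite powR1 ltNge h.
pose sg n := \sum_(i < n) `|c' i| `^ s.
have sg0 n : 0 <= sg n by apply: sumr_ge0 => i _; exact: powR_ge0.
have claim n : (n <= N)%N ->
    Nm r (lincomb c' x n) <= expR (C * sg n) * (C * sg n + (2 - 2 * 2^-1 ^+ prv D n)).
  elim: n => [_|n IH nN].
    rewrite lincomb0 -lpn_pow // lpn0 // powR0 ?gt_eqF // /sg big_ord0 mulr0 expR0.
    by rewrite expr0; lra.
  have {}IH := IH (ltnW nN).
  have sgS : sg n.+1 = sg n + `|c' n| `^ s by rewrite /sg big_ord_recr.
  have [Dn|nD] := pselect (D n); last first.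
    rewrite sgS c'D // normr0 powR0 ?gt_eqF // addr0 prv_out // lincombS c'D //.
    rewrite (_ : fadd _ _ = lincomb c' x n) //.
    by apply/funext => t; rewrite /fadd /fscale mul0r addr0.
  rewrite prv_in // lincombS.
  (* The coefficients vanish between [prv D n] and [n], so the requirement [A (prv D n)] covers this
     combination. *)
  have stop : lincomb c' x n = lincomb c' x (prv D n).
    apply: lincomb_stop; first exact: prv_le.
    move=> i /andP[pi in_]; apply: c'D => Di.
    by have := prv_gap Di in_; rewrite ltnNge pi.
  have := adapted_prv aD Dn; rewrite /A /= => /(_ c').
  rewrite -stop => h; have {h} := h _ (c' n).
  set t := `|c' n| `^ s; have t0 : 0 <= t by exact: powR_ge0.
  set Q := Nm r (lincomb c' x n) in IH *.
  set Q' := Nm r _; move=> h.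
  have {}h : Q' <= (1 + C * t) * Q + C * t + 2^-1 ^+ prv D n.
    apply: h; last by rewrite (le_trans (round_le _ _)) // c1.
    move=> i ip; apply: round_grid; apply: c1.
    by apply: leq_trans nN; apply: ltnW; exact: leq_trans ip (prv_le D n).
  have Q0 : 0 <= Q := Nm_ge0 _ _.
  have e1 : 1 + C * t <= expR (C * t) by exact: expR_ge1Dx.
  have e2 : 1 <= expR (C * sg n.+1) by rewrite -expR0 ler_expR mulr_ge0.
  apply: (le_trans h); rewrite sgS -/t in e2 *.
  have h1 : (1 + C * t) * Q <=
      expR (C * (sg n + t)) * (C * sg n + (2 - 2 * 2^-1 ^+ prv D n)).
    rewrite [C * (sg n + t)]mulrDr expRD [expR _ * expR _]mulrC -mulrA.
    by apply: ler_pM => //; rewrite addr_ge0 // mulr_ge0.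
  have e3 := @half_exp_le R _ _ (prv_le D n); rewrite (@half_expS R n) in e3.
  have h2 : C * t + 2^-1 ^+ prv D n <= expR (C * (sg n + t)) * (C * t + 2^-1 ^+ prv D n).
    by rewrite ler_peMl // addr_ge0 ?mulr_ge0 // exprn_ge0.
  rewrite -addrA; apply: (le_trans (lerD h1 h2)); rewrite -mulrDr.
  by rewrite ler_pM2l ?expR_gt0 //; rewrite mulrDr; lra.
have sgN : sg N <= 1.
  apply: le_trans cs; apply: ler_sum => i _; apply: ler_powR2r => //; first exact: ltW.
  exact: round_le.
have b1 : nrm r (lincomb c' x N) <= B.
  rewrite lpnE ler_powR2r ?Nm_ge0 ?invr_ge0 //.
  apply: (le_trans (claim N (leqnn _))).
  have Csg : C * sg N <= C by rewrite ler_piMr.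
  have p0 : 0 <= 2^-1 ^+ prv D N :> R by rewrite exprn_ge0 // invr_ge0.
  have p1 : 2^-1 ^+ prv D N <= 1 :> R by rewrite -(expr0 2^-1) half_exp_le.
  have Csg0 : 0 <= C * sg N by rewrite mulr_ge0.
  by apply: ler_pM; [exact: expR_ge0|lra|rewrite ler_expR|lra].
have b2 : nrm r (lincomb (fun i => c i - c' i) x N) <= 2 * M.
  apply: (le_trans (lpn_lincomb _ _ r1 Lx)).
  apply: (@le_trans _ _ (\sum_(i < N) (2^-1 ^+ i * M))).
    apply: ler_sum => i _; apply: ler_pM; rewrite ?lpn_ge0 //; exact: round_dist.
  rewrite -mulr_suml ler_pM2r //.
  have : \sum_(i < N) 2^-1 ^+ i <= 2 - 2 * 2^-1 ^+ N :> R.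
    elim: (N) => [|n IH]; first by rewrite big_ord0 expr0; lra.
    by rewrite big_ord_recr /=; have := @half_expS R n; lra.
  have : 0 <= 2^-1 ^+ N :> R by rewrite exprn_ge0 // invr_ge0.
  lra.
rewrite (_ : lincomb c x N = fadd (lincomb c' x N) (lincomb (fun i => c i - c' i) x N)).
  apply: (le_trans (lpn_triangle r1 _ _)); [exact: Lp_lincomb|exact: Lp_lincomb|].
  exact: lerD.
apply/funext => t; rewrite /fadd /lincomb -big_split /=; apply: eq_bigr => i _; ring.
Qed.

End increment_upper.

(** * Upper estimates of weakly null and of concentrating sequences *)

Section estimates.
Variables (U : set_system nat).
Context {Uu : ultrafilter_nat U}.
Variables (r s : R).
Hypothesis rs : conj_exp r s.

Let r1 : 1 < r. Proof. by case: rs. Qed.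
Let r0 : 0 < r. Proof. exact: lt_trans r1. Qed.
Let r0w : 0 <= r. Proof. exact: ltW. Qed.
Let sr := conj_expC rs.

(** The linear term of [normr_powR_expand] integrates to a pairing of [x n] with the fixed function
    [dmap r a], which vanishes along [U]. *)
Lemma upper_wnull x : wnull U r s x -> upper U r (Num.min r 2) x.
Proof.
move=> [bx wx]; apply: increment_upper => //; first by rewrite lt_min r0 /=.
have [M M0 xM] := ubdd_pos bx; have Lx := bx.1.
have [C C0 HC] := normr_powR_expand r1.
have M1 : 0 <= 1 + M `^ r by rewrite addr_ge0 // powR_ge0.
exists (C * (1 + M `^ r)) => [|a La e e0]; first by rewrite mulr_ge0.
have Ld := Lp_dmap rs La.
have er : 0 < e / r by rewrite divr_gt0.
apply: filterS (ucvg0_near (wx _ Ld) er) => n hn c c1.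
have /LpP[_ Lar] := La; have /LpP[_ Lxr] := Lx n.
have /LpP[_ Lsum] := LpD r0w La (LpZ c (Lx n)).
have Lp_ : L1 (fun t => dmap r (a t) * x n t) := L1_pair sr Ld (Lx n).
set w := `|c| `^ _; have w0 : 0 <= w by exact: powR_ge0.
have Lb := L1D (L1D Lar (L1Z r (L1Z c Lp_))) (L1Z (C * w) (L1D Lar Lxr)).
rewrite NmE; apply: (le_trans (itg_le Lsum Lb _)).
  by move=> t; exact: HC.
rewrite itgD; [|by apply: L1D => //; exact/L1Z/L1Z|exact/L1Z/L1D].
rewrite itgD //; last exact/L1Z/L1Z.
rewrite itgZ; last exact: L1Z.
rewrite itgZ // itgZ; last exact: L1D.
rewrite itgD // -!NmE -pairingE pairingC.
set Na := Nm r a; have Na0 : 0 <= Na := Nm_ge0 _ _.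
have Nx : Nm r (x n) <= M `^ r by rewrite -lpn_le // ltW.
have h1 : r * (c * pairing (x n) (fun t => dmap r (a t))) <= e.
  have -> : e = r * (e / r) by rewrite mulrC divfK // gt_eqF.
  rewrite ler_pM2l //; apply: (le_trans (ler_norm _)); rewrite normrM.
  by apply: le_trans hn; rewrite ler_piMl.
have Cw : 0 <= C * w by rewrite mulr_ge0.
have h2 : C * w * Nm r (x n) <= C * w * M `^ r by rewrite ler_wpM2l.
have h3 : 0 <= C * w * (M `^ r * Na) by rewrite mulr_ge0 // mulr_ge0 // powR_ge0.
by nra.
Qed.

(** For a concentrating sequence the whole cross term vanishes, so the exponent is the full [r],
    also above 2. *)
Lemma upper_Dz x : Dz U r x -> upper U r r x.
Proof.
move=> Dx; have bx := Dx.1; apply: increment_upper => //.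
have [M M0 xM] := ubdd_pos bx; have Lx := bx.1.
pose A := r * 2 `^ r; have A0 : 0 < A by rewrite mulr_gt0 ?powR_gt0.
have AM : 0 <= A * M `^ r by rewrite mulr_ge0 ?powR_ge0 // ltW.
exists (A * M `^ r) => // a La e e0.
have eA : 0 < e / A by rewrite divr_gt0.
apply: filterS (ucvg0_near (cross_term_null rs Dx La) eA) => n hn c c1.
apply: (le_trans (Nm_cross rs La (LpZ c (Lx n)))); rewrite -/A.
have -> : (fun t => `|a t| `^ (r - 1) * `|fscale c (x n) t|) =
          (fun t => `|c| * (`|a t| `^ (r - 1) * `|x n t|)).
  by apply/funext => t; rewrite /fscale normrM mulrCA.
have Lc : L1 (fun t => `|a t| `^ (r - 1) * `|x n t|).
  have := L1_norm (L1_pair sr (Lp_dmap rs La) (Lx n)).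
  by under eq_fun do rewrite normrM normr_dmap //.
rewrite itgZ //.
have h1 : A * (`|c| * itg (fun t => `|a t| `^ (r - 1) * `|x n t|)) <= e.
  have -> : e = A * (e / A) by rewrite mulrC divfK // gt_eqF.
  rewrite ler_pM2l //; apply: le_trans hn.
  by apply: (le_trans (ler_norm _)); rewrite normrM normr_id ler_piMl.
have h2 : Nm r (fscale c (x n)) <= `|c| `^ r * M `^ r.
  rewrite -powRM ?(ltW M0) // -lpn_le //; last by rewrite mulr_ge0 // ltW.
  by rewrite lpnZ // ler_wpM2l.
have h3 : A * Nm r (fscale c (x n)) <= A * (`|c| `^ r * M `^ r) by rewrite ler_pM2l.
have h4 : 0 <= A * M `^ r * `|c| `^ r * Nm r a by rewrite !mulr_ge0 ?powR_ge0 ?Nm_ge0.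
rewrite mulrDl mul1r; lra.
Qed.

Lemma upper_exp_le (r' : R) x : r <= 2 -> ubdd 2 x -> upper U 2 r' x -> upper U r r' x.
Proof.
move=> r2 bx [A UA HA]; exists A => // D /HA[K K0 HK]; exists K => // c N cD cs.
apply: le_trans (HK c N cD cs); apply: lpn_exp_le => //.
by apply: Lp_lincomb => //; exact: bx.1.
Qed.

End estimates.

End upper_estimates.

(** * Operators acting as rank one operators on the ultrapower *)

Section rank_one.
Context {R : realType} (U : set_system nat) {Uu : ultrafilter_nat U}.
Hypotheses (Unp : nonprincipal U) (Usel : selective U).
Variables (p q s s' : R).
Hypotheses (pq : conj_exp p q) (ss : conj_exp s s').
Implicit Types (c : nat -> R).

Let p1 : 1 < p. Proof. by case: pq. Qed.
Let p0 : 0 < p. Proof. exact: lt_trans p1. Qed.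
Let p0w : 0 <= p. Proof. exact: ltW. Qed.
Let q1 : 1 < q. Proof. by case: pq. Qed.
Let q0w : 0 <= q. Proof. by apply: ltW; exact: lt_trans q1. Qed.
Let s1 : 1 < s. Proof. by case: ss. Qed.
Let s0 : 0 < s. Proof. exact: lt_trans s1. Qed.
Let qp := conj_expC pq.

Lemma upper_homogeneous (r t : R) (x : useq R) (D : set nat) (K : R) : 1 < r -> 0 < t ->
  (forall i, LP r (x i)) -> 0 <= K ->
  (forall c N, (forall i, ~ D i -> c i = 0) ->
     \sum_(i < N) `|c i| `^ t <= 1 -> nrm r (lincomb c x N) <= K) ->
  forall c N, (forall i, ~ D i -> c i = 0) ->
    nrm r (lincomb c x N) <= K * (\sum_(i < N) `|c i| `^ t) `^ t^-1.
Proof.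
move=> r1 t0 Lx K0 H c N cD; have r0 : 0 < r by exact: lt_trans r1.
set S := \sum_(i < N) _.
have S0 : 0 <= S by apply: sumr_ge0 => i _; exact: powR_ge0.
have [Sz|Sn] := eqVneq S 0.
  rewrite (@lincomb_stop _ c x 0 N) //.
    by rewrite lincomb0 lpn0 // mulr_ge0 // powR_ge0.
  move=> i /andP[_ iN]; apply/eqP; rewrite -normr_eq0.
  have /eqP : `|c i| `^ t = 0.
    apply/le_anti; rewrite powR_ge0 andbT -Sz /S (bigD1 (Ordinal iN)) //= lerDl.
    by apply: sumr_ge0 => j _; exact: powR_ge0.
  by rewrite powR_eq0 => /andP[].
have Sp : 0 < S by rewrite lt_neqAle eq_sym Sn.
pose l := S `^ t^-1; have l0 : 0 < l by rewrite powR_gt0.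
have := H (fun i => l^-1 * c i) N; rewrite (_ : lincomb _ _ _ = fscale l^-1 (lincomb c x N)).
  rewrite lpnZ //; last by apply: Lp_lincomb => //; exact: ltW.
  rewrite gtr0_norm ?invr_gt0 // ler_pdivrMl // -/l mulrC [K * l]mulrC; apply.
    by move=> i /cD ->; rewrite mulr0.
  rewrite (eq_bigr (fun i : 'I_N => S^-1 * `|c i| `^ t)).
    by rewrite -mulr_sumr mulVf.
  move=> i _; rewrite normrM powRM // gtr0_norm ?invr_gt0 //.
  by rewrite powR_inv ?(ltW l0) // powRN powR_invK.
apply/funext => u; rewrite /fscale /lincomb mulr_sumr.
by apply: eq_bigr => i _; rewrite mulrA.
Qed.

Variables (g psi : useq R) (hs : nat -> useq R) (k : nat).
Hypotheses (bg : ubdd p g) (ug : upper U p s g).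
Hypotheses (wpsi : wnull U q p psi) (upsi : upper U q s' psi).
Hypothesis whs : forall j, (j < k)%N -> wnull U p q (hs j).

Section block.
Variables (D : set nat) (K K' : R).
Hypotheses (K0 : 0 <= K) (K'0 : 0 <= K').
Hypothesis HK : forall c N, (forall i, ~ D i -> c i = 0) ->
  \sum_(i < N) `|c i| `^ s <= 1 -> nrm p (lincomb c g N) <= K.
Hypothesis HK' : forall c N, (forall i, ~ D i -> c i = 0) ->
  \sum_(i < N) `|c i| `^ s' <= 1 -> nrm q (lincomb c psi N) <= K'.

Let Lg := bg.1.
Let Lpsi : forall n, LP q (psi n). Proof. by case: wpsi => -[]. Qed.

Definition coef (x : R -> R) (i : nat) : R := if `[< D i >] then pairing x (psi i) else 0.

Definition partial_op (x : R -> R) (N : nat) : R -> R := lincomb (coef x) g N.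

Lemma coef_out x i : ~ D i -> coef x i = 0.
Proof. by rewrite /coef; case: asboolP. Qed.

Lemma coefD x y i : LP p x -> LP p y -> coef (fadd x y) i = coef x i + coef y i.
Proof.
move=> Lx Ly; rewrite /coef; case: asboolP => _; last by rewrite addr0.
by rewrite (pairingDl pq).
Qed.

Lemma coefZ a x i : LP p x -> coef (fscale a x) i = a * coef x i.
Proof.
move=> Lx; rewrite /coef; case: asboolP => _; last by rewrite mulr0.
by rewrite (pairingZl pq).
Qed.

Lemma partial_op_LP x N : LP p (partial_op x N).
Proof. exact: Lp_lincomb. Qed.

(** The upper estimate of [g] reduces the claim to the l^s norm of the coefficients. That norm is
    found by pairing [x] with the combination of the [psi i] whose coefficients are the images under
    [dmap s] of those of [x]; the upper s'-estimate bounds its q-norm. *)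
Lemma partial_op_le x N : LP p x -> nrm p (partial_op x N) <= K * (K' * nrm p x).
Proof.
move=> Lx; have cD := @coef_out x.
apply: (le_trans (upper_homogeneous p1 s0 Lg K0 HK N cD)).
rewrite ler_wpM2l //; set S := \sum_(i < N) _.
have S0 : 0 <= S by apply: sumr_ge0 => i _; exact: powR_ge0.
have [->|Sn] := eqVneq S 0.
  by rewrite powR0 ?invr_eq0 ?gt_eqF // mulr_ge0 ?lpn_ge0.
have Sp : 0 < S by rewrite lt_neqAle eq_sym Sn.
pose d i := dmap s (coef x i).
have dD i : ~ D i -> d i = 0 by move=> nD; rewrite /d cD // dmap0.
have s'0 : 0 < s' by case: ss => _ h _; exact: lt_trans h.
have := upper_homogeneous q1 s'0 Lpsi K'0 HK' N dD.
rewrite (eq_bigr (fun i : 'I_N => `|coef x i| `^ s)) => [|i _]; last exact: dmap_conj.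
rewrite -/S => h.
have SE : S = pairing (lincomb d psi N) x.
  rewrite (pairing_lincomb _ _ qp) //; apply: eq_bigr => i _.
  rewrite -dmap_mul // /d pairingC /coef; case: asboolP => // _.
  by rewrite dmap0 !mul0r.
have e3 : S = S `^ s^-1 * S `^ s'^-1.
  by rewrite -powRD; [case: ss => _ _ ->; rewrite powRr1|rewrite Sn implybT].
have S'p : 0 < S `^ s'^-1 by rewrite powR_gt0.
rewrite -(ler_pM2r S'p) -e3 {1}SE (le_trans (ler_norm _)) //.
have Ll : LP q (lincomb d psi N) by exact: Lp_lincomb.
apply: (le_trans (pairing_le qp Ll Lx)); rewrite mulrAC ler_wpM2r ?lpn_ge0 //.
Qed.

(** [T x] is the weak limit along [U] of the bounded partial sums, so convergence of the series in
    norm does not have to be shown. *)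
Lemma block_op : exists2 T, bop p T &
  forall x y, LP p x -> LP q y -> pairing (partial_op x N) y @[N --> U] --> pairing (T x) y.
Proof.
have H (x : R -> R) : exists f : R -> R, LP p x -> LP p f /\
    forall y, LP q y -> pairing (partial_op x N) y @[N --> U] --> pairing f y.
  have [Lx|nLx] := pselect (LP p x); last by exists x.
  have bT : ubdd p (partial_op x).
    by split; [exact: partial_op_LP|exists (K * (K' * nrm p x)) => N; exact: partial_op_le].
  have [f Lf [_ wf]] := weak_limit (Uu := Uu) pq bT.
  exists f => _; split=> // y Ly; apply/subr_cvg0; apply: cvg_trans (wf y Ly).
  apply: near_eq_cvg; apply: nearW => N.
  by rewrite (pairingBl pq (partial_op_LP x N) Lf Ly).
have [T HT] := choice H.
have LT x : LP p x -> LP p (T x) by move=> /HT[].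
have cT x y : LP p x -> LP q y -> pairing (partial_op x N) y @[N --> U] --> pairing (T x) y.
  by move=> /HT[_ h] /h.
exists T => //; apply: (bop_intro pq) => //.
- move=> x x' y Lx Lx' Ly; apply: (ucvg_unique (cT _ _ (LpD p0w Lx Lx') Ly)).
  rewrite (_ : (fun N => _) = fun N => pairing (partial_op x N) y + pairing (partial_op x' N) y).
    by apply: cvgD; exact: cT.
  apply/funext => N; rewrite -(pairingDl pq) //; [|exact: partial_op_LP..].
  congr pairing; apply/funext => t; rewrite /fadd /partial_op /lincomb -big_split /=.
  by apply: eq_bigr => i _; rewrite coefD // mulrDl.
- move=> a x y Lx Ly; apply: (ucvg_unique (cT _ _ (LpZ a Lx) Ly)).
  rewrite (_ : (fun N => _) = fun N => a * pairing (partial_op x N) y).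
    by apply: cvgM; [exact: cvg_cst|exact: cT].
  apply/funext => N; rewrite -(pairingZl pq) //; [|exact: partial_op_LP..].
  congr pairing; apply/funext => t; rewrite /fscale /partial_op /lincomb mulr_sumr.
  by apply: eq_bigr => i _; rewrite coefZ // mulrA.
exists (K * K') => x Lx; apply: (lpn_dual_le pq) => [||y Ly]; first exact: LT.
  by rewrite !mulr_ge0 ?lpn_ge0.
apply: (ucvg_le (cT x y Lx Ly)); apply: nearW => N.
rewrite (le_trans (ler_norm _)) // (le_trans (pairing_le pq (partial_op_LP x N) Ly)) //.
by rewrite ler_wpM2r ?lpn_ge0 // -mulrA partial_op_le.
Qed.

(* Off the diagonal the coefficients are summably small. *)
Lemma block_op_diag T (h : R -> R) (n : nat) (G e : R) : bop p T ->
  (forall x y, LP p x -> LP q y -> pairing (partial_op x N) y @[N --> U] --> pairing (T x) y) ->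
  LP p h -> D n -> (forall i, nrm p (g i) <= G) ->
  (forall N, (n < N)%N -> \sum_(0 <= i < n) `|coef h i| + \sum_(n.+1 <= i < N) `|coef h i| <= e) ->
  nrm p (fsub (T h) (fscale (pairing h (psi n)) (g n))) <= e * G.
Proof.
move=> bT cT Lh Dn gG He.
have G0 : 0 <= G by apply: le_trans (gG 0%N); exact: lpn_ge0.
have e0 : 0 <= e.
  by apply: le_trans (He n.+1 (leqnn _)); rewrite addr_ge0 // sumr_ge0.
have LTh := bop_LP bT Lh; have Lgn := LpZ (pairing h (psi n)) (Lg n).
apply: (lpn_dual_le pq) => [||y Ly]; [exact: LpB|by rewrite mulr_ge0|].
have c1 : pairing (partial_op h N) y - pairing h (psi n) * pairing (g n) y @[N --> U] -->
    pairing (T h) y - pairing h (psi n) * pairing (g n) y.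
  by apply: cvgB; [exact: cT|exact: cvg_cst].
rewrite (pairingBl pq) // (pairingZl pq) //.
apply: (ucvg_le c1); apply: filterS (unear_ge Unp n.+1) => N nN.
rewrite (pairing_lincomb _ _ pq) // -(big_mkord xpredT (fun i => coef h i * pairing (g i) y)).
rewrite (@big_cat_nat _ _ _ n) ?(ltnW nN) //= (@big_ltn _ _ _ n) //.
have -> : coef h n = pairing h (psi n) by rewrite /coef; case: asboolP.
rewrite addrCA addrAC subrr add0r.
have tb a b : \sum_(a <= i < b) coef h i * pairing (g i) y <=
    (\sum_(a <= i < b) `|coef h i|) * (G * nrm q y).
  rewrite mulr_suml; apply: ler_sum => i _; rewrite (le_trans (ler_norm _)) // normrM.
  rewrite ler_wpM2l // (le_trans (pairing_le pq (Lg i) Ly)) //.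
  by rewrite ler_wpM2r ?lpn_ge0.
apply: (le_trans (lerD (tb _ _) (tb _ _))); rewrite -mulrDl -mulrA.
by rewrite ler_wpM2r ?mulr_ge0 ?lpn_ge0 //; exact: He.
Qed.

End block.

Lemma rank_one_op : exists2 T, bop p T & forall j, (j < k)%N ->
  unull U p (usub (fun n => T (hs j n)) (uscale (upair U (hs j) psi) g)).
Proof.
have [A1 UA1 HA1] := ug; have [A2 UA2 HA2] := upsi.
have bpsi := wpsi.1; have Lpsi := bpsi.1; have Lg := bg.1.
(* Smallness in both directions: the new [hs j n] against earlier [psi i], as [hs j] is weakly null,
   and earlier [hs j i] against the new [psi n], as [psi] is weakly null. The bound [4^-m] leaves
   room for a sum of [m] terms. *)
pose A3 m := [set n | forall j, j \in iota 0 k -> forall i, i \in iota 0 m ->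
  `|pairing (hs j n) (psi i)| <= 4^-1 ^+ m /\ `|pairing (hs j i) (psi n)| <= 4^-1 ^+ m].
have UA3 m : U (A3 m).
  apply: near_seq => j; rewrite mem_iota /= add0n => jk; apply: near_seq => i _.
  have e0 : 0 < 4^-1 ^+ m :> R by rewrite exprn_gt0 // invr_gt0.
  have [bh wh] := whs jk.
  have h1 := ucvg0_near (Uu := Uu) (wh _ (Lpsi i)) e0.
  have h2 := ucvg0_near (Uu := Uu) (wpsi.2 _ (bh.1 i)) e0.
  by apply: filterS2 h1 h2 => n h1 h2; split; rewrite // pairingC.
pose A m := A1 m `&` A2 m `&` A3 m.
have UA m : U (A m) by apply: filterI => //; exact: filterI.
have [D UD aD] := selective_adapted Uu Usel UA.
have a1 : adapted A1 D.
  by move=> n /aD[[[h _] _] H]; split=> // m Dm mn; have [[h' _] _] := H m Dm mn.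
have a2 : adapted A2 D.
  by move=> n /aD[[[_ h] _] H]; split=> // m Dm mn; have [[_ h'] _] := H m Dm mn.
have a3 : adapted A3 D.
  by move=> n /aD[[[_ _] h] H]; split=> // m Dm mn; have [_ h'] := H m Dm mn.
have [K K0 HK] := HA1 D a1; have [K' K'0 HK'] := HA2 D a2.
have [T bT cT] := block_op K0 K'0 HK HK'.
exists T => // j jk; have [bh wh] := whs jk.
have [G G0 gG] := ubdd_pos bg.
have bTh := bop_ubdd bT bh.
(* The first summand bounds the coefficients before [n], at most [m = prv D n] of them, by
   [m 4^-m <= 2^-m]; the second bounds those after [n] by [prv_sum]. As [D] is in [U] it is
   unbounded, so [prv D n] tends to infinity. *)
pose err n : R := 2^-1 ^+ prv D n + 2^-1 ^+ n.
have err0 : err n @[n --> U] --> 0.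
  apply: ucvg0P => e e0.
  have /cvgrPdist_le : (fun n => 2^-1 ^+ n : R) @ \oo --> 0.
    by apply: cvg_expr; rewrite ger0_norm; lra.
  move=> /(_ (e / 2)); rewrite divr_gt0 // => /(_ isT) [m _ Hm].
  have [d Dd dm] := unear_ex2 (Uu := Uu) UD (unear_ge Unp m).
  apply: filterS (unear_ge Unp d.+1) => n dn.
  have pd : (d < prv D n)%N by exact: prv_gap.
  have h1 := Hm (prv D n) (leq_trans dm (ltnW pd)).
  have h2 := Hm n (leq_trans dm (ltnW dn)).
  move: h1 h2; rewrite !sub0r !normrN /err => h1 h2.
  by rewrite (le_trans (ler_normD _ _)) // (splitr e) lerD.
have diag n : D n ->
    nrm p (fsub (T (hs j n)) (fscale (pairing (hs j n) (psi n)) (g n))) <= err n * G.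
  move=> Dn; apply: (block_op_diag bT cT (bh.1 n) Dn gG) => N nN.
  have jin : j \in iota 0 k by rewrite mem_iota.
  rewrite /err; apply: lerD.
    have := adapted_prv a3 Dn => /(_ j jin) h.
    set m := prv D n in h *; have mn : (m <= n)%N := prv_le D n.
    rewrite (@big_cat_nat _ _ _ m) //= [X in _ + X]big_nat_cond [X in _ + X]big1 ?addr0; last first.
      move=> i /andP[/andP[mi in_] _]; rewrite coef_out ?normr0 // => Di.
      by have := prv_gap Di in_; rewrite ltnNge -/m mi.
    apply: (@le_trans _ _ (\sum_(0 <= i < m) 4^-1 ^+ m)).
      apply: ler_sum_nat => i /andP[_ im]; rewrite /coef; case: asboolP => _; last first.
        by rewrite normr0 exprn_ge0 // invr_ge0.
      by apply: (h i _).1; rewrite mem_iota.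
    rewrite sumr_const_nat subn0 (_ : 4^-1 = 2^-1 * 2^-1 :> R); last by field.
    rewrite -[leLHS]mulr_natr exprMn -mulrA ler_piMr ?exprn_ge0 ?invr_ge0 //.
    rewrite exprVn ler_pdivrMl ?exprn_gt0 // mulr1 -natrX ler_nat.
    by rewrite ltnW // ltn_expl.
  have := @prv_sum R D (fun i => `|coef D (hs j n) i|) n.+1 N nN.
  rewrite prv_in // -half_expS => H; apply: (le_trans (H _ _)).
  - by move=> i _ nD; rewrite coef_out // normr0.
  - move=> i /andP[ni iN] Di; rewrite /coef; case: asboolP => // _.
    have := adapted_prv a3 Di => /(_ j jin n) h.
    apply: (@le_trans _ _ (4^-1 ^+ prv D i)).
      by apply: (h _).2; rewrite mem_iota /= add0n prv_gap.
    by apply: lerXn2r; rewrite ?nnegrE; lra.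
  - by rewrite gerBl mulr_ge0 // exprn_ge0 // invr_ge0.
set l := upair U (hs j) psi.
have cl : pairing (hs j n) (psi n) @[n --> U] --> l := upairP pq bh bpsi.
apply: (@ucvg0_le _ _ _ _ (fun n => err n * G + `|pairing (hs j n) (psi n) - l| * G)); last first.
  rewrite -(addr0 (0 : R)); apply: cvgD.
    by rewrite -(mul0r G); apply: cvgM => //; exact: cvg_cst.
  rewrite -(mul0r G); apply: cvgM; last exact: cvg_cst.
  rewrite -(normr0 R) -(subrr l); apply: cvg_norm.
  by apply: cvgB; [exact: cl|exact: cvg_cst].
apply: filterS UD => n Dn; rewrite ger0_norm ?lpn_ge0 //.
have Lgn := Lg n.
apply: (le_trans (lpn_triangle3 p1 (bTh.1 n) (LpZ (pairing (hs j n) (psi n)) Lgn) (LpZ l Lgn))).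
apply: lerD; first exact: diag.
rewrite (_ : fsub _ _ = fscale (pairing (hs j n) (psi n) - l) (g n)).
  by rewrite lpnZ // ler_wpM2l.
by apply/funext => t; rewrite /fsub /fscale mulrBl.
Qed.

End rank_one.

(** * Approximation on finite families *)

Section separation.
Context {R : realType} (V : Type).
Variables (W : set V) (add : V -> V -> V) (sc : R -> V -> V).
Hypotheses (WD : forall u v, W u -> W v -> W (add u v)) (WZ : forall a u, W u -> W (sc a u)).

Definition linear_on (f : V -> R) : Prop :=
  (forall u v, W u -> W v -> f (add u v) = f u + f v) /\
  (forall a u, W u -> f (sc a u) = a * f u).

Lemma separate (e : nat -> V -> R) (f : V -> R) (k : nat) :
  (forall j, (j < k)%N -> linear_on (e j)) -> linear_on f ->
  (exists u, [/\ W u, f u = 1 & forall j, (j < k)%N -> e j u = 0]) \/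
  (exists c : nat -> R, forall u, W u -> f u = \sum_(j < k) c j * e j u).
Proof.
elim: k f => [|k IH] f le lf.
  have [h|h] := pselect (forall u, W u -> f u = 0).
    by right; exists (fun=> 0) => u Wu; rewrite big_ord0 h.
  left; move/existsNP : h => [u /not_implyP[Wu /eqP fu]].
  exists (sc (f u)^-1 u); split=> //; first exact: WZ.
  by rewrite lf.2 // mulVf.
have le' j : (j < k)%N -> linear_on (e j) by move=> jk; apply: le; exact: ltnW.
have lk := le k (leqnn _).
case: (IH (e k) le' lk) => [[u0 [W0 eu0 u00]]|[d Hd]]; last first.
  case: (IH f le' lf) => [[u [Wu fu uj]]|[c Hc]].
    left; exists u; split=> // j; rewrite ltnS leq_eqVlt => /predU1P[->|]; last exact: uj.
    by rewrite Hd // big1 // => i _; rewrite uj // mulr0.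
  right; exists (fun j => if (j < k)%N then c j else 0) => u Wu.
  rewrite big_ord_recr /= ltnn mul0r addr0 Hc //; apply: eq_bigr => i _.
  by rewrite ltn_ord.
have lf' : linear_on (fun u => f u - f u0 * e k u).
  split=> [u v Wu Wv|a u Wu].
    rewrite lf.1 // lk.1 //; ring.
  rewrite lf.2 // lk.2 //; ring.
case: (IH _ le' lf') => [[u1 [W1 fu1 u1j]]|[c Hc]].
  left; exists (add u1 (sc (- e k u1) u0)); have Ws := WZ (- e k u1) W0; split.
  - exact: WD.
  - by rewrite lf.1 // lf.2 // -fu1; ring.
  - move=> j; rewrite ltnS leq_eqVlt => /predU1P[->|jk].
      by rewrite lk.1 // lk.2 // eu0; ring.
    by rewrite (le' _ jk).1 // (le' _ jk).2 // u1j // u00 // mulr0 addr0.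
right; exists (fun j => if (j < k)%N then c j else f u0) => u Wu.
rewrite big_ord_recr /= ltnn; apply/eqP; rewrite -subr_eq; apply/eqP.
by rewrite Hc //; apply: eq_bigr => i _; rewrite ltn_ord.
Qed.

End separation.

(** * The seminorm of the ultrapower, and approximation extended by one vector *)

Definition unm {R : realType} (U : set_system nat) (r : R) (x : useq R) : R :=
  lim (nrm r (x n) @[n --> U]).

Definition ulinop {R : realType} (U : set_system nat) (r : R) (A : useq R -> useq R) : Prop :=
  [/\ forall x, ubdd r x -> ubdd r (A x),
      forall x y, ubdd r x -> ubdd r y -> unull U r (usub x y) -> unull U r (usub (A x) (A y)),
      forall x y, ubdd r x -> ubdd r y ->
        unull U r (usub (A (uadd x y)) (uadd (A x) (A y))) &
      forall a x, ubdd r x -> unull U r (usub (A (uscale a x)) (uscale a (A x)))].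

Section seminorm.
Context {R : realType} (U : set_system nat) {Uu : ultrafilter_nat U}.
Variables (p q : R).
Hypothesis pq : conj_exp p q.
Implicit Types (x y z : useq R) (A : useq R -> useq R) (T : (R -> R) -> R -> R).

Let p1 : 1 < p. Proof. by case: pq. Qed.
Let p0 : 0 < p. Proof. exact: lt_trans p1. Qed.
Let p0w : 0 <= p. Proof. exact: ltW. Qed.

Lemma unmP x : ubdd p x -> nrm p (x n) @[n --> U] --> unm U p x.
Proof. by move=> bx; have [l _ h] := ubdd_nrm_cvg (Uu := Uu) bx; apply/cvg_ex; exists l. Qed.

Lemma unmE x l : nrm p (x n) @[n --> U] --> l -> unm U p x = l.
Proof. by move=> h; apply/cvg_lim. Qed.

Lemma unm_ge0 x : ubdd p x -> 0 <= unm U p x.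
Proof. by move=> /unmP h; apply: (ucvg_ge h); apply: nearW => n; exact: lpn_ge0. Qed.

Lemma unm_null x : ubdd p x -> unull U p x <-> unm U p x = 0.
Proof.
move=> bx; split=> [|h]; first exact: unmE.
by have := unmP bx; rewrite h.
Qed.

Lemma unmD x y : ubdd p x -> ubdd p y -> unm U p (uadd x y) <= unm U p x + unm U p y.
Proof.
move=> bx by_.
have h : nrm p (x n) + nrm p (y n) @[n --> U] --> unm U p x + unm U p y.
  by apply: cvgD; exact: unmP.
apply: (ler_cvg_to (unmP (ubddD pq bx by_)) h); apply: nearW => n.
exact: (lpn_triangle p1 (bx.1 n) (by_.1 n)).
Qed.

Lemma unmZ a x : ubdd p x -> unm U p (uscale a x) = `|a| * unm U p x.
Proof.
move=> bx; apply: unmE; under eq_fun do rewrite (lpnZ a p0 (bx.1 _)).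
by apply: cvgM; [exact: cvg_cst|exact: unmP].
Qed.

Lemma unmB x y : ubdd p x -> ubdd p y -> unm U p (usub x y) <= unm U p x + unm U p y.
Proof.
move=> bx by_; rewrite usubE (le_trans (unmD bx (ubddZ pq _ by_))) //.
by rewrite unmZ // normrN1 mul1r.
Qed.

Lemma unm_eq x y : ubdd p x -> ubdd p y -> unull U p (usub x y) -> unm U p x = unm U p y.
Proof.
move=> bx by_ h.
have key z w : ubdd p z -> ubdd p w -> unull U p (usub z w) -> unm U p z <= unm U p w.
  move=> bz bw zw; have bzw := ubddB pq bz bw.
  have -> : z = uadd w (usub z w).
    by apply/funext => n; apply/funext => t; rewrite /uadd /usub /fadd /fsub addrC subrK.
  by rewrite (le_trans (unmD bw bzw)) // (unm_null bzw).1 // addr0.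
apply/le_anti; rewrite !key //.
exact: unull_subC.
Qed.

Lemma usubxx x : usub x x = fun _ _ => 0.
Proof. by apply/funext => n; apply/funext => t; rewrite /usub /fsub subrr. Qed.

Lemma unull0 : unull U p (fun _ _ => 0).
Proof. by rewrite /unull (lpn0 p0); exact: cvg_cst. Qed.

Lemma unull_refl x : unull U p (usub x x).
Proof. by rewrite usubxx; exact: unull0. Qed.

Lemma ulinopB A B : ulinop U p A -> ulinop U p B -> ulinop U p (fun x => usub (A x) (B x)).
Proof.
move=> [Ab Aeq AD AZ] [Bb Beq BD BZ].
have swap x x' y y' : usub (usub x y) (usub x' y') = usub (usub x x') (usub y y').
  by apply/funext => n; apply/funext => t; rewrite /usub /fsub; ring.
have nB x y : ubdd p x -> ubdd p y -> unull U p x -> unull U p y -> unull U p (usub x y).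
  move=> bx by_ nx ny; rewrite usubE; apply: (unullD pq) => //; first exact: (ubddZ pq).
  exact: (unullZ pq).
split.
- by move=> x bx; apply: (ubddB pq); [exact: Ab|exact: Bb].
- move=> x y bx by_ xy; rewrite swap; apply: nB; [| |exact: Aeq|exact: Beq].
    by apply: (ubddB pq); exact: Ab.
  by apply: (ubddB pq); exact: Bb.
- move=> x y bx by_; have bxy := ubddD pq bx by_.
  have -> : usub (usub (A (uadd x y)) (B (uadd x y))) (uadd (usub (A x) (B x)) (usub (A y) (B y)))
    = usub (usub (A (uadd x y)) (uadd (A x) (A y))) (usub (B (uadd x y)) (uadd (B x) (B y))).
    by apply/funext => n; apply/funext => t; rewrite /usub /fsub /uadd /fadd; ring.
  apply: nB; [| |exact: AD|exact: BD].
    by apply: (ubddB pq); [exact: Ab|apply: (ubddD pq); exact: Ab].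
  by apply: (ubddB pq); [exact: Bb|apply: (ubddD pq); exact: Bb].
- move=> a x bx; have bax := ubddZ pq a bx.
  have -> : usub (usub (A (uscale a x)) (B (uscale a x))) (uscale a (usub (A x) (B x)))
    = usub (usub (A (uscale a x)) (uscale a (A x))) (usub (B (uscale a x)) (uscale a (B x))).
    by apply/funext => n; apply/funext => t; rewrite /usub /fsub /uscale /fscale; ring.
  apply: nB; [| |exact: AZ|exact: BZ].
    by apply: (ubddB pq); [exact: Ab|apply: (ubddZ pq); exact: Ab].
  by apply: (ubddB pq); [exact: Bb|apply: (ubddZ pq); exact: Bb].
Qed.

Lemma ulinop_ultraop T : bop p T -> ulinop U p (fun x n => T (x n)).
Proof.
move=> bT; have [C C0 TC] := bop_bound bT.
case: (bT) => LT Teq TD TZ _; split.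
- by move=> x; exact: bop_ubdd.
- move=> x y bx by_ xy; have bd := ubddB pq bx by_.
  apply: (@ucvg0_le _ _ _ _ (fun n => C * nrm p (usub x y n))); last first.
    by rewrite -(mulr0 C); apply: cvgM => //; exact: cvg_cst.
  apply: nearW => n; rewrite ger0_norm ?lpn_ge0 //.
  apply: le_trans (TC _ (bd.1 n)).
  have Lx := bx.1 n; have Ly := by_.1 n.
  have e1 : nrm p (fsub (fsub (T (x n)) (T (y n))) (T (fsub (x n) (y n)))) = 0.
    apply: (null_eq_pairing pq) => [||z Lz].
    - by apply: LpB => //; exact: LT.
    - by apply: LT; exact: LpB.
    rewrite (pairingBl pq) //; [|exact: LT..].
    have -> : x n = fadd (fsub (x n) (y n)) (y n) by apply/funext => t; rewrite /fadd /fsub subrK.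
    rewrite (bop_pairingD pq bT) //; last exact: LpB.
    rewrite addrK; congr (pairing (T _) z).
    by apply/funext => t; rewrite /fadd /fsub subrK.
  have h := lpn_le_sub p1 (LpB p0w (LT _ Lx) (LT _ Ly)) (LT _ (LpB p0w Lx Ly)).
  by rewrite e1 addr0 in h; exact: h.
- move=> x y bx by_; rewrite /unull.
  rewrite (_ : (fun n => _) = fun=> 0); first exact: cvg_cst.
  by apply/funext => n; exact: (TD _ _ (bx.1 n) (by_.1 n)).
- move=> a x bx; rewrite /unull.
  rewrite (_ : (fun n => _) = fun=> 0); first exact: cvg_cst.
  by apply/funext => n; exact: (TZ _ _ (bx.1 n)).
Qed.

Definition ulincomb (c : nat -> R) (xs : nat -> useq R) (k : nat) : useq R :=
  fun n => lincomb c (fun j => xs j n) k.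

Lemma ulincombS c xs k :
  ulincomb c xs k.+1 = uadd (ulincomb c xs k) (uscale (c k) (xs k)).
Proof. by apply/funext => n; rewrite /ulincomb lincombS. Qed.

Lemma ulincomb0 c xs : ulincomb c xs 0 = fun _ _ => 0.
Proof. by apply/funext => n; rewrite /ulincomb lincomb0. Qed.

Lemma ubdd0 : ubdd p (fun _ _ => 0). Proof. exact: ubdd_cst (Lp_cst _ _). Qed.

Lemma ubdd_ulincomb c xs k : (forall j, (j < k)%N -> ubdd p (xs j)) ->
  ubdd p (ulincomb c xs k).
Proof.
elim: k => [|k IH] bxs; first by rewrite ulincomb0; exact: ubdd0.
rewrite ulincombS; apply: (ubddD pq); first by apply: IH => j jk; apply: bxs; exact: ltnW.
by apply: (ubddZ pq); exact: bxs.
Qed.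

Lemma upair_ulincomb c xs k z : (forall j, (j < k)%N -> ubdd p (xs j)) -> ubdd q z ->
  upair U (ulincomb c xs k) z = \sum_(j < k) c j * upair U (xs j) z.
Proof.
move=> bxs bz; elim: k bxs => [|k IH] bxs.
  rewrite ulincomb0 big_ord0; apply: (upair_null pq) => //; [exact: ubdd0|exact: unull0].
have bxs' j : (j < k)%N -> ubdd p (xs j) by move=> jk; apply: bxs; exact: ltnW.
have bk := bxs k (leqnn _).
rewrite ulincombS (upairDl pq) //; [|exact: ubdd_ulincomb|exact: (ubddZ pq)].
by rewrite big_ord_recr /= IH // (upairZl pq).
Qed.

Lemma ulinop0 A : ulinop U p A -> unm U p (A (fun _ _ => 0)) = 0.
Proof.
move=> [Ab Aeq AD AZ]; have := AZ 0 _ ubdd0.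
have -> : uscale 0 (fun _ _ => 0) = (fun _ _ => 0) :> useq R.
  by apply/funext => n; apply/funext => t; rewrite /uscale /fscale mul0r.
move=> h; have b0 := Ab _ ubdd0; rewrite (unm_eq b0 _ h); last exact: (ubddZ pq).
by rewrite unmZ // normr0 mul0r.
Qed.

Lemma unm_ulincomb A c xs k : ulinop U p A -> (forall j, (j < k)%N -> ubdd p (xs j)) ->
  unm U p (A (ulincomb c xs k)) <= \sum_(j < k) `|c j| * unm U p (A (xs j)).
Proof.
move=> lA; have [Ab Aeq AD AZ] := lA; elim: k => [|k IH] bxs.
  by rewrite ulincomb0 ulinop0 // big_ord0.
have bxs' j : (j < k)%N -> ubdd p (xs j) by move=> jk; apply: bxs; exact: ltnW.
have bk := bxs k (leqnn _); have bl := ubdd_ulincomb c bxs'; have bz := ubddZ pq (c k) bk.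
rewrite ulincombS big_ord_recr /=.
rewrite (unm_eq (Ab _ (ubddD pq bl bz)) (ubddD pq (Ab _ bl) (Ab _ bz)) (AD _ _ bl bz)).
apply: (le_trans (unmD (Ab _ bl) (Ab _ bz))); apply: lerD; first exact: IH.
by rewrite (unm_eq (Ab _ bz) (ubddZ pq (c k) (Ab _ bk)) (AZ _ _ bk)) unmZ //; exact: Ab.
Qed.

Lemma bopD T1 T2 : bop p T1 -> bop p T2 -> bop p (fun f => fadd (T1 f) (T2 f)).
Proof.
move=> b1 b2; have [C1 C10 H1] := bop_bound b1; have [C2 C20 H2] := bop_bound b2.
have L1_ f : LP p f -> LP p (T1 f) := @bop_LP _ _ _ b1 f.
have L2_ f : LP p f -> LP p (T2 f) := @bop_LP _ _ _ b2 f.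
apply: (bop_intro pq).
- by move=> f Lf; apply: LpD => //; [exact: L1_|exact: L2_].
- move=> f g y Lf Lg Ly; have Lfg := LpD p0w Lf Lg.
  rewrite !(pairingDl pq) //; try (by [exact: L1_|exact: L2_]).
  by rewrite (bop_pairingD pq b1) // (bop_pairingD pq b2) // addrACA.
- move=> a f y Lf Ly; have Laf := LpZ a Lf.
  rewrite !(pairingDl pq) //; try (by [exact: L1_|exact: L2_]).
  by rewrite (bop_pairingZ pq b1) // (bop_pairingZ pq b2) // mulrDr.
- exists (C1 + C2) => f Lf; apply: (le_trans (lpn_triangle p1 (L1_ _ Lf) (L2_ _ Lf))).
  by rewrite mulrDl lerD ?H1 ?H2.
Qed.

Section approximation.
Variable S : useq R -> useq R.
Hypothesis lS : ulinop U p S.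

Definition defect T x : R := unm U p (usub (S x) (fun n => T (x n))).

(** Approximation in norm, hence density for the strong operator topology; [closure_good] passes to
    the weak one. *)
Definition good (xs : nat -> useq R) (k : nat) : Prop := forall d : R, 0 < d ->
  exists2 T, bop p T & forall j, (j < k)%N -> defect T (xs j) <= d.

Lemma good_span xs k x c : good xs k -> (forall j, (j < k)%N -> ubdd p (xs j)) -> ubdd p x ->
  unull U p (usub x (ulincomb c xs k)) ->
  forall d, 0 < d -> exists2 T, bop p T &
    (forall j, (j < k)%N -> defect T (xs j) <= d) /\ defect T x <= d.
Proof.
move=> gxs bxs bx xc d d0; pose s := \sum_(j < k) `|c j|.
have s0 : 0 <= s by apply: sumr_ge0.
have s1 : 0 < s + 1 by rewrite ltr_wpDl.
have ds : 0 < d / (s + 1) by rewrite divr_gt0.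
have dd : d / (s + 1) <= d by rewrite ler_pdivrMr // ler_peMr ?(ltW d0) // lerDr.
have [T bT HT] := gxs _ ds; exists T => //; split=> [j jk|].
  exact: le_trans (HT j jk) dd.
have lA := ulinopB lS (ulinop_ultraop bT); have [Ab Aeq _ _] := lA.
have bl := ubdd_ulincomb c bxs.
rewrite /defect (unm_eq (Ab _ bx) (Ab _ bl) (Aeq _ _ bx bl xc)).
apply: (le_trans (unm_ulincomb c lA bxs)).
apply: (@le_trans _ _ (s * (d / (s + 1)))).
  by rewrite mulr_suml; apply: ler_sum => j _; rewrite ler_wpM2l //; exact: HT.
by rewrite mulrCA ler_piMr ?(ltW d0) // ler_pdivrMr // mul1r lerDl.
Qed.

(** If a test [psi] in [W] separates [x] from the family, an operator [T0] good for the family is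
    corrected by one that acts as [psi] tensor [g], with [g] close to the remaining error
    [S x - T0 x]. The correction is null on the family, so the earlier estimates survive. Without
    such a [psi], linear algebra gives the first alternative. *)
Lemma good_step xs k x (W G : set (useq R)) :
  good xs k -> (forall j, (j < k)%N -> ubdd p (xs j)) -> ubdd p x ->
  W `<=` ubdd q -> G `<=` ubdd p ->
  (forall u v, W u -> W v -> W (uadd u v)) -> (forall a u, W u -> W (uscale a u)) ->
  (forall T, bop p T -> forall d : R, 0 < d -> exists2 g, G g &
     unm U p (usub (usub (S x) (fun n => T (x n))) g) <= d) ->
  (forall psi g, W psi -> G g -> exists2 T, bop p T &
     (forall j, (j < k)%N ->
        unull U p (usub (fun n => T (xs j n)) (uscale (upair U (xs j) psi) g))) /\
     unull U p (usub (fun n => T (x n)) (uscale (upair U x psi) g))) ->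
  (exists c : nat -> R, forall psi, W psi ->
     upair U x psi = \sum_(j < k) c j * upair U (xs j) psi) \/
  (forall d, 0 < d -> exists2 T, bop p T &
    (forall j, (j < k)%N -> defect T (xs j) <= d) /\ defect T x <= d).
Proof.
move=> gxs bxs bx Wb Gb WD WZ appr rk1.
have qp := conj_expC pq.
have lin y : ubdd p y -> linear_on W (@uadd R) (@uscale R) (upair U y).
  move=> by_; split=> [u v Wu Wv|a u Wu].
    by rewrite !(upairC U y) (upairDl qp) //; exact: Wb.
  by rewrite !(upairC U y) (upairZl qp) //; exact: Wb.
have linxs j : (j < k)%N -> linear_on W (@uadd R) (@uscale R) (upair U (xs j)).
  by move=> jk; apply: lin; exact: bxs.
case: (separate WD WZ linxs (lin x bx)) => [[psi [Wpsi xpsi jpsi]]|]; last by left.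
right=> d d0; have d2 : 0 < d / 2 by rewrite divr_gt0.
have [T0 bT0 HT0] := gxs _ d2.
have [g Gg Hg] := appr T0 bT0 _ d0; have bg := Gb _ Gg.
have [T1 bT1 [HT1 HTx]] := rk1 psi g Wpsi Gg.
have bS := let: And4 h _ _ _ := lS in h.
have bT j (y : useq R) T : bop p T -> ubdd p y -> ubdd p (fun n => T (y n)).
  by move=> b; exact: bop_ubdd.
exists (fun f => fadd (T0 f) (T1 f)); first exact: bopD.
have e (y : useq R) : usub (S y) (fun n => fadd (T0 (y n)) (T1 (y n))) =
    usub (usub (S y) (fun n => T0 (y n))) (fun n => T1 (y n)).
  by apply/funext => n; apply/funext => t; rewrite /usub /fsub /fadd; ring.
split=> [j jk|].
  have by_ := bxs j jk; rewrite /defect e.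
  have n1 : unull U p (fun n => T1 (xs j n)).
    have := HT1 j jk; rewrite jpsi //.
    rewrite (_ : usub _ _ = fun n => T1 (xs j n)) //.
    by apply/funext => n; apply/funext => t; rewrite /usub /fsub /uscale /fscale mul0r subr0.
  have b0 : ubdd p (usub (S (xs j)) (fun n => T0 (xs j n))).
    by apply: (ubddB pq); [exact: bS|exact: bop_ubdd].
  apply: (le_trans (unmB b0 (bop_ubdd bT1 by_))).
  rewrite (unm_null (bop_ubdd bT1 by_)).1 // addr0 (le_trans (HT0 j jk)) //.
  by rewrite ler_pdivrMr // ler_peMr // ?(ltW d0) //; lra.
rewrite /defect e.
have b0 : ubdd p (usub (S x) (fun n => T0 (x n))).
  by apply: (ubddB pq); [exact: bS|exact: bop_ubdd].
have b1 := bop_ubdd bT1 bx.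
apply: le_trans Hg; rewrite le_eqVlt; apply/orP; left; apply/eqP.
apply: unm_eq; [exact: (ubddB pq)|exact: (ubddB pq)|].
rewrite (_ : usub _ _ = usub g (fun n => T1 (x n))); last first.
  by apply/funext => n; apply/funext => t; rewrite /usub /fsub; ring.
apply: unull_subC; move: HTx; rewrite xpsi.
rewrite (_ : uscale 1 g = g) //.
by apply/funext => n; apply/funext => t; rewrite /uscale /fscale mul1r.
Qed.

End approximation.

End seminorm.

(** * The ultraoperators are dense in the operators with the three invariant subspaces *)

(** Both versions of [M] have this form: [N] is [W2] in L^q for [p > 2], and [Dz] in L^q for
    [p < 2]. Closedness and stability under weak operator limits are then treated at once. *)
Definition annih {R : realType} (U : set_system nat) (p q : R) (N : set (useq R)) :
  set (useq R) := [set x | wnull U p q x /\ forall psi, N psi -> upair U x psi = 0].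

Section density.
Context {R : realType} (U : set_system nat) {Uu : ultrafilter_nat U}.
Hypotheses (Unp : nonprincipal U) (Usel : selective U).
Variables (p q : R).
Hypothesis pq : conj_exp p q.
Implicit Types (x y z g psi : useq R) (S : useq R -> useq R) (T : (R -> R) -> R -> R).

Let p1 : 1 < p. Proof. by case: pq. Qed.
Let p0 : 0 < p. Proof. exact: lt_trans p1. Qed.
Let p0w : 0 <= p. Proof. exact: ltW. Qed.
Let q1 : 1 < q. Proof. by case: pq. Qed.
Let q0 : 0 < q. Proof. exact: lt_trans q1. Qed.
Let q0w : 0 <= q. Proof. exact: ltW. Qed.
Let qp := conj_expC pq.

Lemma wnull0 : wnull U p q (fun _ _ => 0).
Proof. by apply: (wnull_unull pq); [exact: ubdd0|exact: (unull0 pq)]. Qed.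

Lemma wnull_ulincomb c xs k : (forall j, (j < k)%N -> wnull U p q (xs j)) ->
  wnull U p q (ulincomb c xs k).
Proof.
elim: k => [|k IH] wxs; first by rewrite ulincomb0; exact: wnull0.
rewrite ulincombS; apply: (wnullD pq); first by apply: IH => j jk; apply: wxs; exact: ltnW.
by apply: (wnullZ pq); exact: wxs.
Qed.

Lemma wnull_eq x y : wnull U p q x -> ubdd p y -> unull U p (usub x y) -> wnull U p q y.
Proof.
move=> wx by_ xy; have -> : y = usub x (usub x y).
  by apply/funext => n; apply/funext => t; rewrite /usub /fsub opprB addrCA subrr addr0.
apply: (wnullB pq) => //; apply: (wnull_unull pq) => //.
by apply: (ubddB pq) => //; exact: wx.1.
Qed.

Lemma bop_wnull T x : bop p T -> wnull U p q x -> wnull U p q (fun n => T (x n)).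
Proof.
move=> bT [bx wx]; have [T' bT' HT'] := adjoint pq bT.
split=> [|y Ly]; first exact: bop_ubdd.
under eq_fun do rewrite (HT' _ _ (bx.1 _) Ly).
by apply: wx; exact: bop_LP bT' _ Ly.
Qed.

Lemma annihD N x y : annih U p q N x -> annih U p q N y -> N `<=` ubdd q ->
  annih U p q N (uadd x y).
Proof.
move=> [wx ax] [wy ay] Nb; split=> [|psi Npsi]; first exact: (wnullD pq).
by rewrite (upairDl pq wx.1 wy.1 (Nb _ Npsi)) ax // ay // addr0.
Qed.

Lemma annihZ N a x : annih U p q N x -> N `<=` ubdd q -> annih U p q N (uscale a x).
Proof.
move=> [wx ax] Nb; split=> [|psi Npsi]; first exact: (wnullZ pq).
by rewrite (upairZl pq a wx.1 (Nb _ Npsi)) ax // mulr0.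
Qed.

Lemma annih_eq N x y : annih U p q N x -> N `<=` ubdd q -> ubdd p y ->
  unull U p (usub x y) -> annih U p q N y.
Proof.
move=> [wx ax] Nb by_ xy; split=> [|psi Npsi]; first exact: wnull_eq xy.
have bpsi := Nb _ Npsi; have bx := wx.1.
have := upair_null (Uu := Uu) pq (ubddB pq bx by_) bpsi xy.
by rewrite (upairBl pq bx by_ bpsi) ax // sub0r => /eqP; rewrite oppr_eq0 => /eqP.
Qed.

Variables (N0 M0 : set (useq R)).
Local Notation M := (annih U p q N0).

(** The pairs to which [rank_one_op] applies. Two kinds will be available: [psi] in [N0] with any
    weakly null [g], and [g] in a dense part [M0] of [M] with any weakly null [psi]. *)
Definition admissible g psi : Prop := exists s s', [/\ conj_exp s s',
  upper U p s g & upper U q s' psi].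

Hypotheses (N0w : N0 `<=` wnull U q p)
  (N0D : forall u v, N0 u -> N0 v -> N0 (uadd u v)) (N0Z : forall a u, N0 u -> N0 (uscale a u))
  (adC : forall psi g, N0 psi -> wnull U p q g -> admissible g psi)
  (M0M : M0 `<=` M)
  (M0dense : forall x, M x -> forall d : R, 0 < d -> exists2 g, M0 g & unm U p (usub x g) <= d)
  (adB : forall psi g, wnull U q p psi -> M0 g -> admissible g psi)
  (bopM : forall T x, bop p T -> M x -> M (fun n => T (x n))).

Let N0b : N0 `<=` ubdd q. Proof. by move=> x /N0w[]. Qed.

Variable S : useq R -> useq R.
Hypotheses (lS : ulinop U p S)
  (Sw : forall x, wnull U p q x -> wnull U p q (S x))
  (SM : forall x, M x -> M (S x))
  (Sc : forall f, LP p f -> exists2 g, LP p g & unull U p (usub (S (fun=> f)) (fun=> g))).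

Lemma rank_one_family (hs : nat -> useq R) k x g psi :
  (forall j, (j < k)%N -> wnull U p q (hs j)) -> wnull U p q x ->
  wnull U p q g -> wnull U q p psi -> admissible g psi ->
  exists2 T, bop p T &
    (forall j, (j < k)%N ->
      unull U p (usub (fun n => T (hs j n)) (uscale (upair U (hs j) psi) g))) /\
    unull U p (usub (fun n => T (x n)) (uscale (upair U x psi) g)).
Proof.
move=> whs wx wg wpsi [s [s' [ss ug upsi]]].
pose hs' j := if j == k then x else hs j.
have whs' j : (j < k.+1)%N -> wnull U p q (hs' j).
  rewrite /hs' ltnS leq_eqVlt; case: eqP => //= _; exact: whs.
have [T bT HT] := rank_one_op Unp Usel pq ss wg.1 ug wpsi upsi whs'.
exists T => //; split=> [j jk|].
  by have := HT j (ltnW jk); rewrite /hs' ltn_eqF.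
by have := HT k (leqnn _); rewrite /hs' eqxx.
Qed.

(** Induction on the family, with two extension steps. Tests from [N0] allow any target. If they do
    not separate [x], subtracting a combination of the family lands in [M]; there the error of
    approximation stays in [M] and is approximated from [M0], so every weakly null test is
    allowed. *)
Lemma good_hats (hs : nat -> useq R) k :
  (forall j, (j < k)%N -> wnull U p q (hs j)) -> good U p S hs k.
Proof.
elim: k => [|k IH] whs.
  move=> d d0; exists (fun f => fscale 0 f) => //; apply: (bop_intro pq).
  - by move=> f Lf; exact: LpZ.
  - by move=> f g y Lf Lg Ly; rewrite !(pairingZl pq) //; [rewrite !mul0r addr0|exact: LpD].
  - by move=> c f y Lf Ly; rewrite !(pairingZl pq) //; [rewrite !mul0r mulr0|exact: LpZ].
  - by exists 1 => f Lf; rewrite lpnZ // normr0 mul0r mulr_ge0 // lpn_ge0.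
have whs' j : (j < k)%N -> wnull U p q (hs j) by move=> jk; apply: whs; exact: ltnW.
have {}IH := IH whs'.
have bhs j : (j < k)%N -> ubdd p (hs j) by move=> /whs'[].
have wx := whs k (leqnn _); set x := hs k in wx; have bx := wx.1.
have wB T y : bop p T -> wnull U p q y -> wnull U p q (usub (S y) (fun n => T (y n))).
  by move=> bT wy; apply: (wnullB pq); [exact: Sw|exact: bop_wnull].
have fin : (forall d : R, 0 < d -> exists2 T, bop p T &
    (forall j, (j < k)%N -> defect U p S T (hs j) <= d) /\ defect U p S T x <= d) ->
    good U p S hs k.+1.
  move=> h d d0; have [T bT [h1 h2]] := h d d0; exists T => // j.
  by rewrite ltnS leq_eqVlt => /predU1P[->|/h1].
have := @good_step _ U Uu _ _ pq S lS hs k x N0 (wnull U p q) IH bhs bx N0b.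
case=> //.
- by move=> y [].
- move=> T bT d d0; exists (usub (S x) (fun n => T (x n))); first exact: wB.
  by rewrite (unm_null _).1 ?(ltW d0) //; [rewrite usubxx; exact: ubdd0|exact: (unull_refl pq)].
- by move=> psi g Npsi wg; apply: rank_one_family => //; [exact: N0w|exact: adC].
- move=> [c Hc]; pose m := usub x (ulincomb c hs k).
  have wm : wnull U p q m by apply: (wnullB pq) => //; exact: wnull_ulincomb.
  have bl := ubdd_ulincomb pq c bhs.
  have Mm : M m.
    split=> // psi Npsi; have bpsi := N0b Npsi.
    by rewrite (upairBl pq bx bl bpsi) (upair_ulincomb pq c bhs bpsi) Hc // subrr.
  have := @good_step _ U Uu _ _ pq S lS hs k m (wnull U q p) M0 IH bhs wm.1.
  case=> //.
  + by move=> y [].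
  + by move=> y /M0M[[]].
  + exact: (wnullD qp).
  + exact: (wnullZ qp).
  + move=> T bT d d0; apply: M0dense => //.
    have MT := bopM bT Mm; have MS := SM Mm; rewrite usubE.
    by apply: annihD => //; exact: annihZ.
  + by move=> psi g wpsi Mg; apply: rank_one_family => //; [have [] := M0M Mg|exact: adB].
  (* If no weakly null test separates [m] either, [m] is a combination of the family modulo null
     sequences, by [wnull_separated]. *)
  + move=> [c' Hc']; apply: fin; apply: (good_span pq lS (c := fun j => c j + c' j) IH) => //.
    have bl' := ubdd_ulincomb pq c' bhs.
    rewrite (_ : usub _ _ = usub m (ulincomb c' hs k)); last first.
      apply/funext => n; apply/funext => t; rewrite /usub /fsub /ulincomb /lincomb.
      rewrite (eq_bigr (fun j : 'I_k => c j * hs j n t + c' j * hs j n t)) => [|j _].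
        by rewrite big_split /= opprD addrA.
      by rewrite mulrDl.
    apply: (wnull_separated pq).
      by apply: (wnullB pq) => //; exact: wnull_ulincomb.
    move=> psi wpsi; have bpsi := wpsi.1.
    by rewrite (upairBl pq wm.1 bl' bpsi) (upair_ulincomb pq c' bhs bpsi) Hc' // subrr.
  (* The approximated family contains [m] in place of [x]; [x] is recovered from it as a
     combination. *)
  + move=> gm.
    pose hs' j := if j == k then m else hs j.
    have hs'E j : (j < k)%N -> hs' j = hs j by move=> jk; rewrite /hs' ltn_eqF.
    have gm' : good U p S hs' k.+1.
      move=> d d0; have [T bT [h1 h2]] := gm d d0; exists T => // j.
      rewrite ltnS leq_eqVlt => /predU1P[->|jk]; first by rewrite /hs' eqxx.
      by rewrite hs'E // h1.
    have bhs' j : (j < k.+1)%N -> ubdd p (hs' j).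
      rewrite ltnS leq_eqVlt => /predU1P[->|jk]; first by rewrite /hs' eqxx; exact: wm.1.
      by rewrite hs'E //; exact: bhs.
    apply: fin => d d0.
    have [|T bT [h1 h2]] := good_span pq lS (c := fun j => if j == k then 1 else c j) gm' bhs' bx _ d0.
      rewrite (_ : ulincomb _ _ _ = x); first exact: (unull_refl pq).
      apply/funext => n; apply/funext => t; rewrite /ulincomb /lincomb big_ord_recr /= /hs' eqxx.
      rewrite mul1r (eq_bigr (fun j : 'I_k => c j * hs j n t)) => [|j _].
        by rewrite /m /usub /fsub addrC subrK.
      by rewrite ltn_eqF.
    exists T => //; split=> // j jk; rewrite -(hs'E _ jk); apply: h1; exact: ltnW.
Qed.

Lemma rank_one_const (f y : R -> R) : LP q f -> LP p y -> exists2 T, bop p T &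
  forall x, ubdd p x -> unull U p (usub (fun n => T (x n)) (uscale (upair U x (fun=> f)) (fun=> y))).
Proof.
move=> Lf Ly; exists (fun x : R -> R => fscale (pairing x f) y).
  apply: (bop_intro pq).
  - by move=> x Lx; exact: LpZ.
  - move=> x x' z Lx Lx' Lz; rewrite !(pairingZl pq) // (pairingDl pq) //; ring.
  - move=> a x z Lx Lz; rewrite !(pairingZl pq) //; ring.
  - exists (nrm q f * nrm p y) => x Lx; rewrite lpnZ // mulrC [leRHS]mulrC mulrA.
    by rewrite mulrC ler_wpM2r ?lpn_ge0 //; exact: (pairing_le pq).
move=> x bx; have h := upairP (Uu := Uu) pq bx (ubdd_cst Lf).
rewrite /unull (_ : (fun n => _) = fun n => `|pairing (x n) f - upair U x (fun=> f)| * nrm p y).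
  rewrite -(mul0r (nrm p y)); apply: cvgM; last exact: cvg_cst.
  rewrite -(normr0 R) -(subrr (upair U x (fun=> f))); apply: cvg_norm.
  by apply: cvgB; [exact: h|exact: cvg_cst].
apply/funext => n; rewrite -lpnZ //; congr nrm; apply/funext => t.
by rewrite /usub /fsub /uscale /fscale mulrBl.
Qed.

(** Each vector is split into its weak limit and a weakly null part. The weak limits are adjoined
    one at a time to the weakly null parts, using constant tests and targets, for which genuine rank
    one operators are available. *)
Lemma good_all (xs : nat -> useq R) k :
  (forall j, (j < k)%N -> ubdd p (xs j)) -> good U p S xs k.
Proof.
move=> bxs.
have Hf j : exists f, (j < k)%N -> LP p f /\ wnull U p q (usub (xs j) (fun=> f)).
  have [jk|_] := ltnP j k; last by exists (fun=> 0).
  by have [f Lf wf] := weak_limit (Uu := Uu) pq (bxs j jk); exists f.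
have [f Hf'] := choice Hf.
have Lf j : (j < k)%N -> LP p (f j) by move=> /Hf'[].
pose hs j := usub (xs j) (fun=> f j).
have whs j : (j < k)%N -> wnull U p q (hs j) by move=> /Hf'[].
pose zs j : useq R := if (j < k)%N then hs j else (fun=> f (j - k)%N).
have bzs j : (j < k + k)%N -> ubdd p (zs j).
  rewrite /zs; case: (ltnP j k) => [jk _|kj jkk]; first by have [] := whs _ jk.
  by apply: ubdd_cst; apply: Lf; rewrite ltn_subLR.
have gz l : (l <= k)%N -> good U p S zs (k + l).
  elim: l => [_|l IH lk].
    rewrite addn0 => d d0; have [T bT HT] := good_hats whs d0; exists T => // j jk.
    by rewrite /zs jk HT.
  have {}IH := IH (ltnW lk).
  have zkl : zs (k + l)%N = fun=> f l by rewrite /zs ltnNge leq_addr /= addKn.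
  have Lfl := Lf l lk; have bzl : ubdd p (zs (k + l)%N) by rewrite zkl; exact: ubdd_cst.
  have bzs' j : (j < k + l)%N -> ubdd p (zs j).
    by move=> jkl; apply: bzs; apply: (leq_trans jkl); rewrite leq_add2l ltnW.
  have fin : (forall d : R, 0 < d -> exists2 T, bop p T &
    (forall j, (j < k + l)%N -> defect U p S T (zs j) <= d) /\ defect U p S T (zs (k + l)%N) <= d) ->
    good U p S zs (k + l.+1).
    move=> h d d0; have [T bT [h1 h2]] := h d d0; exists T => // j.
    by rewrite addnS ltnS leq_eqVlt => /predU1P[->|/h1].
  have := @good_step _ U Uu _ _ pq S lS zs (k + l) (zs (k + l)%N)
    [set u | exists2 y, LP q y & u = fun=> y] [set u | exists2 y, LP p y & u = fun=> y]
    IH bzs' bzl.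
  case.
  - by move=> u [y Ly ->]; exact: ubdd_cst.
  - by move=> u [y Ly ->]; exact: ubdd_cst.
  - move=> u v [y Ly ->] [y' Ly' ->]; exists (fadd y y') => //; exact: LpD.
  - by move=> a u [y Ly ->]; exists (fscale a y) => //; exact: LpZ.
  - move=> T bT d d0; have [g Lg Hg] := Sc Lfl; have LT := bop_LP bT Lfl.
    exists (fun=> fsub g (T (f l))); first by exists (fsub g (T (f l))) => //; exact: LpB.
    rewrite (unm_null _).1 ?(ltW d0) //; rewrite zkl (_ : usub _ _ = usub (S (fun=> f l)) (fun=> g)).
    + by apply: (ubddB pq); [case: lS => h _ _ _; apply: h; exact: ubdd_cst|exact: ubdd_cst].
    + by apply/funext => n; apply/funext => t; rewrite /usub /fsub; ring.
    + exact: Hg.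
    + by apply/funext => n; apply/funext => t; rewrite /usub /fsub; ring.
  - move=> _ _ [y Ly ->] [y' Ly' ->]; have [T bT HT] := rank_one_const Ly Ly'.
    by exists T => //; split=> [j jkl|]; apply: HT => //; exact: bzs'.
  - move=> [c Hc]; apply: fin.
    (* Constant tests vanish on the weakly null vectors, so their coefficients can be set to zero;
       what remains is a combination of constants. *)
    pose c' j := if (j < k)%N then 0 else c j.
    apply: (good_span pq lS (c := c') IH) => //.
    have bl := ubdd_ulincomb pq c' bzs'.
    have cst n : ulincomb c' zs (k + l) n = ulincomb c' zs (k + l) 0%N.
      apply/funext => t; rewrite /ulincomb /lincomb; apply: eq_bigr => j _.
      by rewrite /c' /zs; case: ifP => // _; rewrite !mul0r.
    set u := ulincomb c' zs (k + l) 0%N in cst.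
    have Lu : LP p u by have := bl.1 0%N.
    have -> : ulincomb c' zs (k + l) = fun=> u by apply/funext => n; rewrite cst.
    rewrite zkl /unull /usub (null_eq_pairing pq Lfl Lu); first exact: cvg_cst.
    move=> y Ly.
    have e1 : upair U (zs (k + l)%N) (fun=> y) = pairing (f l) y.
      by apply: upairE; rewrite zkl; exact: cvg_cst.
    have e2 : upair U (ulincomb c' zs (k + l)) (fun=> y) = pairing u y.
      by apply: upairE; under eq_fun do rewrite cst; exact: cvg_cst.
    rewrite -e1 -e2 Hc; last by exists y.
    rewrite (upair_ulincomb pq c' bzs' (ubdd_cst Ly)); apply: eq_bigr => j _.
    rewrite /c'; case: ifP => // jk; rewrite /zs jk (upair_cst (whs _ jk) Ly) !mulr0 //.
  - by move=> h; apply: fin.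
move=> d d0; have d2 : 0 < d / 2 by rewrite divr_gt0.
have [T bT HT] := gz k (leqnn k) _ d2; exists T => // j jk.
have lA := ulinopB pq lS (ulinop_ultraop pq bT); have [Ab _ AD _] := lA.
have bh : ubdd p (hs j) by have [] := whs _ jk.
have bf : ubdd p (fun=> f j) := ubdd_cst (Lf _ jk).
have h1 := HT j (leq_trans jk (leq_addr k k)).
have h2 : defect U p S T (fun=> f j) <= d / 2.
  have := HT (k + j)%N; rewrite ltn_add2l => /(_ jk).
  by rewrite {1}/zs ltnNge leq_addr /= addKn.
rewrite {1}/zs jk in h1.
rewrite /defect; have -> : xs j = uadd (hs j) (fun=> f j).
  by apply/funext => n; apply/funext => t; rewrite /hs /usub /uadd /fsub /fadd subrK.
have := AD _ _ bh bf => h3.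
rewrite (unm_eq pq (Ab _ (ubddD pq bh bf)) (ubddD pq (Ab _ bh) (Ab _ bf)) h3).
apply: (le_trans (unmD pq (Ab _ bh) (Ab _ bf))).
by rewrite (splitr d); apply: lerD.
Qed.

End density.

(** * The invariant subspace *)

(** Meant for [r < 2]: being weakly null in L^2 raises the exponent of the upper estimate from [r]
    to 2. *)
Definition W2 {R : realType} (U : set_system nat) (r s : R) (x : useq R) : Prop :=
  wnull U 2 2 x /\ Bz U r s x.

Section classes.
Context {R : realType} (U : set_system nat) {Uu : ultrafilter_nat U}.
Hypothesis Unp : nonprincipal U.
Variables (r s : R).
Hypothesis rs : conj_exp r s.
Implicit Types (x y z psi : useq R).

Let r1 : 1 < r. Proof. by case: rs. Qed.
Let r0 : 0 < r. Proof. exact: lt_trans r1. Qed.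
Let r0w : 0 <= r. Proof. exact: ltW. Qed.
Let sr := conj_expC rs.
Let c22 := @conj_exp22 R.

Lemma DzD x y : Dz U r x -> Dz U r y -> Dz U r (uadd x y).
Proof.
move=> [bx x0] [by_ y0]; split; first exact: (ubddD rs).
apply: (@ucvg0_le _ _ _ _ (fun n => itg (fun t => `|x n t|) + itg (fun t => `|y n t|))); last first.
  by rewrite -(addr0 (0 : R)); exact: cvgD.
apply: nearW => n; rewrite ger0_norm ?itg_ge0 //.
have Lx : L1 (x n) := Lp_L1 (ltW r1) (bx.1 n); have Ly : L1 (y n) := Lp_L1 (ltW r1) (by_.1 n).
rewrite -itgD; [|exact: L1_norm..].
apply: itg_le; [exact/L1_norm/L1D|by apply: L1D; exact: L1_norm|].
by move=> t; exact: ler_normD.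
Qed.

Lemma DzZ a x : Dz U r x -> Dz U r (uscale a x).
Proof.
move=> [bx x0]; split; first exact: (ubddZ rs).
rewrite (_ : (fun n => _) = fun n => `|a| * itg (fun t => `|x n t|)).
  by rewrite -(mulr0 `|a|); apply: cvgM => //; exact: cvg_cst.
apply/funext => n; have Lx : L1 (x n) := Lp_L1 (ltW r1) (bx.1 n).
rewrite -itgZ; last exact: L1_norm.
by congr itg; apply/funext => t; rewrite /uscale /fscale normrM.
Qed.

Lemma unull_Dz x : ubdd r x -> unull U r x -> Dz U r x.
Proof.
move=> bx nx; split=> //; apply: ucvg0_le nx; apply: nearW => n.
by rewrite ger0_norm ?itg_ge0 // itg_norm_le //; [exact: ltW|exact: bx.1].
Qed.

Lemma BzP x : ubdd r x -> Bz U r s x <-> forall y, Dz U s y -> upair U x y = 0.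
Proof.
move=> bx; split=> [[_ h] y /h|h]; first exact: upairE.
by split=> // y Dy; have := upairP (Uu := Uu) rs bx Dy.1; rewrite (h y Dy).
Qed.

Lemma BzD x y : Bz U r s x -> Bz U r s y -> Bz U r s (uadd x y).
Proof.
move=> Bx By; have bx := Bx.1; have by_ := By.1; have bxy := ubddD rs bx by_.
apply/BzP => // z Dz_; rewrite (upairDl rs bx by_ Dz_.1).
by rewrite ((BzP bx).1 Bx) // ((BzP by_).1 By) // addr0.
Qed.

Lemma BzZ a x : Bz U r s x -> Bz U r s (uscale a x).
Proof.
move=> Bx; have bx := Bx.1; apply/BzP; first exact: (ubddZ rs).
by move=> z Dz_; rewrite (upairZl rs a bx Dz_.1) ((BzP bx).1 Bx) // mulr0.
Qed.

Lemma unull_Bz x : ubdd r x -> unull U r x -> Bz U r s x.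
Proof. by move=> bx nx; apply/BzP => // y Dy; rewrite (upair_null rs bx Dy.1). Qed.

Lemma Bz_cst w : LP r w -> Bz U r s (fun=> w).
Proof.
move=> Lw; split=> [|y Dy]; first exact: ubdd_cst.
by have [_ wy] := Dz_wnull sr Dy; under eq_fun do rewrite pairingC; exact: wy.
Qed.

Lemma Bz_bounded x K : (forall n, meas (x n)) -> (forall n t, `|x n t| <= K) -> Bz U r s x.
Proof.
move=> mx xK; have K0 : 0 <= K by exact: le_trans (xK 0%N 0).
have bx : ubdd r x.
  split=> [n|]; first exact: (Lp_bounded r0w (mx n) (xK n)).
  exists K => n; have Ln := Lp_bounded r0w (mx n) (xK n).
  rewrite -(ger0_norm K0) -(lpn_cst K r0); apply: lpn_mono => //; first exact: Lp_cst.
  by move=> t; rewrite (ger0_norm K0).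
split=> // y [by_ y0]; apply: (@ucvg0_le _ _ _ _ (fun n => K * itg (fun t => `|y n t|))); last first.
  by rewrite -(mulr0 K); apply: cvgM => //; exact: cvg_cst.
apply: nearW => n; rewrite pairingC; exact: (bounded_pairing_le sr (by_.1 n) (mx n) (xK n)).
Qed.

Hypothesis r2 : r < 2.
Let s2 : 2 < s. Proof. exact: conj_exp_lt2 rs r2. Qed.

Lemma ubdd_exp_le x : ubdd 2 x -> ubdd r x.
Proof.
move=> [Lx [M xM]]; split=> [n|]; first exact: (Lp_exp_le r0 (ltW r2) (Lx n)).
by exists M => n; rewrite (le_trans _ (xM n)) // lpn_exp_le // ltW.
Qed.

Lemma W2_wnull x : W2 U r s x -> wnull U r s x.
Proof.
move=> [[bx wx] _]; split=> [|y Ly]; first exact: ubdd_exp_le.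
by apply: wx; apply: (Lp_exp_le _ (ltW s2) Ly).
Qed.

Lemma W2D x y : W2 U r s x -> W2 U r s y -> W2 U r s (uadd x y).
Proof. by move=> [wx Bx] [wy By]; split; [exact: (wnullD c22)|exact: BzD]. Qed.

Lemma W2Z a x : W2 U r s x -> W2 U r s (uscale a x).
Proof. by move=> [wx Bx]; split; [exact: (wnullZ c22)|exact: BzZ]. Qed.

Lemma upper_W2 x : W2 U r s x -> upper U r 2 x.
Proof.
move=> [wx _]; apply: upper_exp_le; [exact: rs|exact: ltW|exact: wx.1|].
by have := upper_wnull (Uu := Uu) c22 wx; rewrite minxx.
Qed.

(** The supply of elements of [W2]: truncations, sign functions and cosines enter it after removal
    of their weak limit in L^2. *)
Lemma bounded_W2 x K : (forall n, meas (x n)) -> (forall n t, `|x n t| <= K) ->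
  exists2 w, LP 2 w & W2 U r s (usub x (fun=> w)).
Proof.
move=> mx xK; have K0 : 0 <= K by exact: le_trans (xK 0%N 0).
have Lx n : LP 2 (x n) by apply: (Lp_bounded _ (mx n) (xK n)).
have bx : ubdd 2 x.
  split=> //; exists K => n.
  rewrite -(ger0_norm K0) -(@lpn_cst _ 2 K) //; apply: lpn_mono => //; first exact: Lp_cst.
  by move=> t; rewrite (ger0_norm K0).
have [w Lw ww] := weak_limit (Uu := Uu) c22 bx; exists w => //; split=> //.
rewrite usubE; apply: BzD; first exact: Bz_bounded.
by apply: BzZ; apply: Bz_cst; apply: (Lp_exp_le r0 (ltW r2) Lw).
Qed.

(* Truncations are bounded in L^2 and approximate the uniformly integrable sequences. *)
Lemma W2_dense x : wnull U r s x -> Bz U r s x -> forall d : R, 0 < d ->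
  exists2 g, W2 U r s g & unm U r (usub x g) <= d.
Proof.
move=> wx Bx d d0; have bx := wx.1.
have [K] := split_seq Unp rs bx; set b := fun n => trunc (K n)%:R (x n).
move=> [appr Bb Db].
have bb := Bb.1; have bxb := ubddB rs bx bb.
(* The difference concentrates by the splitting and lies in [Bz] because [x] and [b] do. *)
have nxb : unull U r (usub x b).
  apply: (Dz_Bz_null rs) => //; rewrite usubE; apply: BzD => //; exact: BzZ.
have d2 : 0 < d / 2 by rewrite divr_gt0.
have [k Hk] := appr _ d2.
pose t n := trunc k%:R (x n).
have mt n : meas (t n) by apply: meas_trunc; exact: Lp_meas (bx.1 n).
have tk n u : `|t n u| <= k%:R by apply: trunc_bound; exact: ler0n.
have [w Lw2 Ww] := bounded_W2 mt tk.
have bt : ubdd r t by apply: (ubdd_le rs bx mt) => n u; exact: trunc_le.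
have Lw : LP r w := Lp_exp_le r0 (ltW r2) Lw2.
exists (usub t (fun=> w)) => //.
have bbt := ubddB rs bb bt.
have ubt : unm U r (usub b t) <= d / 2 by apply: (ucvg_le (unmP bbt)).
have uxt : unm U r (usub x t) <= d / 2.
  rewrite (_ : usub x t = uadd (usub x b) (usub b t)).
    by rewrite (le_trans (unmD rs bxb bbt)) // (unm_null bxb).1 // add0r.
  by apply/funext => n; apply/funext => u; rewrite /uadd /usub /fadd /fsub addrA subrK.
have bxt := ubddB rs bx bt.
(* Since [x] is weakly null, [-w] is the weak limit of [x - t] up to sign conventions of the
   pairing: [w] is that of [t - x], so its norm is at most the limit of [|| x - t ||]. *)
have nw : nrm r w <= d / 2.
  apply: (lpn_dual_le rs Lw) => [|y Ly]; first exact: ltW.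
  have [_ h1] := W2_wnull Ww; have c1 := h1 y Ly; have c2 := wx.2 y Ly.
  have c3 : pairing (usub t (fun=> w) n) y - pairing (x n) y @[n --> U] --> 0.
    by rewrite -(subr0 (0 : R)); apply: cvgB.
  have c4 : pairing w y + pairing (usub x t n) y @[n --> U] --> 0.
    rewrite (_ : (fun n => _) = fun n => - (pairing (usub t (fun=> w) n) y - pairing (x n) y)).
      by rewrite -(oppr0 R); exact: cvgN.
    apply/funext => n.
    rewrite (pairingBl rs (bt.1 n) Lw Ly) (pairingBl rs (bx.1 n) (bt.1 n) Ly); ring.
  have c5 : nrm r (usub x t n) * nrm s y @[n --> U] --> unm U r (usub x t) * nrm s y.
    by apply: cvgM; [exact: unmP|exact: cvg_cst].
  apply: (@le_trans _ _ (unm U r (usub x t) * nrm s y)); last by rewrite ler_wpM2r ?lpn_ge0.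
  have c6 : nrm r (usub x t n) * nrm s y + (pairing w y + pairing (usub x t n) y)
      @[n --> U] --> unm U r (usub x t) * nrm s y + 0 by exact: cvgD.
  rewrite addr0 in c6; apply: (ucvg_ge c6); apply: nearW => n.
  have := pairing_le rs (bxt.1 n) Ly; rewrite ler_norml => /andP[h _]; lra.
rewrite (_ : usub x _ = uadd (usub x t) (fun=> w)); last first.
  by apply/funext => n; apply/funext => u; rewrite /uadd /usub /fadd /fsub; ring.
rewrite (le_trans (unmD rs bxt (ubdd_cst Lw))) // (splitr d) lerD //.
by rewrite (unmE (l := nrm r w)) //; exact: cvg_cst.
Qed.

End classes.

Section characterization.
Context {R : realType} (U : set_system nat) {Uu : ultrafilter_nat U}.
Hypothesis Unp : nonprincipal U.
Variables (p q : R).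
Hypothesis pq : conj_exp p q.
Implicit Types (x y z psi : useq R).

Let q1 : 1 < q. Proof. by case: pq. Qed.
Let q0 : 0 < q. Proof. exact: lt_trans q1. Qed.
Let qp := conj_expC pq.

(** For the converse, [x n] is paired with its sign, which gives its L^1 norm; the sign sequence
    minus its weak limit lies in [W2], and that weak limit pairs to zero with [x]. *)
Lemma Dz_annih x : 2 < p -> Dz U p x <-> annih U p q (W2 U q p) x.
Proof.
move=> p2; have q2 := conj_exp_gt2 pq p2.
split=> [Dx|[wx ax]].
  split=> [|psi [_ [bpsi Bpsi]]]; first exact: (Dz_wnull pq).
  by apply: upairE; under eq_fun do rewrite pairingC; exact: Bpsi.
have bx := wx.1; split=> //.
pose sg n t := Num.sg (x n t).
have msg n : meas (sg n) by apply: meas_sg; exact: Lp_meas (bx.1 n).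
have sg1 n t : `|sg n t| <= 1 by rewrite normr_sg; case: (_ != 0); rewrite ?ler01.
have [w Lw Ww] := bounded_W2 (Uu := Uu) qp q2 msg sg1.
have Lwq : LP q w := Lp_exp_le q0 (ltW q2) Lw.
have bsg : ubdd q sg := (Bz_bounded (Uu := Uu) qp msg sg1).1.
have := ax _ Ww; rewrite upairC (upairBl qp bsg (ubdd_cst Lwq) bx).
rewrite (upairC U (fun=> w)) (upair_cst wx Lwq) subr0 => h.
have := upairP (Uu := Uu) qp bsg bx; rewrite h.
rewrite (_ : (fun n => pairing (sg n) (x n)) = fun n => itg (fun t => `|x n t|)) //.
apply/funext => n; rewrite pairingE; congr itg; apply/funext => t.
by rewrite /sg -normrEsg.
Qed.

End characterization.

(** * Concentrating and oscillating sequences *)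

Section examples.
Context {R : realType}.

Lemma itg_indic (a : R) : 0 <= a <= 1 -> itg (\1_(`[0, a]%classic) : R -> R) = a.
Proof.
move=> /andP[a0 a1]; rewrite itg.unlock /Rintegral integral_indic //; last exact: I01_measurable.
rewrite (_ : _ `&` _ = `[0, a]%classic).
  apply: (etrans (congr1 fine (@lebesgue_measure_itv R `[0%R, a]))).
  rewrite /= lte_fin; case: ltP => [_|h]; first by rewrite oppr0 adde0.
  by apply/le_anti; rewrite /= a0 h.
apply/setIidPl => t /=; rewrite /I01 /= !in_itv /= => /andP[-> h].
exact: le_trans a1.
Qed.

(** Indicators of [0, 1/(n+1)] normalized in L^p; their L^1 norms are [(n+1)^(1/p - 1)]. *)
Lemma spikes (U : set_system nat) (Uu : ultrafilter_nat U) (p : R) :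
  nonprincipal U -> 1 < p -> exists2 x, Dz U p x & ~ unull U p x.
Proof.
move=> Unp p1; have p0 : 0 < p by exact: lt_trans p1.
pose a n : R := n.+1%:R^-1.
have a0 n : 0 < a n by rewrite invr_gt0 ltr0Sn.
have a1 n : a n <= 1 by rewrite invf_le1 ?ltr0Sn // ler1n.
pose i n : R -> R := \1_(`[0, a n]%classic).
have mi n : meas (i n) by apply: meas_indic; exact: measurable_itv.
have ii n t : `|i n t| <= 1 by exact: indic_le1.
have Li n : L1 (i n) by apply: (Lp_L1 (lexx 1)); apply: (Lp_bounded _ (mi n) (ii n)).
pose x n := fscale ((a n)^-1 `^ p^-1) (i n).
have xpow n (r : R) : 0 < r -> itg (fun t => `|x n t| `^ r) = ((a n)^-1 `^ p^-1) `^ r * a n.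
  move=> r0; have an : 0 <= a n <= 1 by rewrite a1 (ltW (a0 n)).
  have <- : itg (fun t => ((a n)^-1 `^ p^-1) `^ r * i n t) = ((a n)^-1 `^ p^-1) `^ r * a n.
    by rewrite itgZ // /i (itg_indic an).
  congr itg; apply/funext => t.
  rewrite /x /fscale /i normrM powRM // ger0_norm ?powR_ge0 // indicE.
  by case: (_ \in _); rewrite ?normr1 ?normr0 ?powR1 ?powR0 ?gt_eqF.
have Lx n : LP p (x n) by apply: LpZ; apply: (Lp_bounded (ltW p0) (mi n) (ii n)).
have nx n : nrm p (x n) = 1.
  rewrite lpnE NmE xpow // powR_invK ?invr_ge0 ?(ltW (a0 n)) //.
  by rewrite mulVf ?gt_eqF // powR1.
exists x; last first.
  move=> h; have h1 : nrm p (x n) @[n --> U] --> (1 : R).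
    by under eq_fun do rewrite nx; exact: cvg_cst.
  have /eqP := ucvg_unique (Uu := Uu) h h1; by rewrite eq_sym oner_eq0.
split; first by split=> //; exists 1 => n; rewrite nx.
have q0 : 0 < 1 - p^-1 by rewrite subr_gt0 invf_lt1.
have xE n : itg (fun t => `|x n t|) = a n `^ (1 - p^-1).
  have := xpow n 1 ltr01; rewrite powRr1 ?powR_ge0 // => h.
  rewrite (_ : itg _ = itg (fun t => `|x n t| `^ 1)); last first.
    by congr itg; apply/funext => t; rewrite powRr1.
  rewrite h powR_inv ?(ltW (a0 n)) // -{2}(powRr1 (ltW (a0 n))) -powRD.
    by congr (_ `^ _); rewrite addrC.
  by rewrite gt_eqF ?implybT // addrC.
apply: ucvg0P => e e0.
pose N := Num.truncn (e `^ (- (1 - p^-1)^-1)).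
apply: filterS (unear_ge Unp N) => n Nn.
rewrite xE ger0_norm ?powR_ge0 // -[leRHS](powR_invK q0 (ltW e0)).
apply: ler_powR2r; [exact: ltW|exact: ltW|].
have e1 : 0 < e `^ (1 - p^-1)^-1 by rewrite powR_gt0.
rewrite /a -[leRHS]invrK lef_pV2 ?posrE ?invr_gt0 ?ltr0Sn // -powRN.
by apply: ltW; apply: (lt_le_trans (truncnS_gt _)); rewrite ler_nat ltnS.
Qed.

Lemma sin_npi (n : nat) : sin (n%:R * pi) = 0 :> R.
Proof.
elim: n => [|n IH]; first by rewrite mul0r sin0.
by rewrite -natr1 mulrDl mul1r sinDpi IH oppr0.
Qed.

Lemma cos_meas (k : R) : meas (fun t => cos (k * t)).
Proof.
apply: (@measurable_funS _ _ _ _ setT) => //.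
apply: continuous_measurable_fun => t; apply: continuous_comp; last exact: continuous_cos.
by apply: cvgM; [exact: cvg_cst|exact: cvg_id].
Qed.

Lemma itg_cos (n : nat) : itg (fun t => cos (n.+1%:R * pi * t)) = 0 :> R.
Proof.
set k : R := n.+1%:R * pi.
have k0 : k != 0 by rewrite mulf_neq0 ?pnatr_eq0 // gt_eqF // pi_gt0.
pose F t := k^-1 * sin (k * t).
have dF (t : R) : is_derive t 1 F (cos (k * t)).
  have dk : is_derive t 1 (fun u : R => k * u) k.
    by apply: is_derive_eq (is_deriveZ k (is_derive_id t 1)) _; rewrite scaler1.
  have := is_deriveZ k^-1 (is_derive1_comp (is_derive_sin (k * t)) dk).
  by move=> h; apply: is_derive_eq h _; rewrite /GRing.scale /=; field.
have cc : continuous (fun t => cos (k * t)).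
  move=> t; apply: continuous_comp; last exact: continuous_cos.
  by apply: cvgM; [exact: cvg_cst|exact: cvg_id].
have cF : continuous F.
  move=> t; apply: cvgM; first exact: cvg_cst.
  apply: continuous_comp; last exact: continuous_sin.
  by apply: cvgM; [exact: cvg_cst|exact: cvg_id].
rewrite itg.unlock /Rintegral /I01 (@continuous_FTC2 _ _ F) //.
- by rewrite -EFinB /F mulr1 mulr0 sin0 /k sin_npi !mulr0 subrr.
- by apply: continuous_subspaceT.
- split.
  + by move=> t _; have [] := dF t.
  + by apply: cvg_at_right_filter; exact: cF.
  + by apply: cvg_at_left_filter; exact: cF.
- by move=> t _; rewrite derive1E derive_val.
Qed.

(** Distinct cosines are at L^2 distance 1 and differ by at most 2 everywhere, so their L^1 distance
    is at least 1/2; they cannot converge in L^1 along a nonprincipal ultrafilter. *)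
Lemma oscillation (U : set_system nat) (Uu : ultrafilter_nat U) : nonprincipal U ->
  exists x : useq R, [/\ forall n, meas (x n), forall n t, `|x n t| <= 1 &
    forall w, L1 w -> ~ itg (fun t => `|x n t - w t|) @[n --> U] --> 0].
Proof.
move=> Unp; pose x n t : R := cos (n.+1%:R * pi * t).
have mx n : meas (x n) by exact: cos_meas.
have x1 n t : `|x n t| <= 1 by rewrite ler_norml cos_geN1 cos_le1.
exists x; split=> // w Lw h.
have L1x n : L1 (x n) by apply: (Lp_L1 (lexx 1)); exact: (Lp_bounded _ (mx n) (x1 n)).
(* Two cosines within 1/8 of [w] are within 1/4 of each other. *)
have h8 : 0 < 8^-1 :> R by rewrite invr_gt0.
have Un := ucvg0_near (Uu := Uu) h h8.
have [m Pm _] := unear_ex2 (Uu := Uu) Un Un.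
have [n Pn mn] := unear_ex2 (Uu := Uu) Un (unear_ge Unp m.+1).
have d1 : itg (fun t => `|x n t - x m t|) <= 4^-1.
  apply: (@le_trans _ _ (itg (fun t => `|x n t - w t|) + itg (fun t => `|x m t - w t|))).
    rewrite -itgD; [|exact/L1_norm/L1B..].
    apply: itg_le; [exact/L1_norm/L1B|by apply: L1D; exact/L1_norm/L1B|move=> t].
    rewrite (_ : x n t - x m t = (x n t - w t) - (x m t - w t)); last by ring.
    exact: ler_normB.
  have := lerD (le_trans (ler_norm _) Pn) (le_trans (ler_norm _) Pm); lra.
pose C k (t : R) : R := cos (k.+1%:R * pi * t).
have LC k : L1 (C k).
  by apply: (Lp_L1 (lexx 1)); exact: (Lp_bounded _ (mx k) (x1 k)).
(* [C k] has frequency index [k + 1], hence the predecessor in the last term. As [n > m], all the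
   cosines on the right have positive frequency and integrate to zero. *)
have sq t : (x n t - x m t) ^+ 2 = 1 + 2^-1 * C (n.*2.+1) t + 2^-1 * C (m.*2.+1) t
    - C (n + m).+1 t - C (n - m).-1 t.
  rewrite /C /x prednK ?subn_gt0 // natrB ?(ltnW mn) //.
  set a := n.+1%:R * pi * t; set b := m.+1%:R * pi * t.
  rewrite (_ : n.*2.+2%:R * pi * t = a *+ 2); last first.
    by rewrite /a -doubleS -muln2 natrM; ring.
  rewrite (_ : m.*2.+2%:R * pi * t = b *+ 2); last first.
    by rewrite /b -doubleS -muln2 natrM; ring.
  rewrite (_ : (n + m).+2%:R * pi * t = a + b); last first.
    by rewrite /a /b -addSn -addnS natrD; ring.
  rewrite (_ : (n%:R - m%:R) * pi * t = a - b); last first.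
    by rewrite /a /b -!natr1; ring.
  rewrite !cos_mulr2n cosD cosB; by field.
have i1 : itg (fun t => (x n t - x m t) ^+ 2) = 1.
  rewrite (_ : (fun t => _) = fun t => 1 + 2^-1 * C (n.*2.+1) t + 2^-1 * C (m.*2.+1) t
    - C (n + m).+1 t - C (n - m).-1 t); last by apply/funext => t; exact: sq.
  have La := L1D (L1_cst 1) (L1Z 2^-1 (LC n.*2.+1)).
  have Lb := L1D La (L1Z 2^-1 (LC m.*2.+1)).
  have Lc := L1B Lb (LC (n + m).+1).
  rewrite (itgB Lc (LC _)) (itgB Lb (LC _)) (itgD La (L1Z _ (LC _))).
  rewrite (itgD (L1_cst 1) (L1Z _ (LC _))) !itgZ // itg_cst /C !itg_cos !mulr0 !subr0 !addr0.
  by [].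
have : 1 <= 2 * itg (fun t => `|x n t - x m t|).
  rewrite -{1}i1 -itgZ; last exact/L1_norm/L1B.
  have Lm : L1 (fun t => 2 * `|x n t - x m t|) by exact/L1Z/L1_norm/L1B.
  have pt t : `|(x n t - x m t) ^+ 2| <= 2 * `|x n t - x m t|.
    rewrite normrX expr2 ler_wpM2r // (le_trans (ler_normB _ _)) //.
    by have := x1 n t; have := x1 m t; lra.
  apply: itg_le => // [|t]; last exact: le_trans (ler_norm _) (pt t).
  apply: (L1_le _ pt Lm).
  by have := measM (measB (mx n) (mx m)) (measB (mx n) (mx m)).
lra.
Qed.

End examples.

(** * Comparison with the concrete definitions *)

Section translation.
Context {R : realType} (U : set_system nat) {Uu : ultrafilter_nat U}.
Variables (p q : R).
Hypothesis pq : conj_exp p q.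
Implicit Types (x y z psi : useq R) (S : useq R -> useq R) (phi : useq R -> R).

Lemma UP_ubdd x : UP p x <-> ubdd p x.
Proof. by rewrite /UP /ubdd LP.unlock nrm.unlock. Qed.

Lemma unormP x l : unorm p U x l <-> nrm p (x n) @[n --> U] --> l.
Proof. by rewrite nrm.unlock; exact: ulim_cvg. Qed.

Lemma ueqP x y : ueq p U x y <-> unull U p (usub x y).
Proof. exact: unormP. Qed.

Lemma unorm_unm x l : ubdd p x -> unorm p U x l <-> l = unm U p x.
Proof.
move=> bx; split=> [/unormP h|->]; last by apply/unormP; exact: unmP.
by rewrite (unmE h).
Qed.

Lemma pairing_dualfun g : LP q g -> dualfun p (fun f => pairing f g).
Proof.
move=> Lg; split=> [f h Lf Lh|c f Lf|]; first exact: (pairingDl pq).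
  exact: (pairingZl pq).
by exists (nrm q g) => f Lf; rewrite mulrC; exact: (pairing_le pq).
Qed.

Lemma LhatP x : Lhat p U x <-> wnull U p q x.
Proof.
split=> [[/UP_ubdd bx h]|[bx wx]]; split.
- by [].
- move=> y Ly; apply/ulim_cvg; apply: (h (fun f => pairing f y)).
  exact/LpDualP/pairing_dualfun.
- exact/UP_ubdd.
- move=> phi /LpDualP /(riesz pq)[g Lg Hg]; apply/ulim_cvg.
  by under eq_fun do rewrite (Hg _ (bx.1 _)); exact: wx.
Qed.

Lemma LconstP x : Lconst p U x <->
  ubdd p x /\ exists2 f, LP p f & unull U p (usub x (fun=> f)).
Proof.
split=> [[/UP_ubdd bx [f [Lf /ueqP h]]]|[bx [f Lf h]]]; split=> //.
- by exists f => //; rewrite LP.unlock.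
- exact/UP_ubdd.
- by exists f; split; [rewrite LP.unlock in Lf|exact/ueqP].
Qed.

Lemma UOpP S : UOp p U S <-> ulinop U p S /\
  exists C : R, forall x, ubdd p x -> unm U p (S x) <= C * unm U p x.
Proof.
split.
  move=> [Sb [Seq [SD [SZ [C SC]]]]].
  have Sbdd x : ubdd p x -> ubdd p (S x) by move=> /UP_ubdd bx; exact/UP_ubdd/Sb.
  split; first split=> // [x y bx by_ xy|x y bx by_|a x bx].
  - by apply/ueqP; apply: Seq; [exact/UP_ubdd|exact/UP_ubdd|exact/ueqP].
  - by apply/ueqP; apply: SD; exact/UP_ubdd.
  - by apply/ueqP; apply: SZ; exact/UP_ubdd.
  exists C => x bx; apply: (SC x); first exact/UP_ubdd.
    exact/unorm_unm.
  by apply/unorm_unm => //; exact: Sbdd.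
move=> [[Sb Seq SD SZ] [C SC]]; split; last split; last split; last split.
- by move=> x /UP_ubdd bx; exact/UP_ubdd/Sb.
- by move=> x y /UP_ubdd bx /UP_ubdd by_ /ueqP xy; exact/ueqP/Seq.
- by move=> x y /UP_ubdd bx /UP_ubdd by_; exact/ueqP/SD.
- by move=> a x /UP_ubdd bx; exact/ueqP/SZ.
- exists C => x a b /UP_ubdd bx /(unorm_unm _ bx)-> /(unorm_unm _ (Sb _ bx))->.
  exact: SC.
Qed.

Lemma upair_UDual psi : ubdd q psi -> UDual p U (fun x => upair U x psi).
Proof.
move=> bpsi; split; last split; last split.
- move=> x y /UP_ubdd bx /UP_ubdd by_ /ueqP h.
  apply/eqP; rewrite -subr_eq0 -(upairBl pq bx by_ bpsi) (upair_null pq) //.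
  exact: (ubddB pq).
- by move=> x y /UP_ubdd bx /UP_ubdd by_; exact: (upairDl pq).
- by move=> a x /UP_ubdd bx; exact: (upairZl pq).
- have [_ [K psiK]] := bpsi; exists K => x a /UP_ubdd bx /unormP xa.
  by rewrite mulrC; exact: (upair_le pq).
Qed.

Lemma UDual_sub phi : UDual p U phi -> exists2 C : R, 0 <= C &
  forall x y, ubdd p x -> ubdd p y -> `|phi x - phi y| <= C * unm U p (usub x y).
Proof.
move=> [_ [phiD [phiZ [C phiC]]]]; exists `|C| => // x y bx by_.
have bxy := ubddB pq bx by_.
have -> : phi x - phi y = phi (usub x y).
  rewrite usubE phiD ?phiZ ?mulN1r //; try exact/UP_ubdd.
  exact/UP_ubdd/(ubddZ pq).
apply: (le_trans (phiC _ (unm U p (usub x y)) _ _)); first exact/UP_ubdd.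
  exact/unorm_unm.
by apply: ler_wpM2r; [exact: unm_ge0|exact: ler_norm].
Qed.

Lemma wnull_upair x : wnull U p q x <->
  ubdd p x /\ forall f, LP q f -> upair U x (fun=> f) = 0.
Proof.
split=> [wx|[bx h]]; first by split=> [|f Lf]; [exact: wx.1|exact: (upair_cst wx)].
by split=> // f Lf; rewrite -(h f Lf); apply: (upairP pq) => //; exact: ubdd_cst.
Qed.

Lemma upair_cst0 f psi : LP p f -> wnull U q p psi -> upair U (fun=> f) psi = 0.
Proof. by move=> Lf wpsi; rewrite upairC; exact: (upair_cst wpsi). Qed.

Section annihilator.
Variable N : set (useq R).
Hypothesis Nw : N `<=` wnull U q p.
Let Nb : N `<=` ubdd q. Proof. by move=> x /Nw[]. Qed.

Lemma annih_subspace : usubspace p U (annih U p q N).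
Proof.
split; last split; last split; last split.
- by move=> x [[bx _] _]; exact/UP_ubdd.
- by move=> x y Mx /UP_ubdd by_ /ueqP; exact: (annih_eq pq).
- split; first exact: (wnull0 pq).
  move=> psi Npsi; apply: (upair_null pq); [exact: ubdd0|exact: Nb|exact: (unull0 pq)].
- by move=> x y Mx My; apply: (annihD pq).
- by move=> a x Mx; apply: (annihZ pq).
Qed.

Lemma annih_closed : uclosed p U (annih U p q N).
Proof.
move=> x /UP_ubdd bx H.
have key psi : ubdd q psi -> (forall y, annih U p q N y -> upair U y psi = 0) ->
    upair U x psi = 0.
  move=> bpsi psi0; apply/eqP; rewrite -normr_le0; apply/ler_addgt0Pl => e e0.
  have [K K0 psiK] := ubdd_pos bpsi.
  have [y [r [My [/unormP xy re]]]] := H (e / K) (divr_gt0 e0 K0).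
  have by_ : ubdd p y by case: My => -[].
  rewrite addr0 -[upair _ _ _]subr0 -{1}(psi0 y My) -(upairBl pq bx by_ bpsi).
  apply: (le_trans (upair_le pq (ubddB pq bx by_) bpsi xy psiK)).
  by rewrite -ler_pdivlMr // ltW.
split; last by move=> psi Npsi; apply: key; [exact: Nb|move=> y [_ My]; exact: My].
apply/wnull_upair; split=> // f Lf; apply: key; first exact: ubdd_cst.
by move=> y [wy _]; exact: (upair_cst wy).
Qed.

End annihilator.

(** * Complementation *)

(** The component in [M] is chosen for each representative separately. As [M] and [Mc] meet in null
    sequences only, it is unique modulo null sequences, which makes the choice linear; the termwise
    norm bound makes it contractive. *)
Lemma annih_complemented (M Mc : set (useq R)) :
  M `<=` wnull U p q -> (forall x y, M x -> M y -> M (uadd x y)) ->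
  (forall a x, M x -> M (uscale a x)) ->
  (forall x y, Mc x -> Mc y -> Mc (uadd x y)) -> (forall a x, Mc x -> Mc (uscale a x)) ->
  (forall x, ubdd p x -> unull U p x -> Mc x) ->
  (forall x, M x -> Mc x -> unull U p x) ->
  (forall x, wnull U p q x -> exists2 y, M y &
     Mc (usub x y) /\ forall n, nrm p (y n) <= nrm p (x n)) ->
  complemented_in p U (Lhat p U) M.
Proof.
move=> Mw MD MZ McD McZ Mc0 MMc H.
have Mb x : M x -> ubdd p x by move=> /Mw[].
have uniq z u v : M u -> M v -> Mc (usub z u) -> Mc (usub z v) -> unull U p (usub u v).
  move=> Mu Mv Mcu Mcv; apply: MMc; first by rewrite usubE; apply: MD => //; exact: MZ.
  have -> : usub u v = uadd (usub z v) (uscale (-1) (usub z u)).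
    by apply/funext => n; apply/funext => t; rewrite /uadd /usub /uscale /fadd /fsub /fscale; ring.
  by apply: McD => //; exact: McZ.
have HH x : exists y, wnull U p q x -> [/\ M y,
    Mc (usub x y) & forall n, nrm p (y n) <= nrm p (x n)].
  have [wx|nwx] := pselect (wnull U p q x); last by exists x.
  by have [y My [h1 h2]] := H x wx; exists y.
have [P HP] := choice HH; exists P; split; last split; last split; last split; last split.
- by move=> x /LhatP /HP[].
- move=> x y /LhatP wx /LhatP wy /ueqP xy; apply/ueqP.
  have [Px Pcx _] := HP x wx; have [Py Pcy _] := HP y wy.
  apply: (uniq x) => //; have -> : usub x (P y) = uadd (usub x y) (usub y (P y)).
    by apply/funext => n; apply/funext => t; rewrite /uadd /usub /fadd /fsub; ring.
  by apply: McD => //; apply: Mc0 => //; apply: (ubddB pq); [exact: wx.1|exact: wy.1].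
- move=> x y /LhatP wx /LhatP wy; apply/ueqP.
  have [Px Pcx _] := HP x wx; have [Py Pcy _] := HP y wy.
  have [Pxy Pcxy _] := HP _ (wnullD pq wx wy).
  apply: (uniq (uadd x y)) => //; first exact: MD.
  have -> : usub (uadd x y) (uadd (P x) (P y)) = uadd (usub x (P x)) (usub y (P y)).
    by apply/funext => n; apply/funext => t; rewrite /uadd /usub /fadd /fsub; ring.
  exact: McD.
- move=> a x /LhatP wx; apply/ueqP.
  have [Px Pcx _] := HP x wx; have [Pax Pcax _] := HP _ (wnullZ pq a wx).
  apply: (uniq (uscale a x)) => //; first exact: MZ.
  have -> : usub (uscale a x) (uscale a (P x)) = uscale a (usub x (P x)).
    by apply/funext => n; apply/funext => t; rewrite /uscale /usub /fscale /fsub; ring.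
  exact: McZ.
- exists 1 => x a b /LhatP wx /unormP xa /unormP Pb; rewrite mul1r.
  have [_ _ le] := HP x wx.
  by apply: (ler_cvg_to Pb xa); exact: nearW.
- move=> m Mm; apply/ueqP; have [Pm Pcm _] := HP m (Mw _ Mm).
  apply: (uniq m) => //; rewrite usubxx; apply: Mc0; first exact: ubdd0.
  exact: (unull0 pq).
Qed.

(** * The weak operator closure *)

Section closure.
Variable S : useq R -> useq R.
Hypotheses (oS : UOp p U S) (wS : WOT_closure_ultraops p U S).

Let Sb x : ubdd p x -> ubdd p (S x). Proof. by case/UOpP: oS => -[h _ _ _] _; exact: h. Qed.

(** A weak neighbourhood given by one vector and one functional; invariance passes to the closure
    once it is expressed by annihilation. *)
Lemma closure_annih x psi : ubdd p x -> ubdd q psi ->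
  (forall T, bop p T -> upair U (fun n => T (x n)) psi = 0) -> upair U (S x) psi = 0.
Proof.
move=> bx bpsi H; apply/eqP; rewrite -normr_le0; apply/ler_addgt0Pl => e e0; rewrite addr0.
have [|i|T [/LpOpP bT h]] := wS (k := 1) (xs := fun=> x) (phis := fun=> upair U ^~ psi) e0.
- by move=> _; exact/UP_ubdd.
- exact: upair_UDual.
have := h ord0; rewrite (_ : upair U (ultraop T x) psi = 0); last exact: H.
by rewrite subr0 => /ltW.
Qed.

Lemma closure_wnull : uinvariant S (Lhat p U).
Proof.
move=> x /LhatP wx; apply/LhatP/wnull_upair; split=> [|f Lf]; first exact/Sb/wx.1.
apply: closure_annih; [exact: wx.1|exact: ubdd_cst|move=> T bT].
exact: (upair_cst (bop_wnull pq bT wx)).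
Qed.

(** A class is constant when every weakly null [psi] annihilates it: its difference from its weak
    limit is then null by [wnull_separated]. *)
Lemma closure_const : uinvariant S (Lconst p U).
Proof.
move=> x /LconstP[bx [f Lf xf]]; have bSx := Sb bx; apply/LconstP; split=> //.
have [g Lg wg] := weak_limit (Uu := Uu) pq bSx; exists g => //.
apply: (wnull_separated pq wg) => psi wpsi; have bpsi := wpsi.1.
rewrite (upairBl pq bSx (ubdd_cst Lg) bpsi) (upair_cst0 Lg wpsi) subr0.
apply: closure_annih => // T bT.
have [b1 b2 _ _] := ulinop_ultraop (Uu := Uu) pq bT.
have bf := ubdd_cst Lf.
have LTf := bop_LP bT Lf.
have bTx : ubdd p (fun n => T (x n)) := b1 x bx.
have := upair_null (Uu := Uu) pq (ubddB pq bTx (ubdd_cst LTf)) bpsi (b2 _ _ bx bf xf).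
by rewrite (upairBl pq bTx (ubdd_cst LTf) bpsi) (upair_cst0 LTf wpsi) subr0.
Qed.

Lemma closure_annih_invariant (N : set (useq R)) : N `<=` wnull U q p ->
  (forall T x, bop p T -> annih U p q N x -> annih U p q N (fun n => T (x n))) ->
  uinvariant S (annih U p q N).
Proof.
move=> Nw bopM x [wx Mx]; split; first exact/LhatP/closure_wnull/LhatP.
move=> psi Npsi; apply: closure_annih; [exact: wx.1|by case: (Nw _ Npsi)|].
by move=> T bT; have [_] := bopM T x bT (conj wx Mx); apply.
Qed.

End closure.

Lemma closure_good S : UOp p U S -> (forall (xs : nat -> useq R) k,
    (forall j, (j < k)%N -> ubdd p (xs j)) -> good U p S xs k) ->
  WOT_closure_ultraops p U S.
Proof.
move=> /UOpP[lS _] H k xs phis e e0 bxs dphi.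
have [C HC] := @choice _ _ (fun i (C : R) => 0 <= C /\ forall x y, ubdd p x -> ubdd p y ->
  `|phis i x - phis i y| <= C * unm U p (usub x y))
  (fun i => let: ex_intro2 C C0 h := UDual_sub (dphi i) in ex_intro _ C (conj C0 h)).
pose K := 1 + \sum_i C i.
have CK i : C i <= K.
  rewrite /K (bigD1 i) //= addrCA lerDl addr_ge0 // sumr_ge0 // => j _.
  by have [] := HC j.
have K0 : 0 < K by rewrite ltr_pwDl // sumr_ge0 // => j _; have [] := HC j.
pose xs' j : useq R := oapp xs (fun _ _ => 0) (insub j).
have xsE (i : 'I_k) : xs' i = xs i by rewrite /xs' valK.
have bxs' j : (j < k)%N -> ubdd p (xs' j).
  by move=> jk; rewrite -[j]/(val (Ordinal jk)) xsE; exact/UP_ubdd.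
have d0 : 0 < e / 2 / K by rewrite !divr_gt0.
have [T bT HT] := H xs' k bxs' _ d0.
exists T; split; first exact/LpOpP.
move=> i; have bx : ubdd p (xs i) by exact/UP_ubdd.
have [Sb _ _ _] := lS; have [C0 hC] := HC i.
apply: (le_lt_trans (hC _ _ (Sb _ bx) (bop_ubdd bT bx))).
have := HT i (ltn_ord i); rewrite /defect xsE => h.
apply: (le_lt_trans (ler_pM C0 (unm_ge0 (ubddB pq (Sb _ bx) (bop_ubdd bT bx))) (CK i) h)).
by rewrite mulrC divfK ?gt_eqF // ltr_pdivrMr // ltr_pMr // ltr1n.
Qed.

(** * Uniqueness *)

Section rank_one.
Variables psi y : useq R.
Hypotheses (wpsi : wnull U q p psi) (wy : wnull U p q y).

(** An operator on the ultrapower itself. It kills the constants and has weakly null values, so its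
    membership in the weak closure is decided by the third subspace alone. *)
Definition rank_one x : useq R := uscale (upair U x psi) y.

Let bpsi : ubdd q psi := wpsi.1.
Let by_ : ubdd p y := wy.1.

Lemma rank_one_UOp : UOp p U rank_one.
Proof.
apply/UOpP; split; first split=> [x bx|x z bx bz xz|x z bx bz|a x bx].
- exact: (ubddZ pq).
- have := upair_null (Uu := Uu) pq (ubddB pq bx bz) bpsi xz.
  rewrite (upairBl pq bx bz bpsi) /rank_one => /eqP; rewrite subr_eq0 => /eqP->.
  exact: (unull_refl pq).
- have -> : rank_one (uadd x z) = uadd (rank_one x) (rank_one z).
    rewrite /rank_one (upairDl pq bx bz bpsi); apply/funext => n; apply/funext => t.
    by rewrite /uadd /uscale /fadd /fscale mulrDl.
  exact: (unull_refl pq).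
- have -> : rank_one (uscale a x) = uscale a (rank_one x).
    rewrite /rank_one (upairZl pq a bx bpsi); apply/funext => n; apply/funext => t.
    by rewrite /uscale /fscale mulrA.
  exact: (unull_refl pq).
have [K K0 psiK] := ubdd_pos bpsi.
exists (K * unm U p y) => x bx; rewrite /rank_one (unmZ pq) // mulrAC.
apply: ler_wpM2r; first exact: unm_ge0.
by rewrite mulrC; apply: (upair_le pq) => //; exact: unmP.
Qed.

Lemma rank_one_Lhat : uinvariant rank_one (Lhat p U).
Proof. by move=> x _; apply/LhatP; exact: (wnullZ pq). Qed.

Lemma uscale0 x : uscale 0 x = @uzero R.
Proof. by apply/funext => n; apply/funext => t; rewrite /uscale /fscale mul0r. Qed.

Lemma rank_one_eq0 x : upair U x psi = 0 -> rank_one x = @uzero R.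
Proof. by rewrite /rank_one => ->; exact: uscale0. Qed.

Lemma rank_one_Lconst : uinvariant rank_one (Lconst p U).
Proof.
move=> x /LconstP[bx [f Lf xf]].
have := upair_null (Uu := Uu) pq (ubddB pq bx (ubdd_cst Lf)) bpsi xf.
rewrite (upairBl pq bx (ubdd_cst Lf) bpsi) (upair_cst0 Lf wpsi) subr0 => /rank_one_eq0 ->.
apply/LconstP; split; first exact: ubdd0.
by exists (fun=> 0); [exact: Lp_cst|exact: (unull_refl pq)].
Qed.

End rank_one.

Definition wot_characterization (M : set (useq R)) : Prop := forall S, UOp p U S ->
  (WOT_closure_ultraops p U S <->
   uinvariant S (Lconst p U) /\ uinvariant S (Lhat p U) /\ uinvariant S M).

(** Invariance of [M] puts the operator into the weak closure, which [M'] describes as well. *)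
Lemma wot_transfer (M M' : set (useq R)) psi y :
  wot_characterization M -> wot_characterization M' ->
  wnull U q p psi -> wnull U p q y ->
  uinvariant (rank_one psi y) M -> uinvariant (rank_one psi y) M'.
Proof.
move=> cM cM' wpsi wy h; have o := rank_one_UOp wpsi wy.
have w : WOT_closure_ultraops p U (rank_one psi y).
  by apply/(cM _ o); split; [exact: rank_one_Lconst|split=> //; exact: rank_one_Lhat].
by have [_ []] := (cM' _ o).1 w.
Qed.

(* Rank one operators leave only [0], [M] and the whole of [Lhat] as candidates. *)
Lemma wot_unique (N M' : set (useq R)) :
  N `<=` wnull U q p ->
  (exists2 m, annih U p q N m & ~ unull U p m) ->
  (exists2 y, wnull U p q y & ~ annih U p q N y) ->
  wot_characterization (annih U p q N) ->
  M' `<=` Lhat p U -> usubspace p U M' -> wot_characterization M' ->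
  M' = annih U p q N.
Proof.
set M := annih U p q N => Nw [m Mm nm] [y wy nMy] cM M'L [_ [_ [M'0 [_ M'Z]]]] cM'.
have M0 : M (@uzero R) by have [_ [_ []]] := annih_subspace Nw.
have MZ a x : M x -> M (uscale a x) by have [_ [_ [_ [_ h]]]] := annih_subspace Nw; exact: h.
have scK (A : set (useq R)) a x : (forall b z, A z -> A (uscale b z)) -> a != 0 ->
    A (uscale a x) -> A x.
  move=> AZ a0 /(AZ a^-1); congr A; apply/funext => n; apply/funext => t.
  by rewrite /uscale /fscale mulKf.
have sep x : wnull U p q x -> ~ unull U p x -> exists2 psi, wnull U q p psi & upair U x psi != 0.
  move=> wx nx; apply: contrapT => h; apply: nx; apply: (wnull_separated pq wx) => psi wpsi.
  by apply/eqP; apply: contrapT => /negP h'; apply: h; exists psi.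
have [psi wpsi mpsi] := sep m Mm.1 nm.
(* [psi] does not kill [m], and [y] lies outside [M], so [m] is sent out of [M]. *)
have nS : ~ uinvariant (rank_one psi y) M.
  by move=> /(_ m Mm) h; apply: nMy; exact: scK MZ mpsi h.
have [sub|/existsNP[x' /not_implyP[M'x' nMx']]] := pselect (forall x, M' x -> M x).
  (* If [M'] were zero, the operator of [nS] would leave it invariant, hence also [M]. *)
  have [all0|/existsNP[m' /not_implyP[M'm' nm']]] := pselect (forall x, M' x -> unull U p x).
    exfalso; apply: nS; apply: (wot_transfer cM' cM) => // x M'x.
    rewrite rank_one_eq0 // (upair_null pq) //; [by case: (sub _ M'x) => -[]| |exact: all0].
    exact: wpsi.1.
  have [chi wchi mchi] := sep m' (sub _ M'm').1 nm'.
  (* [chi] tensor [z] leaves [M] invariant, hence [M'], and sends [m'] to a nonzero multiple of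
     [z]. *)
  apply/seteqP; split=> // z Mz; apply: (scK _ _ _ M'Z mchi).
  apply: (wot_transfer cM cM' wchi Mz.1 _ M'm') => x _.
  exact: MZ.
have wx' : wnull U p q x' by exact/LhatP/M'L.
have [chi Nchi xchi] : exists2 chi, N chi & upair U x' chi != 0.
  apply: contrapT => h; apply: nMx'; split=> // chi Nchi.
  by apply/eqP; apply: contrapT => /negP h'; apply: h; exists chi.
(* [chi] in [N] kills [M], so [chi] tensor [z] leaves [M], hence [M'], invariant for every weakly
   null [z]. Thus [M'] is the whole weakly null part, which the operator of [nS] preserves. *)
have full z : wnull U p q z -> M' z.
  move=> wz; apply: (scK _ _ _ M'Z xchi).
  apply: (wot_transfer cM cM' (Nw _ Nchi) wz _ M'x') => x [_ Mx].
  by rewrite rank_one_eq0 //; exact: Mx.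
exfalso; apply: nS; apply: (wot_transfer cM' cM) => // x _.
by apply: full; apply: (wnullZ pq).
Qed.

End translation.

(** * The two ranges of exponents *)

Section main.
Context {R : realType} (U : set_system nat) {Uu : ultrafilter_nat U}.
Hypotheses (Unp : nonprincipal U) (Usel : selective U).
Variables (p q : R).
Hypothesis pq : conj_exp p q.
Implicit Types (x y z psi g : useq R) (S : useq R -> useq R).

Let p1 : 1 < p. Proof. by case: pq. Qed.
Let p0 : 0 < p. Proof. exact: lt_trans p1. Qed.
Let p0w : 0 <= p. Proof. exact: ltW. Qed.
Let qp := conj_expC pq.

Lemma annih_characterization (N M0 : set (useq R)) : N `<=` wnull U q p ->
  (forall u v, N u -> N v -> N (uadd u v)) -> (forall a u, N u -> N (uscale a u)) ->
  (forall psi g, N psi -> wnull U p q g -> admissible U p q g psi) ->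
  M0 `<=` annih U p q N ->
  (forall x, annih U p q N x -> forall d : R, 0 < d ->
     exists2 g, M0 g & unm U p (usub x g) <= d) ->
  (forall psi g, wnull U q p psi -> M0 g -> admissible U p q g psi) ->
  (forall T x, bop p T -> annih U p q N x -> annih U p q N (fun n => T (x n))) ->
  wot_characterization U p (annih U p q N).
Proof.
move=> Nw ND NZ adC M0M M0d adB bopM S oS; split=> [wS|[Sc [Sw SM]]].
  split; first exact: (closure_const pq oS wS).
  split; first exact: (closure_wnull pq oS wS).
  exact: (closure_annih_invariant pq oS wS).
apply: (closure_good pq) => // xs k bxs.
have /UOpP[lS _] := oS.
apply: (good_all Unp Usel pq Nw ND NZ adC M0M M0d adB bopM lS) => //.
- by move=> x wx; apply/(LhatP pq); exact/Sw/(LhatP pq).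
- move=> f Lf; have /Sc /LconstP[_ [g Lg h]] : Lconst p U (fun=> f); last by exists g.
  apply/LconstP; split; first exact: ubdd_cst.
  by exists f => //; exact: (unull_refl pq).
Qed.

Lemma oscillation_away_from_cst : exists x : useq R, [/\ forall n, meas (x n),
  forall n t, `|x n t| <= 1 & forall w, LP p w ->
    ~ itg (fun t => `|usub x (fun=> w) n t|) @[n --> U] --> 0].
Proof.
have [x [mx x1 H]] := oscillation (R := R) Uu Unp; exists x; split=> // w Lw.
by apply: H; apply: Lp_L1 Lw; exact: ltW.
Qed.

Lemma nrm_trunc_le K (f : R -> R) : LP p f -> nrm p (trunc K f) <= nrm p f.
Proof.
move=> Lf; apply: lpn_mono => //; first exact: Lp_trunc.
by move=> t; exact: trunc_le.
Qed.

Lemma nrm_sub_trunc_le K (f : R -> R) : LP p f -> nrm p (fsub f (trunc K f)) <= nrm p f.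
Proof.
move=> Lf; apply: lpn_mono => //; first by apply: LpB => //; exact: Lp_trunc.
by move=> t; exact: trunc_sub_le.
Qed.

Lemma usubKC x y : usub x (usub x y) = y.
Proof. by apply/funext => n; apply/funext => t; rewrite /usub /fsub subKr. Qed.

(** * Exponents above 2 *)

Section above2.
Hypothesis p2 : 2 < p.
Let q2 : q < 2. Proof. exact: conj_exp_gt2 pq p2. Qed.
Local Notation N := (W2 U q p).
Local Notation M := (annih U p q N).

Let Nw : N `<=` wnull U q p. Proof. by move=> psi; exact: (W2_wnull qp q2). Qed.
Let MP x : M x <-> Dz U p x.
Proof. by have h := Dz_annih (Uu := Uu) pq x p2; split=> /h. Qed.

(** Tests in [W2] have the exponent 2, as have all weakly null targets in L^p. Targets in [Dz] have
    the exponent [p], conjugate to the exponent [q] of all weakly null tests. *)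
Lemma characterization_above2 : wot_characterization U p M.
Proof.
apply: (@annih_characterization _ (Dz U p)) => //.
- by move=> u v; exact: (W2D qp).
- by move=> a u; exact: (W2Z qp).
- move=> psi g Npsi wg; exists 2, 2; split; first exact: conj_exp22.
    by have := upper_wnull (Uu := Uu) pq wg; rewrite min_r // ltW.
  exact: (upper_W2 qp q2).
- by move=> x Dx; exact/MP.
- move=> x Mx d d0; exists x; first exact/MP.
  by rewrite usubxx (unm_null _).1 ?ltW //; [exact: ubdd0|exact: (unull0 pq)].
- move=> psi g wpsi Dg; exists p, q; split=> //; first exact: (upper_Dz pq).
  by have := upper_wnull (Uu := Uu) qp wpsi; rewrite min_l // ltW.
- by move=> T x bT /MP Dx; apply/MP; exact: (bop_Dz pq).
Qed.

(** The complement is the uniformly integrable part; the projection keeps what exceeds the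
    truncation levels. *)
Lemma complemented_above2 : complemented_in p U (Lhat p U) M.
Proof.
apply: (@annih_complemented _ _ _ _ _ pq _ (Bz U p q)).
- by move=> x [].
- by move=> x y /MP Dx /MP Dy; apply/MP; exact: (DzD pq).
- by move=> a x /MP Dx; apply/MP; exact: (DzZ pq).
- by move=> x y; exact: (BzD pq).
- by move=> a x; exact: (BzZ pq).
- by move=> x; exact: (unull_Bz pq).
- by move=> x /MP; exact: (Dz_Bz_null pq).
- move=> x wx; have [K /= [_ Bb Dd]] := split_seq Unp pq wx.1.
  exists (usub x (fun n => trunc (K n)%:R (x n))); first exact/MP.
  by split=> [|n]; [rewrite usubKC|exact: (nrm_sub_trunc_le _ (wx.1.1 n))].
Qed.

Lemma nonzero_above2 : exists2 m, M m & ~ unull U p m.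
Proof. by have [m Dm nm] := spikes Uu Unp p1; exists m => //; exact/MP. Qed.

Lemma proper_above2 : exists2 y, wnull U p q y & ~ M y.
Proof.
have [x [mx x1 H]] := oscillation_away_from_cst.
have [bx _] := Bz_bounded (U := U) pq mx x1.
have [w Lw wxw] := weak_limit (Uu := Uu) pq bx.
by exists (usub x (fun=> w)) => // /MP[_]; exact: H.
Qed.

End above2.

(** * Exponents below 2 *)

Section below2.
Hypothesis p2 : p < 2.
Let q2 : 2 < q. Proof. exact: conj_exp_lt2 pq p2. Qed.
Local Notation N := (Dz U q).
Local Notation M := (annih U p q N).

Let Nw : N `<=` wnull U q p. Proof. by move=> psi; exact: (Dz_wnull qp). Qed.
Let MP x : M x <-> wnull U p q x /\ Bz U p q x.
Proof.
by split=> -[wx h]; split=> //; move: h; have h := BzP (Uu := Uu) pq wx.1; move/h.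
Qed.

(** The same exponents with the roles of tests and targets exchanged. Invariance of [M] is that of
    [Dz] in L^q under the adjoint operator, where [q > 2]. *)
Lemma characterization_below2 : wot_characterization U p M.
Proof.
apply: (@annih_characterization _ (W2 U p q)) => //.
- by move=> u v; exact: (DzD qp).
- by move=> a u; exact: (DzZ qp).
- move=> psi g Npsi wg; exists p, q; split=> //; last exact: (upper_Dz qp).
  by have := upper_wnull (Uu := Uu) pq wg; rewrite min_l // ltW.
- by move=> x Wx; apply/MP; split; [exact: (W2_wnull pq p2)|case: Wx].
- by move=> x /MP[wx Bx] d d0; exact: (W2_dense Unp pq p2).
- move=> psi g wpsi Wg; exists 2, 2; split; first exact: conj_exp22.
    exact: (upper_W2 pq p2).
  by have := upper_wnull (Uu := Uu) qp wpsi; rewrite min_r // ltW.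
- move=> T x bT [wx Mx]; split; first exact: (bop_wnull pq bT).
  have [T' bT' HT'] := adjoint pq bT.
  move=> psi Dpsi; rewrite -(Mx _ (bop_Dz qp q2 bT' Dpsi)) /upair.
  by under eq_fun do rewrite (HT' _ _ (wx.1.1 _) (Dpsi.1.1 _)).
Qed.

Lemma complemented_below2 : complemented_in p U (Lhat p U) M.
Proof.
apply: (@annih_complemented _ _ _ _ _ pq _ (Dz U p)).
- by move=> x [].
- move=> x y /MP[wx Bx] /MP[wy By]; apply/MP.
  by split; [exact: (wnullD pq)|exact: (BzD pq)].
- by move=> a x /MP[wx Bx]; apply/MP; split; [exact: (wnullZ pq)|exact: (BzZ pq)].
- by move=> x y; exact: (DzD pq).
- by move=> a x; exact: (DzZ pq).
- by move=> x; exact: (unull_Dz pq).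
- by move=> x /MP[_ Bx] Dx; exact: (Dz_Bz_null pq).
- move=> x wx; have [K /= [_ Bb Dd]] := split_seq Unp pq wx.1.
  set b := (fun n => _) in Bb Dd; exists b; last first.
    by split=> // n; exact: (nrm_trunc_le _ (wx.1.1 n)).
  (* [b] is weakly null as the difference of [x] and its concentrating part. *)
  apply/MP; split=> //; rewrite -(usubKC x b).
  by apply: (wnullB pq) => //; exact: (Dz_wnull pq).
Qed.

Lemma nonzero_below2 : exists2 m, M m & ~ unull U p m.
Proof.
have [x [mx x1 H]] := oscillation_away_from_cst.
have [w Lw Ww] := bounded_W2 (Uu := Uu) pq p2 mx x1.
have Lpw : LP p w by exact: Lp_exp_le (ltW p2) Lw.
exists (usub x (fun=> w)); first by apply/MP; split; [exact: (W2_wnull pq p2)|case: Ww].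
move=> nx; apply: (H w Lpw); apply: ucvg0_le nx; apply: nearW => n.
rewrite ger0_norm ?itg_ge0 //; apply: itg_norm_le; first exact: ltW.
by have [[Lx _] _] := W2_wnull pq p2 Ww; exact: Lx.
Qed.

Lemma proper_below2 : exists2 y, wnull U p q y & ~ M y.
Proof.
have [m Dm nm] := spikes Uu Unp p1; exists m; first exact: (Dz_wnull pq).
by move=> /MP[_ Bm]; apply: nm; exact: (Dz_Bz_null pq).
Qed.

End below2.

End main.

Theorem theorem1p1 (R : realType) (p : R) (U : set (set nat)) :
  1 < p -> p != 2 ->
  ultrafilter_nat U -> nonprincipal U -> selective U ->
  exists M : set (useq R),
    (M `<=` Lhat p U /\ usubspace p U M /\ uclosed p U M /\
     complemented_in p U (Lhat p U) M /\
     forall S, UOp p U S ->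
       (WOT_closure_ultraops p U S <->
        uinvariant S (Lconst p U) /\ uinvariant S (Lhat p U) /\ uinvariant S M)) /\
    forall M' : set (useq R),
      (M' `<=` Lhat p U /\ usubspace p U M' /\ uclosed p U M' /\
       complemented_in p U (Lhat p U) M' /\
       forall S, UOp p U S ->
         (WOT_closure_ultraops p U S <->
          uinvariant S (Lconst p U) /\ uinvariant S (Lhat p U) /\ uinvariant S M')) ->
      M' = M.
Proof.
move=> p1 p2 Uu Unp Usel; have pq := conj_exp_ex p1; set q := p / (p - 1) in pq.
have qp := conj_expC pq.
suff [N [Nw cM comp nz pr]] : exists N : set (useq R), [/\ N `<=` wnull U q p,
    wot_characterization U p (annih U p q N),
    complemented_in p U (Lhat p U) (annih U p q N),
    exists2 m, annih U p q N m & ~ unull U p m &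
    exists2 y, wnull U p q y & ~ annih U p q N y].
  exists (annih U p q N); split; last first.
    move=> M' [M'L [M's [_ [_ cM']]]].
    exact: (wot_unique pq Nw nz pr cM M'L M's cM').
  split; first by move=> x [wx _]; exact/(LhatP pq).
  split; first exact: (annih_subspace pq Nw).
  by split; first exact: (annih_closed pq Nw).
move: p2; rewrite neq_lt => /orP[p2|p2].
  exists (Dz U q); split.
  - by move=> x; exact: (Dz_wnull qp).
  - exact: (characterization_below2 Unp Usel pq).
  - exact: (complemented_below2 Unp pq).
  - exact: (nonzero_below2 Unp pq).
  - exact: (proper_below2 Unp pq).
exists (W2 U q p); split.
- by move=> x; exact: (W2_wnull qp (conj_exp_gt2 pq p2)).
- exact: (characterization_above2 Unp Usel pq).
- exact: (complemented_above2 Unp pq).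
- exact: (nonzero_above2 Unp pq).
- exact: (proper_above2 Unp pq).
Qed.
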